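(* Let $l\neq 2,3,7$ be a prime. The irreducible factors of $\hat H_{7,l}(x)$ over $\mathbb{F}_l$ are: (i) quadratic, if $l\equiv 1\pmod 7$; (ii) linear or quadratic, if $l\equiv 6\pmod 7$; (iii) $x^2-x+1$ or sextic, if $l\equiv 2,4\pmod 7$; (iv) $x^2-x+1$, cubic or sextic, if $l\equiv 3,5\pmod 7$.
   Context: Let $n_l=\lfloor l/12\rfloor$, $r=\frac{1}{2}\left(1-\left(\frac{-3}{l}\right)\right)$, $s=\frac12\left(1-\left(\frac{-4}{l}\right)\right)$, and $J_l(t)\equiv \sum_{k=0}^{n_l}\binom{2n_l+s}{2k+s}\binom{2n_l-2k}{n_l-k}(-432)^{n_l-k}(t-1728)^k \pmod l$. Let $$j_7(x)=\frac{(x^2-x+1)^3(x^6-11x^5+30x^4-15x^3-10x^2+5x+1)^3}{x^7(x-1)^7(x^3-8x^2+5x+1)}$$ (the $j$-invariant of the Tate normal form $E_7: Y^2+(1+d-d^2)XY+(d^2-d^3)Y=X^3+(d^2-d^3)X^2$ at $d=x$). The Hasse invariant of $E_7$ is $$\hat H_{7,l}(x)=(x^2-x+1)^r(x^6-11x^5+30x^4-15x^3-10x^2+5x+1)^r\,f_2(x)^s\,x^{7n_l}(x-1)^{7n_l}(x^3-8x^2+5x+1)^{n_l}J_l(j_7(x))\in\mathbb{F}_l[x],$$ where $f_2(x)=x^{12}-18x^{11}+117x^{10}-354x^9+570x^8-486x^7+273x^6-222x^5+174x^4-46x^3-15x^2+6x+1$. *)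

(* Defs.v *)
From HB Require Import structures.
From mathcomp Require Import all_boot all_order all_algebra.
Set Implicit Arguments. Unset Strict Implicit. Unset Printing Implicit Defensive.
Import Order.TTheory GRing.Theory Num.Theory.
Local Open Scope ring_scope.

Definition legendre (a : int) (p : nat) : int :=
  if (a %% p%:Z)%Z == 0 then 0
  else if [exists x : 'F_p, x ^+ 2 == a%:~R] then 1 else -1.

Definition n_l (l : nat) : nat := (l %/ 12)%N.
(* r = (1 - (-3/l))/2 ,  s = (1 - (-4/l))/2  (integer halves; for l <> 2,3
   these are 0 or 1).  (-4/l) is the Kronecker symbol, which for an odd
   prime l is the Legendre symbol. *)
Definition r_l (l : nat) : nat := `|((1 - legendre (-3) l) %/ 2)%Z|%N.
Definition s_l (l : nat) : nat := `|((1 - legendre (-4) l) %/ 2)%Z|%N.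

Section H7.
Variable l : nat.
Local Notation F := 'F_l.
Local Notation P := {poly F}.

Definition q1 : P := 'X^2 - 'X + 1.
Definition q2 : P := 'X^6 - 11%:R *: 'X^5 + 30%:R *: 'X^4 - 15%:R *: 'X^3
  - 10%:R *: 'X^2 + 5%:R *: 'X + 1.
Definition c7 : P := 'X^3 - 8%:R *: 'X^2 + 5%:R *: 'X + 1.
Definition f2 : P := 'X^12 - 18%:R *: 'X^11 + 117%:R *: 'X^10 - 354%:R *: 'X^9
  + 570%:R *: 'X^8 - 486%:R *: 'X^7 + 273%:R *: 'X^6 - 222%:R *: 'X^5
  + 174%:R *: 'X^4 - 46%:R *: 'X^3 - 15%:R *: 'X^2 + 6%:R *: 'X + 1.

(* j_7 = num7 / den7 *)
Definition num7 : P := (q1 * q2) ^+ 3.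
Definition den7 : P := 'X^7 * ('X - 1) ^+ 7 * c7.

(* coefficients of J_l(t) = sum_k Jcoef k (t - 1728)^k, reduced mod l *)
Definition Jcoef (k : nat) : F :=
  let n := n_l l in let s := s_l l in
  ('C(2 * n + s, 2 * k + s) * 'C(2 * n - 2 * k, n - k))%:R
    * (- 432%:R) ^+ (n - k).

(* den7^{n_l} * J_l(j_7(x)), computed in F_l[x]:
   sum_k Jcoef k (num7 - 1728 den7)^k den7^(n_l - k). Note
   x^{7n}(x-1)^{7n}(x^3-8x^2+5x+1)^n = den7^n. *)
Definition JdenJ7 : P :=
  \sum_(0 <= k < (n_l l).+1)
     Jcoef k *: ((num7 - 1728%:R *: den7) ^+ k * den7 ^+ (n_l l - k)).

Definition Hhat7 : P :=
  q1 ^+ r_l l * q2 ^+ r_l l * f2 ^+ s_l l * JdenJ7.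

End H7.

(* Main.v *)
Require Import Defs.
From HB Require Import structures.
From mathcomp Require Import all_boot all_order all_algebra all_field.
From mathcomp Require Import zify ring.
Set Implicit Arguments. Unset Strict Implicit. Unset Printing Implicit Defensive.
Import GRing.Theory.
Local Open Scope ring_scope.

(* Let d be a root of an irreducible factor in an algebraic closure of F_l and l = 2k+3.
   Up to a nonzero constant, the value of the Hasse invariant at d is the coefficient of x^(l-1)
   in f^((l-1)/2), where y^2 = f(x) is a short model of E_7; so E_7 is supersingular at d.
   Then the multiplication by l is, up to an isomorphism (x, y) |-> (rho^2 x + c0, +-rho^3 y), the
   Frobenius of F_(l^2). On the abscissas x_1, x_2, x_3 of P, 2P, 3P, where P = (0, 0) has order 7,
   d = (x_2 - x_1) / (x_3 - x_1); so d^(l^2) is the same ratio for the points lP, 2lP, 3lP, that is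
   d, (d-1)/d or 1/(1-d) according to whether l = +-1, +-2 or +-3 mod 7. These homographies
   have order 1 or 3, and d = (d-1)/d is the equation d^2 - d + 1 = 0, so the degree divides 2 or 6.
   Degrees 1 and 3 are excluded by comparing lP with the points that Frobenius would give.

   Supersingularity is used as follows. A linear algebra argument yields polynomials a, b with
   a(x, X) + y Y b(x, X) vanishing on the graph X = x^l, Y = y^l. The norm of this function is
   (x^l - X) M, and the vanishing of the Hasse coefficient makes M = p(X) x - q(X) satisfy
   p' q = p q', so that M is a constant times x - (c1 X^l + c0). Specializing X at the l-th power
   of the abscissa of a point Q gives the function with divisor l(Q) + (-lQ) - (l+1)(O). *)

(** A function on the curve is handled as a pair (u, v) standing for u + v * y, and its divisor
    through the norm u^2 - f * v^2. The norm does not separate a point from its opposite, which is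
    why every sign needs an argument of its own.

    The abscissas, known only up to x |-> rho^2 x + c0, bound the degree but do not exclude degrees
    1 and 3: an arbitrary [rho] would allow a permutation of the abscissas. Hence [rho] has to be
    computed. It satisfies rho * c^(l-1) = 1, where c is the coefficient of x^(l-2) in f^((l-1)/2).
    So rho = 1 if d lies in F_l, and the product of the three conjugates of rho under the l^2-power
    map is 1 if d lies in F_(l^3). This value comes from the equation 2 f C' + f' C = c satisfied by
    the part C of f^((l-1)/2) above x^l: the top coefficients of b in X and in x are multiples of C
    and of its Frobenius twist, and they share one coefficient. For rho = 1 the sign obtained is
    that of [l] = -Frobenius^2, the relation of a curve of trace zero. *)

(** * Linear algebra, sizes and multiplicities *)

Lemma linear_dependence (K : fieldType) (I : finType) (B : I -> {poly K}) N :
  (forall i, size (B i) <= N)%N -> (N < #|I|)%N ->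
  exists2 c : I -> K, (exists i, c i != 0) & \sum_i c i *: B i = 0.
Proof.
move=> sB ltN; pose A := \matrix_(i < #|I|, j < N) (B (enum_val i))`_j.
have nfree : ~~ row_free A.
  by rewrite /row_free neq_ltn (leq_ltn_trans (rank_leq_col A)).
rewrite -kermx_eq0 in nfree; have [v /sub_kermxP vA vN0] := rowV0Pn nfree.
exists (fun i => v 0 (enum_rank i)).
  have [j vj] : exists j, v 0 j != 0.
    apply/existsP; rewrite -negb_forall; apply: contra vN0 => /forallP v0.
    by apply/eqP/rowP=> j; rewrite mxE; apply/eqP.
  by exists (enum_val j); rewrite enum_valK.
apply/polyP=> j; rewrite coef0 coef_sum; have [ltj|lej] := ltnP j N; last first.
  by apply: big1 => i _; rewrite coefZ nth_default ?mulr0 // (leq_trans (sB i)).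
have := congr1 (fun w : 'rV_N => w 0 (Ordinal ltj)) vA; rewrite !mxE => vA0.
rewrite -[RHS]vA0 (reindex (@enum_val I predT)) /=; last first.
  by exists enum_rank => x _; [exact: enum_valK | exact: enum_rankK].
by apply: eq_bigr => i _; rewrite coefZ !mxE enum_valK.
Qed.

Lemma size_mul_leqD (R : nzRingType) (p q : {poly R}) m n N :
  (size p <= m -> size q <= n -> m + n <= N.+1 -> size (p * q)%R <= N)%N.
Proof.
move=> sp sq le_N; apply: leq_trans (size_polyMleq _ _) _.
by rewrite -subn1 leq_subLR add1n (leq_trans (leq_add sp sq)).
Qed.

Lemma size_sub_leq (R : nzRingType) (p q : {poly R}) N :
  (size p <= N -> size q <= N -> size (p - q)%R <= N)%N.
Proof.
by move=> sp sq; rewrite (leq_trans (size_polyD _ _)) // size_polyN geq_max sp.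
Qed.

Lemma size_sqr (K : fieldType) (p : {poly K}) : size (p ^+ 2) = (2 * size p).-1.
Proof.
have [->|p0] := eqVneq p 0; first by rewrite expr0n size_poly0.
by rewrite expr2 size_mul // addnn mul2n.
Qed.

Lemma size_mul_field (K : fieldType) (p q : {poly K}) : p != 0 -> q != 0 ->
  size (p * q) = (size p + size q).-1.
Proof. exact: size_mul. Qed.

Lemma mupZ (K : fieldType) (c x : K) (p : {poly K}) : c != 0 ->
  mup x (c *: p) = mup x p.
Proof. by move=> c0; rewrite -mul_polyC mupMr // rootC. Qed.

Lemma mup_sqr (K : fieldType) (x : K) (p : {poly K}) : p != 0 ->
  mup x (p ^+ 2) = (2 * mup x p)%N.
Proof. by move=> p0; rewrite expr2 mupM // addnn mul2n. Qed.

Lemma coef_sqr_top (R : comNzRingType) (p : {poly R}) n : (size p <= n.+1)%N ->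
  (p ^+ 2)`_(2 * n) = p`_n ^+ 2.
Proof.
move=> sp; have n_lt : (n < (2 * n).+1)%N by lia.
rewrite expr2 coefM (bigD1 (Ordinal n_lt)) //= big1 ?addr0.
  by rewrite expr2 (_ : 2 * n - n = n)%N //; lia.
move=> [i /= lt_i] /eqP ne_i; have ne : i <> n by move=> e; apply: ne_i; apply: val_inj.
have [le_i|lt_ni] := leqP i n.
  by rewrite [p`_(_ - _)]nth_default ?mulr0 // (leq_trans sp) //; lia.
by rewrite nth_default ?mul0r // (leq_trans sp).
Qed.

Lemma coef_mul_top (R : comNzRingType) (p q : {poly R}) m n :
  (size p <= m.+1)%N -> (size q <= n.+1)%N -> (p * q)`_(m + n) = p`_m * q`_n.
Proof.
move=> sp sq; have m_lt : (m < (m + n).+1)%N by lia.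
rewrite coefM (bigD1 (Ordinal m_lt)) //= big1 ?addr0 ?addKn //.
move=> [i /= lt_i] /eqP ne_i; have ne : i <> m by move=> e; apply: ne_i; apply: val_inj.
have [le_i|lt_mi] := leqP i m.
  by rewrite [X in _ * X]nth_default ?mulr0 // (leq_trans sq) //; lia.
by rewrite nth_default ?mul0r // (leq_trans sp).
Qed.

(** * Polynomials in two variables *)

Section Bivariate.
Variable K : fieldType.
Implicit Types (u v : {poly {poly K}}) (p q : {poly K}).

Lemma swapXYB u v : swapXY (u - v) = swapXY u - swapXY v.
Proof. exact: rmorphB. Qed.

Lemma swapXYM u v : swapXY (u * v) = swapXY u * swapXY v.
Proof. exact: rmorphM. Qed.

Lemma swapXY_deriv (u : {poly {poly K}}) i : (swapXY u^`())`_i = ((swapXY u)`_i)^`().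
Proof. by apply/polyP=> j; rewrite coef_swapXY !coef_deriv coefMn -coef_swapXY. Qed.

Lemma horner_poly_swapXY u p (x : K) : (swapXY u).[p].[x] = u.[x%:P].[p.[x]].
Proof.
elim/poly_ind: u => [|u r IHu]; first by rewrite rmorph0 !horner0.
rewrite rmorphD rmorphM /= swapXY_X swapXY_polyC !(hornerD, hornerM, hornerC, hornerX) IHu.
by congr (_ + _); apply: horner_comp.
Qed.

Lemma sizeY_leqP u N : reflect (forall i, (size (u`_i)%R <= N)%N) (sizeY u <= N)%N.
Proof.
apply: (iffP idP) => [le_u i|le_u]; first exact: leq_trans (max_size_coefXY u i) le_u.
by apply/bigmax_leqP.
Qed.

(** The coefficients of [u] have degree below [N], so in [u.['X^N]] they occupy disjoint ranges of
    exponents and cannot cancel. *)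
Lemma horner_Xn_eq0 u N : (sizeY u <= N)%N -> u.['X^N] = 0 -> u = 0.
Proof.
elim/poly_ind: u => [|u c IHu] // /sizeY_leqP su.
rewrite hornerMXaddC => u0.
have c0 : c = 0.
  have sc : (size c <= N)%N by have := su 0%N; rewrite coefD coefMX coefC /= add0r.
  by rewrite -(take_polyDMXn u.['X^N] sc) addrC u0 take_poly0r.
have -> : u = 0; last by rewrite c0 mul0r addr0.
apply: IHu.
  apply/sizeY_leqP=> i; have := su i.+1.
  by rewrite coefD coefMX coefC /= addr0.
apply/eqP; have /eqP := u0; rewrite c0 addr0 mulf_eq0 => /orP[//|].
by rewrite -size_poly_eq0 size_polyXn.
Qed.

Lemma sizeYD u v N : (sizeY u <= N -> sizeY v <= N -> sizeY (u + v) <= N)%N.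
Proof.
by move=> su sv; rewrite sizeYE rmorphD /= (leq_trans (size_polyD _ _)) //
  geq_max -!sizeYE su.
Qed.

Lemma sizeYN u : sizeY (- u) = sizeY u.
Proof. by rewrite !sizeYE rmorphN size_polyN. Qed.

Lemma sizeYM u v M N P : (sizeY u <= M -> sizeY v <= N -> M + N <= P.+1 ->
  sizeY (u * v) <= P)%N.
Proof.
by rewrite !sizeYE rmorphM; apply: size_mul_leqD.
Qed.

Lemma sizeY_deriv u : (sizeY u^`() <= sizeY u)%N.
Proof.
apply/sizeY_leqP=> i; rewrite coef_deriv.
by rewrite (leq_trans _ (max_size_coefXY u i.+1)) // -scaler_nat size_scale_leq.
Qed.

Lemma sizeY_polyC p : sizeY p%:P = size p.
Proof. by rewrite sizeYE swapXY_polyC size_map_polyC. Qed.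

Lemma sizeY_map_polyC p : (sizeY p^:P <= 1)%N.
Proof. by rewrite sizeYE swapXY_map_polyC size_polyC leq_b1. Qed.

End Bivariate.

Lemma exprp_comp (K : fieldType) l (pcharKl : l \in [pchar K]) (p : {poly K}) :
  p ^+ l = map_poly (pFrobenius_aut pcharKl) p \Po 'X^l.
Proof.
have pcharPl : l \in [pchar {poly K}] by rewrite pchar_poly.
rewrite -(pFrobenius_autE pcharPl).
elim/poly_ind: p => [|p c IHp]; first by rewrite !rmorph0.
rewrite !rmorphD !rmorphM /= IHp map_polyX map_polyC /=.
rewrite comp_polyX comp_polyC !pFrobenius_autE.
by rewrite polyC_exp.
Qed.

(** * The Frobenius graph of a supersingular cubic *)

Section Pade.
Variables (K : fieldType) (k : nat) (f : {poly K}).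
Local Notation l := (2 * k + 3)%N.
Hypotheses (size_f : size f = 4%N).

(* The outer variable stands for [X = x ^+ l]; as [f ^+ k.+2 = y ^+ l.+1], this says that
   [a(x, X) + y * Y * b(x, X)] vanishes on the graph of [(x, y) |-> (x ^+ l, y ^+ l)]. *)
Definition pade (a b : {poly {poly K}}) :=
  [/\ (size a <= k.+3)%N, (sizeY a <= k.+3)%N, (size b <= k.+1)%N, (sizeY b <= k.+1)%N
    & a.['X^l] = - (b.['X^l] * f ^+ k.+2)].

(* There is one unknown more than there are equations. *)
Lemma pade_exists : exists a b, pade a b /\ (a != 0) || (b != 0).
Proof.
pose I := ('I_k.+3 * 'I_k.+3 + 'I_k.+1 * 'I_k.+1)%type.
pose B (x : I) : {poly K} := match x with
  | inl (i, j) => 'X^j * 'X^l ^+ i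
  | inr (i, j) => f ^+ k.+2 * ('X^j * 'X^l ^+ i) end.
have sB x : (size (B x) <= l * k.+2 + k.+3)%N.
  case: x => [] [i j] /=; have := ltn_ord i; have := ltn_ord j.
    by rewrite -exprM -exprD size_polyXn; nia.
  rewrite -exprM -exprD => ltj lti.
  have sF : (size (f ^+ k.+2) <= 3 * k.+2 + 1)%N.
    by apply: leq_trans (size_poly_exp_leq _ _) _; rewrite size_f addn1 mulnC.
  apply: leq_trans (size_polyMleq _ _) _; rewrite size_polyXn; nia.
have ltI : (l * k.+2 + k.+3 < #|{: I}|)%N.
  by rewrite card_sum !card_prod !card_ord; nia.
have [c [x cx] sum0] := linear_dependence sB ltI.
pose a := \poly_(i < k.+3) \poly_(j < k.+3) c (inl (inord i, inord j)).
pose b := \poly_(i < k.+1) \poly_(j < k.+1) c (inr (inord i, inord j)).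
have aE (i j : 'I_k.+3) : a`_i`_j = c (inl (i, j)).
  by rewrite !(coef_poly, ltn_ord) !inord_val.
have bE (i j : 'I_k.+1) : b`_i`_j = c (inr (i, j)).
  by rewrite !(coef_poly, ltn_ord) !inord_val.
exists a, b; split; first split; rewrite ?size_poly //.
- apply/sizeY_leqP => i; rewrite coef_poly; case: ifP => _.
    exact: size_poly.
  by rewrite size_poly0.
- apply/sizeY_leqP => i; rewrite coef_poly; case: ifP => _.
    exact: size_poly.
  by rewrite size_poly0.
- apply/eqP; rewrite -addr_eq0 -[X in _ == X]sum0 big_sumType /=; apply/eqP.
  rewrite !horner_poly; congr (_ + _).
    transitivity (\sum_i \sum_j c (inl (i, j)) *: B (inl (i, j))); last first.
      by rewrite pair_bigA; apply: eq_bigr => -[].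
    apply: eq_bigr => i _; rewrite poly_def mulr_suml; apply: eq_bigr => j _.
    by rewrite !inord_val scalerAl.
  transitivity (\sum_i \sum_j c (inr (i, j)) *: B (inr (i, j))); last first.
    by rewrite pair_bigA; apply: eq_bigr => -[].
  rewrite mulr_suml; apply: eq_bigr => i _.
  rewrite poly_def !mulr_suml; apply: eq_bigr => j _.
  by rewrite !inord_val -!scalerAl mulrC.
rewrite -negb_and; apply: contra cx => /andP[/eqP a0 /eqP b0].
case: x => [] [i j]; first by rewrite -aE a0 !coef0.
by rewrite -bE b0 !coef0.
Qed.

Lemma swapXY_XsubCC (x0 : K) : swapXY ('X - x0%:P%:P) = ('X - x0%:P)%:P.
Proof. by rewrite swapXYB swapXY_X swapXY_polyC map_polyC polyCB. Qed.

Lemma pade_factor x0 a b :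
  pade (a * ('X - x0%:P%:P)) (b * ('X - x0%:P%:P)) -> pade a b.
Proof.
have sY u : sizeY (u * ('X - x0%:P%:P)) = sizeY u.
  by rewrite !sizeYE rmorphM /= swapXY_XsubCC mulrC size_Cmul // polyXsubC_eq0.
have sX (u : {poly {poly K}}) : (size u <= size (u * ('X - x0%:P%:P))%R)%N.
  have [->|u0] := eqVneq u 0; first by rewrite size_poly0.
  by rewrite size_Mmonic ?monicXsubC // size_XsubC addn2 /=.
case; rewrite !sY => sa sYa sb sYb e; split=> //; try exact: leq_trans (sX _) _.
have := e; rewrite !hornerM !hornerXsubC mulrAC -mulNr => /mulIf -> //.
rewrite -size_poly_eq0 size_XnsubC; lia.
Qed.

(** Dividing [a] and [b] by a common factor [X - x0] preserves [pade] and lowers the total size, so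
    the process stops. It guarantees that the specializations at the points of [s] are not
    identically zero. *)
Lemma pade_primitive (s : seq K) : exists a b,
  pade a b /\ {in s, forall x0, (a.[x0%:P] != 0) || (b.[x0%:P] != 0)}.
Proof.
have [a [b [pab nz]]] := pade_exists.
have [n] := ubnP (size a + size b)%N.
elim: n => // n IHn in a b pab nz *; rewrite ltnS => le_n.
have [/allP prim|/allPn[x0 _]] :=
  boolP (all (fun x0 => (a.[x0%:P] != 0) || (b.[x0%:P] != 0)) s).
  by exists a, b.
rewrite negb_or !negbK => /andP[/factor_theorem[a1 aE] /factor_theorem[b1 bE]].
have sX (u : {poly {poly K}}) :
    size (u * ('X - x0%:P%:P)) = (size u + (u != 0%R))%N.
  have [->|u0] := eqVneq u 0; first by rewrite mul0r size_poly0.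
  by rewrite size_Mmonic ?monicXsubC // size_XsubC addn2 addn1.
have nz1 : (a1 != 0) || (b1 != 0).
  by move: nz; rewrite aE bE !mulf_eq0 polyXsubC_eq0 !orbF.
apply: (IHn a1 b1) => //; first by apply: (@pade_factor x0); rewrite -aE -bE.
move: le_n nz1; rewrite aE bE !sX; case: (a1 == 0); case: (b1 == 0) => //=; lia.
Qed.

Hypotheses (pcharKl : l \in [pchar K]) (k_gt0 : (0 < k)%N).
Local Notation F := (map_poly (pFrobenius_aut pcharKl) f).

Lemma frob_comp : F^:P.['X^l] = f ^+ l.
Proof. by rewrite [RHS](exprp_comp pcharKl). Qed.

Lemma size_frob : size F = 4%N.
Proof. by rewrite size_map_poly. Qed.

(** The norm of [a + y * Y * b], with [f] in the role of y^2 and its Frobenius twist [F] in that of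
    Y^2. *)
Definition pade_norm (a b : {poly {poly K}}) := a ^+ 2 - F^:P * f%:P * b ^+ 2.

Lemma sizeY_Xl (M : {poly {poly K}}) :
  M != 0 -> sizeY (('X^l%:P - 'X) * M) = (sizeY M + l)%N.
Proof.
move=> M0; rewrite !sizeYE rmorphM rmorphB /= swapXY_X swapXY_polyC map_polyXn.
have mX : ('X^l - 'X%:P : {poly {poly K}}) \is monic.
  by rewrite monicXnsubC //; lia.
by rewrite size_monicM ?swapXY_eq0 // size_XnsubC ?addn3 // addSn addnC.
Qed.

(** On the graph, [F] becomes [f ^+ l] and a^2 = f^(l+1) * b^2, so the norm vanishes. It has degree
    at most l + 1 in each variable; dividing by x^l - X leaves degree l in X and 1 in x. *)
Lemma pade_cofactor a b : pade a b -> exists M,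
  [/\ pade_norm a b = ('X^l%:P - 'X) * M, (size M <= l.+1)%N & (sizeY M <= 2)%N].
Proof.
case=> sa sYa sb sYb e.
have : root (pade_norm a b) 'X^l.
  rewrite /root /pade_norm hornerD hornerN !hornerM hornerC frob_comp e; apply/eqP.
  have fE : (f ^+ k.+2) ^+ 2 = f ^+ l * f by rewrite -exprM -exprSr; congr (_ ^+ _); lia.
  by move: fE; move: (f ^+ k.+2) (f ^+ l) b.['X^l] => G fl c fE; ring: fE.
case/factor_theorem=> M' NE; have {M' NE}[M NE] :
    exists M, pade_norm a b = ('X^l%:P - 'X) * M by exists (- M'); rewrite NE mulrN -mulNr opprB mulrC.
exists M; have [M0|M0] := eqVneq M 0.
  by rewrite NE M0 sizeYE rmorph0 !size_poly0.
split=> //.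
  have XlM : size (('X^l%:P - 'X) * M) = (size M).+1.
    rewrite -opprB mulNr size_polyN mulrC size_Mmonic ?monicXsubC //.
    by rewrite size_XsubC addn2.
  have : (size (pade_norm a b) <= 2 * k + 5)%N.
    apply: size_sub_leq; first by rewrite expr2; apply: (size_mul_leqD sa sa); lia.
    have sFf : (size (F^:P * f%:P)%R <= 4)%N.
      by apply: (@size_mul_leqD _ _ _ 4 1); rewrite ?size_polyC_leq1 ?size_map_polyC ?size_frob.
    have sbb : (size (b ^+ 2) <= 2 * k + 1)%N by rewrite expr2; apply: (size_mul_leqD sb sb); lia.
    by apply: (size_mul_leqD sFf sbb); lia.
  by rewrite NE XlM; lia.
rewrite -(leq_add2r l) -sizeY_Xl // -NE; apply: sizeYD; rewrite ?sizeYN.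
  by rewrite expr2; apply: (sizeYM sYa sYa); lia.
have sYFf : (sizeY (F^:P * f%:P)%R <= 4)%N.
  by apply: (sizeYM (sizeY_map_polyC _) (leqnn _)); rewrite sizeY_polyC size_f.
have sYbb : (sizeY (b ^+ 2) <= 2 * k + 1)%N by rewrite expr2; apply: (sizeYM sYb sYb); lia.
by apply: (sizeYM sYFf sYbb); lia.
Qed.

(** This is f^((l-1)/2) with x^l replaced by the outer variable: equal to it on the graph, but of
    degree below l in x. *)
Definition pade_rho : {poly {poly K}} :=
  (take_poly l (f ^+ k.+1))%:P + (drop_poly l (f ^+ k.+1))%:P * 'X.

(** With Y^2 = [F], this is 2 * b^2 * Y^3 times the derivative of a / (b * Y) with respect to X. *)
Definition pade_wr (a b : {poly {poly K}}) :=
  2%:R * (F^:P * (a^`() * b - a * b^`())) - a * b * F^`()^:P.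

Hypothesis hasse0 : (f ^+ k.+1)`_(2 * k + 2) = 0.

(** The vanishing Hasse coefficient is that of x^(l-1), the top one of the low part. The degree
    gained here leaves room for the factor [M] in [pade_wronskian]. *)
Lemma size_low : (size (take_poly l (f ^+ k.+1)) <= 2 * k + 2)%N.
Proof.
apply/leq_sizeP => i; rewrite leq_eqVlt => /predU1P[<-|lt_i].
  by rewrite coef_take_poly hasse0 if_same.
by rewrite coef_take_poly ltnNge (_ : (l <= i)%N) //=; lia.
Qed.

Lemma size_high : (size (drop_poly l (f ^+ k.+1)) <= k.+1)%N.
Proof.
have := size_poly_exp_leq f k.+1; rewrite size_f size_drop_poly /=; lia.
Qed.

Lemma deriv_norm a b : (pade_norm a b)^`() =
  2%:R * a * a^`() - F^`()^:P * f%:P * b ^+ 2 - 2%:R * F^:P * f%:P * b * b^`().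
Proof. by rewrite /pade_norm !(expr2, derivB, derivM, derivC) deriv_map; ring. Qed.

Lemma deriv_Xl (M : {poly {poly K}}) :
  (('X^l%:P - 'X) * M)^`() = - M + ('X^l%:P - 'X) * M^`().
Proof. by rewrite derivM derivB derivC derivX sub0r mulN1r. Qed.

(** On the graph, [M] is minus the X-derivative of the norm, and the two sides then agree by a
    direct computation. Both have degree below l in x, so [horner_Xn_eq0] makes them equal. *)
Lemma pade_wronskian a b M : pade a b -> (sizeY M <= 2)%N ->
  pade_norm a b = ('X^l%:P - 'X) * M -> pade_wr a b = pade_rho * M.
Proof.
move=> [_ sYa _ sYb e] sYM NE; apply/eqP; rewrite -subr_eq0; apply/eqP.
apply: (@horner_Xn_eq0 _ _ l).
  apply: sizeYD; rewrite ?sizeYN.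
    apply: sizeYD; rewrite ?sizeYN.
      apply: (@sizeYM _ _ _ 1 l) => //.
        by rewrite -polyC_natr sizeY_polyC -polyC_natr size_polyC_leq1.
      apply: (sizeYM (sizeY_map_polyC _) (leqnn _)); rewrite add1n ltnS.
      apply: sizeYD; rewrite ?sizeYN.
        by apply: (sizeYM (leq_trans (sizeY_deriv _) sYa) sYb); lia.
      by apply: (sizeYM sYa (leq_trans (sizeY_deriv _) sYb)); lia.
    apply: (@sizeYM _ _ _ l 1 l); rewrite ?sizeY_map_polyC ?addn1 //.
    by apply: (sizeYM sYa sYb); lia.
  apply: (@sizeYM _ _ _ l.-1 2 l); rewrite ?sYM //; last lia.
  apply: sizeYD; first by rewrite sizeY_polyC (leq_trans size_low) //; lia.
  by rewrite sizeY_mulX sizeY_polyC (leq_trans size_high) //; lia.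
have ME : M.['X^l] = F^`()^:P.['X^l] * f * b.['X^l] ^+ 2
    + 2%:R * f ^+ l * f * b.['X^l] * b^`().['X^l] - 2%:R * a.['X^l] * a^`().['X^l].
  have := congr1 (fun u : {poly {poly K}} => u^`().['X^l]) NE.
  rewrite deriv_norm deriv_Xl !(hornerD, hornerN, hornerM, hornerC, hornerX).
  rewrite frob_comp subrr mul0r addr0 => /eqP; rewrite -eqr_oppLR => /eqP <-.
  by move: (f ^+ l) => fl; ring.
have rhoE : pade_rho.['X^l] = f ^+ k.+1.
  by rewrite hornerD hornerMX !hornerC poly_take_drop.
rewrite hornerD hornerN [_ * M]lock -lock hornerM rhoE ME.
rewrite /pade_wr !(hornerD, hornerN, hornerM) frob_comp e -polyC_natr hornerC.
have fE : f ^+ l = f ^+ k.+1 * f ^+ k.+2.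
  by rewrite -exprD; congr (_ ^+ _); lia.
have f1 : f ^+ k.+2 = f * f ^+ k.+1 by rewrite -exprS.
rewrite fE f1; move: (f ^+ k.+1) (b.['X^l]) a^`().['X^l] b^`().['X^l] F^`()^:P.['X^l].
by move=> g b1 a' b' F'; ring.
Qed.

Lemma sizeY2E (M : {poly {poly K}}) : (sizeY M <= 2)%N ->
  M = ((swapXY M)`_1)^:P * 'X%:P + ((swapXY M)`_0)^:P.
Proof.
rewrite sizeYE => sM; apply: (can_inj swapXYK).
rewrite rmorphD rmorphM /= !swapXY_map_polyC swapXY_Y.
apply/polyP=> -[|[|i]]; rewrite coefD coefMX !coefC /= ?add0r ?addr0 //.
by rewrite nth_default // (leq_trans sM).
Qed.

(** With N the norm and wr the Wronskian, F * N'^2 = N * Z + f * wr^2; as [M] divides N and wr, it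
    divides F * (X * M')^2. Modulo [M], that is for x = q / p, [p * M'] is [w] and [p^l * X] no
    longer involves x. Hence [c], a polynomial in the outer variable alone, is a multiple of [M],
    which has degree 1 in x; so it is zero. *)
Lemma pade_ratio a b M p q : pade a b ->
  pade_norm a b = ('X^l%:P - 'X) * M -> M = p^:P * 'X%:P - q^:P ->
  p != 0 -> p^`() * q = p * q^`().
Proof.
move=> pab NE ME p0.
have sYM : (sizeY M <= 2)%N.
  rewrite ME; apply: sizeYD; rewrite ?sizeYN; last exact: leq_trans (sizeY_map_polyC _) _.
  apply: (@sizeYM _ _ _ 1 2) => //; first exact: sizeY_map_polyC.
  by rewrite sizeY_polyC size_polyX.
have TE := pade_wronskian pab sYM NE.
set X : {poly {poly K}} := 'X^l%:P - 'X.
have N'E : (pade_norm a b)^`() = - M + X * M^`() by rewrite NE deriv_Xl.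
pose Z := 4%:R * F^:P * a^`() ^+ 2 - f%:P * (2%:R * F^:P * b^`() + F^`()^:P * b) ^+ 2.
have Z1E : F^:P * (- M + X * M^`()) ^+ 2 = M * (X * Z + f%:P * pade_rho ^+ 2 * M).
  transitivity (pade_norm a b * Z + f%:P * pade_wr a b ^+ 2); last by rewrite NE -/X TE; ring.
  by rewrite -N'E deriv_norm /pade_wr /Z /pade_norm; ring.
set Z1 := X * Z + _ in Z1E.
pose w := p^`() * q - p * q^`().
have M'E : M^`() = p^`()^:P * 'X%:P - q^`()^:P.
  by rewrite ME derivB derivM derivC mulr0 addr0 !deriv_map.
have wE : w^:P = p^:P * M^`() - p^`()^:P * M.
  by rewrite M'E ME /w rmorphB !rmorphM /=; ring.
(* Frobenius turns p * x = M + q into p^l * x^l = M^l + q^l. Here [X] is x^l minus the outer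
   variable. *)
have XpE : (p ^+ l)^:P * X = (q ^+ l - p ^+ l * 'X)^:P + M ^+ l.
  have pcharY : l \in [pchar {poly {poly K}}] by rewrite !pchar_poly.
  have -> : (p ^+ l)^:P * X = (M + q^:P) ^+ l - (p ^+ l * 'X)^:P.
    rewrite ME subrK exprMn rmorphM rmorphXn /= map_polyX -polyC_exp /X mulrBr.
    by rewrite rmorphXn.
  rewrite -(pFrobenius_autE pcharY) rmorphD /= !pFrobenius_autE rmorphB rmorphXn /=.
  by ring.
pose c := F * w ^+ 2 * (q ^+ l - p ^+ l * 'X) ^+ 2.
have [Z2 cE] : exists Z2, c^:P = M * Z2.
  pose V := X * p^`()^:P - p^:P; pose N' := - M + X * M^`(); pose M1 := M ^+ l.-1.
  have XwE : X * w^:P = p^:P * N' - M * V by rewrite wE /N' /V; ring.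
  have MlE : M ^+ l = M * M1 by rewrite /M1 -exprS prednK // addn3.
  exists ((p ^+ l)^:P ^+ 2 * (p^:P ^+ 2 * Z1 - F^:P * V * (2%:R * p^:P * N' - M * V))
    + F^:P * w^:P ^+ 2 * M1 * (M * M1 - 2%:R * (p ^+ l)^:P * X)).
  rewrite /c !rmorphM /= -[(q ^+ l - _)^:P](addrK (M ^+ l)) -XpE MlE.
  transitivity ((p ^+ l)^:P ^+ 2 * (F^:P * (X * w^:P) ^+ 2)
    + M * (F^:P * w^:P ^+ 2 * M1 * (M * M1 - 2%:R * (p ^+ l)^:P * X))); first by ring.
  rewrite XwE; transitivity ((p ^+ l)^:P ^+ 2 * (p^:P ^+ 2 * (F^:P * N' ^+ 2)
     - M * (F^:P * V * (2%:R * p^:P * N' - M * V)))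
    + M * (F^:P * w^:P ^+ 2 * M1 * (M * M1 - 2%:R * (p ^+ l)^:P * X))); first by ring.
  by rewrite Z1E; ring.
have : c = 0.
  apply/eqP; apply: contraT => c0; have := congr1 (fun u => size (swapXY u)) cE.
  have sM : size (swapXY M) = 2%N.
    rewrite ME swapXYB swapXYM !swapXY_map_polyC swapXY_Y -polyCN.
    by rewrite size_MXaddC polyC_eq0 (negPf p0) size_polyC p0.
  rewrite /= [swapXY (M * Z2)]rmorphM /= swapXY_map_polyC size_polyC c0.
  have [->|Z0] := eqVneq (swapXY Z2) 0; first by rewrite mulr0 size_poly0.
  rewrite size_mul // -?size_poly_eq0 ?sM //.
  by move: Z0; rewrite -size_poly_eq0; case: (size _).
move/eqP; rewrite !mulf_eq0 /= -size_poly_eq0 size_frob /=.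
(* The degree of [q ^+ l] is a multiple of l, that of [p ^+ l * 'X] is 1 modulo l. *)
have -> : (q ^+ l - p ^+ l * 'X == 0) = false.
  apply/negbTE; rewrite subr_eq0; apply/eqP => /(congr1 (fun u : {poly K} => size u)).
  rewrite size_mulX ?expf_neq0 //.
  have [->|q0] := eqVneq q 0.
    by rewrite expr0n addn3 size_poly0.
  move: p0 q0 (size_exp p l) (size_exp q l); rewrite -2!size_poly_eq0 => p0 q0 sp sq spq.
  have sp0 : size (p ^+ l) != 0%N by rewrite size_poly_eq0 expf_neq0 // -size_poly_eq0.
  have sq0 : size (q ^+ l) != 0%N by rewrite size_poly_eq0 expf_neq0 // -size_poly_eq0.
  have {sp sq spq sp0 sq0} : ((size q).-1 * l = ((size p).-1 * l).+1)%N.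
    by rewrite -sp -sq spq prednK // lt0n.
  move/(congr1 (modn^~ l)); rewrite modnMl -addn1 modnMDl modn_small //; lia.
by rewrite !orbF orbb subr_eq0 => /eqP.
Qed.

Lemma deriv_eq0 (p : {poly K}) : p^`() = 0 -> (size p <= l.+1)%N ->
  p = p`_l *: 'X^l + (p`_0)%:P.
Proof.
move=> p'0 sp; apply/polyP=> i; rewrite coefD coefZ coefXn coefC.
have l0 : (0 < l)%N by rewrite addn3.
have [->|i0] := posnP i; first by rewrite eq_sym (gtn_eqF l0) mulr0 add0r.
have [->|il] := eqVneq i l; first by rewrite mulr1; case: (l) l0 => // ?; rewrite addr0.
rewrite mulr0 addr0; have [lt_il|] := ltnP i l; last first.
  by move=> le_il; rewrite nth_default // (leq_trans sp) // ltn_neqAle eq_sym il.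
have := congr1 (fun u : {poly K} => u`_i.-1) p'0; rewrite coef_deriv prednK // coef0 /=.
move/eqP; rewrite -mulr_natr mulf_eq0 -(dvdn_pcharf pcharKl) => /orP[/eqP //|].
by rewrite gtnNdvd.
Qed.

(** Once p and q are divided by their gcd, p1 divides p1' * q1, hence p1', which is therefore zero;
    as p1 has degree below l, it is constant. Then q1' = 0 as well. *)
Lemma deriv_ratio (p q : {poly K}) : p^`() * q = p * q^`() -> p != 0 ->
  (size p <= l)%N -> (size q <= l.+1)%N ->
  exists c1 c0, q = p * (c1 *: 'X^l + c0%:P).
Proof.
move=> e p0 sp sq; have [->|q0] := eqVneq q 0.
  by exists 0, 0; rewrite scale0r add0r mulr0.
pose g := gcdp p q; have g0 : g != 0 by rewrite gcdp_eq0 (negPf p0).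
have cop : coprimep (p %/ g) (q %/ g) by rewrite coprimep_div_gcd ?p0.
have pE : p = p %/ g * g by rewrite divpK ?dvdp_gcdl.
have qE : q = q %/ g * g by rewrite divpK ?dvdp_gcdr.
move: (p %/ g) (q %/ g) cop pE qE => p1 q1 cop pE qE.
have [p10 q10] : p1 != 0 /\ q1 != 0.
  by move: p0 q0; rewrite pE qE !mulf_eq0 !(negPf g0) !orbF.
have e1 : p1^`() * q1 = p1 * q1^`().
  apply: (@mulIf _ (g ^+ 2)); first by rewrite expf_neq0.
  have := e; rewrite pE qE !derivM => e'.
  transitivity ((p1^`() * g + p1 * g^`()) * (q1 * g) - p1 * q1 * g * g^`()); first by ring.
  by rewrite e'; ring.
have small (u v : {poly K}) : u != 0 -> (size v < size u)%N -> u %| v -> v = 0.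
  by move=> _ lt_vu /dvdp_leq le_uv; apply/eqP; apply: contraTT lt_vu => /le_uv; rewrite -leqNgt.
have p1'0 : p1^`() = 0.
  apply: (small p1); rewrite ?lt_size_deriv //.
  by rewrite -(Gauss_dvdpl _ cop) e1 dvdp_mulr.
have q1'0 : q1^`() = 0.
  by move/eqP: e1; rewrite p1'0 mul0r eq_sym mulf_eq0 (negPf p10) => /eqP.
have g1 : (0 < size g)%N by rewrite size_poly_gt0.
have sp1 : (size p1 <= l)%N.
  by apply: leq_trans sp; rewrite pE size_mul // -subn1 -addnBA // leq_addr.
have sq1 : (size q1 <= l.+1)%N.
  by apply: leq_trans sq; rewrite qE size_mul // -subn1 -addnBA // leq_addr.
have p1E : p1 = (p1`_0)%:P.
  rewrite {1}(deriv_eq0 p1'0) ?(leq_trans sp1) // (nth_default _ sp1) scale0r add0r //.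
have c0 : p1`_0 != 0 by apply: contraNneq p10 => p10; rewrite p1E p10.
exists (q1`_l / p1`_0), (q1`_0 / p1`_0).
rewrite {1}qE {1}(deriv_eq0 q1'0 sq1) pE {1}p1E mulrAC; congr (_ * _).
by rewrite mulrDr mul_polyC scalerA -polyCM ![p1`_0 * _]mulrC !divfK.
Qed.

(* [a0 + Y * b0] has divisor [l(P) + (Q) - (l+1)(O)] with [P = (x, y)] and [Q] of abscissa [xi];
   the last condition distinguishes [P] from [-P]. *)
Definition miller (x y xi : K) (a0 b0 : {poly K}) :=
  [/\ f.[x] = y ^+ 2, y != 0,
      exists2 c, c != 0 & a0 ^+ 2 - f * b0 ^+ 2 = c *: (('X - x%:P) ^+ l * ('X - xi%:P))
    & ('X - x%:P) ^+ l %| y ^+ l *: a0 + f ^+ k.+2 * b0].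

Lemma f_neq0 : f != 0.
Proof. by rewrite -size_poly_eq0 size_f. Qed.

(** The degree of [a0 ^+ 2] is even and that of [f * b0 ^+ 2] is odd, so the leading terms cannot
    cancel. *)
Lemma size_norm (a0 b0 : {poly K}) N : (size (a0 ^+ 2 - f * b0 ^+ 2)%R <= 2 * N + 1)%N ->
  (size a0 <= N.+1)%N /\ (size b0 <= N.-1)%N.
Proof.
have sb : b0 != 0 -> size (f * b0 ^+ 2) = (2 * size b0 + 2)%N.
  move=> b0N; rewrite size_mul_field ?f_neq0 ?expf_neq0 // size_f size_sqr.
  have : (0 < size b0)%N by rewrite size_poly_gt0.
  lia.
have [->|b0N] := eqVneq b0 0.
  by rewrite expr0n mulr0 subr0 size_poly0 size_sqr => sN; split=> //; lia.
have {}sb := sb b0N; have [->|a0N] := eqVneq a0 0.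
  by rewrite expr0n sub0r size_polyN size_poly0 sb => sN; split=> //; lia.
have sa : (size (a0 ^+ 2)).+1 = (2 * size a0)%N.
  have : (0 < size a0)%N by rewrite size_poly_gt0.
  rewrite size_sqr; lia.
have [lt_ab|lt_ba|eq_ab] := ltngtP (size (a0 ^+ 2)) (size (f * b0 ^+ 2)).
- by rewrite addrC size_polyDl ?size_polyN // => sN; move: lt_ab sN; rewrite sb; split; lia.
- by rewrite size_polyDl ?size_polyN // => sN; move: lt_ba sN; rewrite sb; split; lia.
- by move: sa; rewrite eq_ab sb; lia.
Qed.

Lemma size_miller_rhs (c x xi : K) : c != 0 ->
  size (c *: (('X - x%:P) ^+ l * ('X - xi%:P))) = l.+2.
Proof.
move=> c0; rewrite size_scale // size_Mmonic ?monicXsubC ?expf_neq0 ?polyXsubC_eq0 //.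
by rewrite size_XsubC size_exp_XsubC addn2.
Qed.

Lemma miller_size x y xi a0 b0 : miller x y xi a0 b0 ->
  [/\ (size a0 <= k.+3)%N, (size b0 <= k.+1)%N & b0 != 0].
Proof.
case=> fx y0 [c c0 NE] dv.
have [sa sb] : (size a0 <= k.+3)%N /\ (size b0 <= k.+1)%N.
  have := @size_norm a0 b0 k.+2; rewrite NE size_miller_rhs // => -[|sa sb]; first by lia.
  by split; [|exact: leq_trans sb _].
split=> //; apply: contraNneq c0 => b00; move: dv NE; rewrite b00 mulr0 addr0.
rewrite dvdpZr ?expf_neq0 // => dv.
have [->|a00] := eqVneq a0 0.
  rewrite !expr0n mulr0 subr0 => /esym/eqP; rewrite scale_poly_eq0 => /orP[//|].
  by rewrite mulf_eq0 expf_eq0 !polyXsubC_eq0 andbF.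
have := leq_trans (dvdp_leq a00 dv) sa; rewrite size_exp_XsubC; lia.
Qed.

Lemma XnsubX (x : K) : ('X - x%:P) ^+ l = 'X^l - (x ^+ l)%:P.
Proof.
have pcharP : l \in [pchar {poly K}] by rewrite pchar_poly.
by rewrite -(pFrobenius_autE pcharP) rmorphB /= !pFrobenius_autE polyC_exp.
Qed.

Lemma frob_horner x : F.[x ^+ l] = f.[x] ^+ l.
Proof. by rewrite -(pFrobenius_autE pcharKl x) horner_map. Qed.

Lemma pade_at a b x : pade a b ->
  ('X - x%:P) ^+ l %| a.[(x ^+ l)%:P] + f ^+ k.+2 * b.[(x ^+ l)%:P].
Proof.
case=> _ _ _ _ e; have : root (a + (f ^+ k.+2)%:P * b) 'X^l.
  by rewrite /root hornerD hornerM hornerC e mulrC addNr.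
case/factor_theorem=> h hE.
have := congr1 (fun u : {poly {poly K}} => u.[(x ^+ l)%:P]) hE.
rewrite hornerD !hornerM hornerXsubC hornerC => ->.
have -> : (x ^+ l)%:P - 'X^l = - ('X - x%:P) ^+ l by rewrite XnsubX opprB.
by rewrite mulrN dvdpNr dvdp_mull.
Qed.

(** The specialized pair (A, B) and the Miller function both vanish to order l at (x, y). So
    [(y ^+ l *: a0) * B - A * b0] is divisible by ('X - x)^l; its degree is below l, hence it is
    zero and the two functions are proportional. *)
Lemma miller_pade a b M x y xi a0 b0 : pade a b ->
  pade_norm a b = ('X^l%:P - 'X) * M -> (sizeY M <= 2)%N ->
  (a.[(x ^+ l)%:P] != 0) || (b.[(x ^+ l)%:P] != 0) ->
  miller x y xi a0 b0 ->
  (exists2 kap, kap != 0 & y ^+ l *: a0 = kap *: a.[(x ^+ l)%:P] /\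
      b0 = kap *: b.[(x ^+ l)%:P]) /\
  exists2 mu, mu != 0 & M.[(x ^+ l)%:P] = mu *: ('X - xi%:P).
Proof.
have leN : (k.+3 + k.+1 <= l.+1)%N by lia.
move=> pab NE sYM prim mil; have [sa0 sb0 b00] := miller_size mil.
case: mil => fx y0 [c c0 N0E] dv0; have dvA := pade_at x pab.
have [_ sYa _ sYb _] := pab.
set A := a.[_] in prim dvA *; set B := b.[_] in prim dvA *.
have sA : (size A <= k.+3)%N := leq_trans (max_size_evalC _ _) sYa.
have sB : (size B <= k.+1)%N := leq_trans (max_size_evalC _ _) sYb.
have cross : (y ^+ l *: a0) * B = A * b0.
  apply/eqP; rewrite -subr_eq0; apply/eqP.
  have dv : ('X - x%:P) ^+ l %| (y ^+ l *: a0) * B - A * b0.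
    have -> : (y ^+ l *: a0) * B - A * b0 = (y ^+ l *: a0 + f ^+ k.+2 * b0) * B
        - (A + f ^+ k.+2 * B) * b0 by ring.
    by rewrite dvdp_sub // dvdp_mulr.
  apply/eqP; apply: contraT => nz; have := dvdp_leq nz dv.
  rewrite size_exp_XsubC ltnNge size_sub_leq //.
    by apply: (@size_mul_leqD _ _ _ k.+3 k.+1); rewrite ?size_scale ?expf_neq0.
  exact: (size_mul_leqD sA sb0).
have B0 : B != 0.
  apply: contraTneq prim => B0; rewrite B0 eqxx orbF negbK.
  by have /esym/eqP := cross; rewrite B0 mulr0 mulf_eq0 (negPf b00) orbF.
have NA : A ^+ 2 - (y ^+ l) ^+ 2 *: (f * B ^+ 2) = ('X - x%:P) ^+ l * M.[(x ^+ l)%:P].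
  have := congr1 (fun u : {poly {poly K}} => u.[(x ^+ l)%:P]) NE.
  rewrite /pade_norm /= hornerD hornerN !hornerM !hornerD hornerN !hornerC hornerX.
  rewrite -/A -/B XnsubX => <-.
  have -> : F^:P.[(x ^+ l)%:P] = ((y ^+ l) ^+ 2)%:P.
    by rewrite horner_map /= frob_horner fx -!exprM mulnC.
  by rewrite -mul_polyC; ring.
set M0 := M.[_] in NA *.
have key : ((y ^+ l) ^+ 2 * c) *: (B ^+ 2 * ('X - xi%:P)) = b0 ^+ 2 * M0.
  apply: (@mulfI _ (('X - x%:P) ^+ l)); first by rewrite expf_neq0 ?polyXsubC_eq0.
  transitivity ((y ^+ l) ^+ 2 *: (B ^+ 2 * (a0 ^+ 2 - f * b0 ^+ 2))).
    by rewrite N0E -!mul_polyC polyCM; ring.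
  transitivity (b0 ^+ 2 * (A ^+ 2 - (y ^+ l) ^+ 2 *: (f * B ^+ 2))); last by rewrite NA; ring.
  transitivity (((y ^+ l *: a0) * B) ^+ 2 - (y ^+ l) ^+ 2 *: (B ^+ 2 * f * b0 ^+ 2)).
    by rewrite -!mul_polyC; ring.
  by rewrite cross -!mul_polyC; ring.
have yc0 : (y ^+ l) ^+ 2 * c != 0 by rewrite mulf_neq0 ?expf_neq0.
have M00 : M0 != 0.
  apply: contra_neq yc0 => M00; move/eqP: key.
  rewrite M00 mulr0 scale_poly_eq0 [_ * ('X - _) == 0]mulf_eq0 polyXsubC_eq0.
  by rewrite expf_eq0 (negPf B0) /= !orbF => /eqP.
(* In [key] the multiplicity of [xi] is odd on the left, so [M0], of degree at most 1, must vanish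
   there. *)
have M0E : exists2 mu, mu != 0 & M0 = mu *: ('X - xi%:P).
  have : root M0 xi.
    apply: contraT => /mupNroot mu0; have := congr1 (mup xi) key.
    rewrite mupZ // !mupM ?mup_sqr ?expf_neq0 ?polyXsubC_eq0 // mu0.
    move/(congr1 odd); rewrite (@mup_XsubCX _ 1) eqxx addn1 addn0 ?mul2n -?addnn /=.
    by rewrite !oddD !addbb.
  case/factor_theorem=> h hE; have h0 : h != 0.
    by apply: contraNneq M00 => h0; rewrite hE h0 mul0r.
  have sh : (size h <= 1)%N.
    have := leq_trans (max_size_evalC M (x ^+ l)) sYM.
    by rewrite -/M0 hE size_Mmonic ?monicXsubC // size_XsubC addn2.
  by move: h0 hE; rewrite (size1_polyC sh) polyC_eq0 mul_polyC; exists h`_0.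
split=> //; case: M0E => mu mu0 M0E.
have sqE : b0 ^+ 2 = ((y ^+ l) ^+ 2 * c / mu) *: B ^+ 2.
  apply: (@mulIf _ (mu *: ('X - xi%:P))).
    by rewrite scale_poly_eq0 negb_or mu0 polyXsubC_eq0.
  by rewrite -{1}M0E -key -scalerAl -scalerAr scalerA divfK.
(* [sqE] makes [b0 ^+ 2] a multiple of [B ^+ 2]; the leading coefficients show that the factor is a
   square in [K]. *)
pose kap := lead_coef b0 / lead_coef B.
have lB0 : lead_coef B != 0 by rewrite lead_coef_eq0.
have kapE : kap ^+ 2 = (y ^+ l) ^+ 2 * c / mu.
  have /eqP := congr1 (@lead_coef _) sqE.
  rewrite lead_coefZ !lead_coef_exp => /eqP sqE'.
  by rewrite /kap expr_div_n sqE' mulfK // expf_neq0.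
have kap0 : kap != 0 by rewrite mulf_neq0 ?invr_eq0 ?lead_coef_eq0.
have [kap' kap'0 b0E] : exists2 kap', kap' != 0 & b0 = kap' *: B.
  have : (b0 - kap *: B) * (b0 + kap *: B) == 0.
    by rewrite -subr_sqr exprZn kapE sqE subrr.
  rewrite mulf_eq0 subr_eq0 addr_eq0 => /orP[/eqP bE|/eqP bE]; first by exists kap.
  by exists (- kap); rewrite ?oppr_eq0 ?scaleNr.
exists kap' => //; split=> //; apply: (mulIf B0).
by rewrite cross b0E -scalerAr scalerAl.
Qed.

Lemma pade_scale e a b : e != 0 -> pade a b ->
  pade (e%:P%:P * a) (e%:P%:P * b) /\
  pade_norm (e%:P%:P * a) (e%:P%:P * b) = (e ^+ 2)%:P%:P * pade_norm a b.
Proof.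
move=> e0 [sa sYa sb sYb eq]; have eP : e%:P != 0 :> {poly K} by rewrite polyC_eq0.
split; last by rewrite /pade_norm !polyC_exp; ring.
split; rewrite ?size_Cmul //; first 2 last.
- by rewrite !hornerM !hornerC eq; ring.
- by apply: (@sizeYM _ _ _ 1 k.+3) sYa _; rewrite ?sizeY_polyC ?size_polyC_leq1.
- by apply: (@sizeYM _ _ _ 1 k.+1) sYb _; rewrite ?sizeY_polyC ?size_polyC_leq1.
Qed.

(** The coefficient p of x in [M] is the square of the top x-coefficient of [a]; its degree is even,
    hence below l, as [deriv_ratio] requires. Since q / p takes two values [xi1] and [xi2], it is c1
    * X^l + c0 with c1 nonzero; as q has degree at most l, p is a constant, which is scaled to 1. *)
Lemma pade_normal (s : seq K) x1 y1 xi1 a1 b1 x2 y2 xi2 a2 b2 :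
  miller x1 y1 xi1 a1 b1 -> miller x2 y2 xi2 a2 b2 -> xi1 != xi2 ->
  exists a b c1 c0, [/\ pade a b, c1 != 0,
    {in s, forall x0, (a.[x0%:P] != 0) || (b.[x0%:P] != 0)},
         (swapXY a)`_k.+2 = 1
    & pade_norm a b = ('X^l%:P - 'X) * ('X%:P - (c1 *: 'X^l + c0%:P)^:P)].
Proof.
have odd_leq n : ((2 * n).-1 <= l.+1)%N -> ((2 * n).-1 <= l)%N by lia.
move=> mil1 mil2 ne_xi; have [a [b [pab prim]]] := pade_primitive [:: x1 ^+ l, x2 ^+ l & s].
have [M [NE sM sYM]] := pade_cofactor pab.
have [] := miller_pade pab NE sYM (prim _ _) mil1; first by rewrite inE eqxx.
move=> _ [mu1 mu1N M1E].
have [] := miller_pade pab NE sYM (prim _ _) mil2; first by rewrite !inE eqxx orbT.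
move=> _ [mu2 mu2N M2E].
pose p := (swapXY M)`_1; pose q := - (swapXY M)`_0.
have ME : M = p^:P * 'X%:P - q^:P by rewrite /q [(- _)^:P]rmorphN opprK -sizeY2E.
have MatE x : M.[x%:P] = p.[x] *: 'X - q.[x]%:P.
  by rewrite ME hornerD hornerN hornerM hornerC -!mul_polyC !horner_map.
have pq mu xi x : M.[x%:P] = mu *: ('X - xi%:P) -> p.[x] = mu /\ q.[x] = mu * xi.
  rewrite MatE => e; have := congr1 (fun u : {poly K} => u`_1) e.
  have := congr1 (fun u : {poly K} => u`_0) e.
  rewrite !(coefB, coefZ, coefX, coefC) /= !mulr0 !mulr1 !subr0 !sub0r mulrN.
  by rewrite mulr1 => /oppr_inj ->.
have [p1 q1] := pq _ _ _ M1E; have [p2 q2] := pq _ _ _ M2E.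
have p0 : p != 0 by apply: contraNneq mu1N => p0; rewrite -p1 p0 horner0.
have e := pade_ratio pab NE ME p0.
have sM' : (sizeY (swapXY M) <= l.+1)%N by rewrite sizeYE swapXYK.
have sp : (size p <= l.+1)%N := leq_trans (max_size_coefXY _ _) sM'.
have sq : (size q <= l.+1)%N by rewrite size_polyN (leq_trans (max_size_coefXY _ _) sM').
have [al aal pE] : exists2 al : {poly K}, al = (swapXY a)`_k.+2 & p = al ^+ 2.
  exists (swapXY a)`_k.+2 => //; case: pab => _ sYa _ sYb _.
  rewrite -coef_sqr_top -?sizeYE //.
  have NEs : swapXY a ^+ 2 - F%:P * f^:P * swapXY b ^+ 2 = ('X^l - 'X%:P) * (p%:P * 'X - q%:P).
    have := congr1 swapXY NE; rewrite /pade_norm ME !expr2 !(swapXYB, swapXYM).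
    by rewrite !swapXY_map_polyC !swapXY_polyC swapXY_X map_polyX map_polyXn.
  have := congr1 (fun u : {poly {poly K}} => u`_(2 * k.+2)) NEs.
  rewrite coefB [(_ * swapXY b ^+ 2)`_ _]nth_default ?subr0.
    move=> ->; have -> : ('X^l - 'X%:P) * (p%:P * 'X - q%:P) =
        p%:P * 'X^(l.+1) - q%:P * 'X^l - ('X * p)%:P * 'X + ('X * q)%:P :> {poly {poly K}}.
      by rewrite !polyCM exprSr; ring.
    rewrite (_ : 2 * k.+2 = l.+1)%N; last by lia.
    rewrite coefD !coefB !coefCM !coefXn coefX coefC eqxx (gtn_eqF (ltnSn l)) eqSS.
    by rewrite addn3 /= !mulr0 !subr0 addr0 mulr1.
  have sFf : (size (F%:P * f^:P : {poly {poly K}})%R <= 4)%N.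
    apply: (@size_mul_leqD _ _ _ 1 4); rewrite ?size_polyC_leq1 //.
    by rewrite size_map_polyC size_f.
  have sbb : (size (swapXY b ^+ 2) <= 2 * k + 1)%N.
    by rewrite expr2; apply: (@size_mul_leqD _ _ _ k.+1 k.+1); rewrite -?sizeYE //; lia.
  by apply: (size_mul_leqD sFf sbb); lia.
have sp' : (size p <= l)%N.
  by move: sp; rewrite pE size_sqr; apply: odd_leq.
have [c1 [c0 qE]] := deriv_ratio e p0 sp' sq.
have c1N : c1 != 0.
  apply: contra_neq ne_xi => c10.
  have qx x : q.[x] = c0 * p.[x].
    by rewrite qE c10 scale0r add0r hornerM hornerC mulrC.
  have := q1; have := q2; rewrite !qx p1 p2 ![c0 * _]mulrC => /(mulfI mu2N) <-.
  by move=> /(mulfI mu1N) <-.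
have sXl : size (c1 *: 'X^l + c0%:P) = l.+1.
  by rewrite size_polyDl size_scale ?size_polyXn // (leq_ltn_trans (size_polyC_leq1 _)) // addn3.
have sp1 : (size p <= 1)%N.
  have Xl0 : c1 *: 'X^l + c0%:P != 0 by rewrite -size_poly_eq0 sXl.
  move: sq; rewrite qE (size_mul_field p0 Xl0) sXl.
  by rewrite addnS -[in X in _ -> X](leq_add2r l) add1n.
have sal : (size al <= 1)%N.
  by move: sp1; rewrite pE size_sqr; case: (size al) => [|[|n]] //; rewrite mulnS.
have [ee alE] : exists ee : K, al = ee%:P by exists al`_0; rewrite -size1_polyC.
have ee0 : ee != 0 by move: p0; rewrite pE alE expf_eq0 /= polyC_eq0.
have eeV : ee^-1 != 0 by rewrite invr_eq0.
have [pab' NE'] := pade_scale eeV pab.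
exists ((ee^-1)%:P%:P * a), ((ee^-1)%:P%:P * b), c1, c0; split=> //.
  move=> x0 sx0; have := prim x0; rewrite !inE sx0 !orbT !hornerM !hornerC => /(_ isT).
  by rewrite !mulf_eq0 polyC_eq0 invr_eq0 (negPf ee0).
  by rewrite swapXYM swapXY_polyC map_polyC coefCM -aal alE -polyCM mulVf.
rewrite NE' NE mulrCA; congr (_ * _).
have eeE : (ee^-1 ^+ 2)%:P%:P * (ee ^+ 2)%:P%:P = 1 :> {poly {poly K}}.
  by rewrite -!polyCM -exprMn mulVf // expr1n.
rewrite ME qE pE alE -polyC_exp [(_ * (_ + _))^:P]rmorphM /= !map_polyC /=.
by rewrite -[RHS]mul1r -eeE; ring.
Qed.

End Pade.

(** * Multiplication by l as a twisted Frobenius *)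

Section Supersingular.
Variables (K : fieldType) (k : nat) (f : {poly K}).
Local Notation l := (2 * k + 3)%N.
Hypotheses (size_f : size f = 4%N) (pcharKl : l \in [pchar K]) (k_gt0 : (0 < k)%N).
Hypothesis hasse0 : (f ^+ k.+1)`_(2 * k + 2) = 0.
Hypothesis f_monic : f \is monic.
Local Notation F := (map_poly (pFrobenius_aut pcharKl) f).
Local Notation C := (drop_poly l (f ^+ k.+1)).
Local Notation c := ((f ^+ k.+1)`_(2 * k + 1)).

Lemma charl0 : (2 * k + 3)%:R = 0 :> K.
Proof. exact: pcharf0. Qed.

Lemma lead_cubic : f`_3 = 1.
Proof. by have := monicP f_monic; rewrite /lead_coef size_f. Qed.

Lemma high_lead : C`_k = 1.
Proof.
rewrite coef_drop_poly; have /monicP <- := monic_exp k.+1 f_monic.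
rewrite /lead_coef; congr nth; rewrite size_exp size_f; lia.
Qed.

(** The power g = f^(k+1) satisfies 2 f g' + f' g = (2k+3) f' g = 0. Splitting g at x^l, the low
    part contributes degree at most l because its degree is below l - 1, so the high part solves the
    equation up to a constant. Its value uses 2 (2k+1) + 3 = -1 in [K]. *)
Lemma high_ode : 2%:R * f * C^`() + f^`() * C = c%:P.
Proof.
have gE : take_poly l (f ^+ k.+1) + C * 'X^l = f ^+ k.+1 by rewrite poly_take_drop.
set L := take_poly l _ in gE *; set D := C in gE *.
have sL : (size L <= 2 * k + 2)%N by apply: size_low.
have ode : 2%:R * f * (f ^+ k.+1)^`() + f^`() * f ^+ k.+1 = 0.
  rewrite deriv_exp; transitivity ((2 * k + 3)%:R * f^`() * f ^+ k.+1).
    by rewrite exprS /= -[_ *+ k.+1]mulr_natr -[k.+1%:R]natr1 natrD natrM; ring.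
  by rewrite -polyC_natr charl0 !mul0r.
have Xl' : ('X^l : {poly K})^`() = 0.
  by rewrite derivXn -mulr_natr -polyC_natr charl0 mulr0.
have e : (2%:R * f * D^`() + f^`() * D) * 'X^l = - (2%:R * f * L^`() + f^`() * L).
  by apply/eqP; rewrite -addr_eq0 -[X in _ == X]ode -gE derivD derivM Xl'; apply/eqP; ring.
set E := 2%:R * f * D^`() + _ in e *.
have sf' : (size f^`() <= 3)%N by rewrite -ltnS -size_f lt_size_deriv // monic_neq0.
have sL' : (size L^`() <= 2 * k + 1)%N.
  have [->|L0] := eqVneq L 0; first by rewrite deriv0 size_poly0.
  by have := leq_trans (lt_size_deriv L0) sL; rewrite addn2 addn1.
have s2f : (size (2%:R * f)%R <= 4)%N.
  by rewrite mulr_natl -scaler_nat (leq_trans (size_scale_leq _ _)) ?size_f.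
have sE : (size E <= 1)%N.
  have : (size (E * 'X^l)%R <= l.+1)%N.
    rewrite e size_polyN (leq_trans (size_polyD _ _)) // geq_max; apply/andP; split.
      by apply: (size_mul_leqD s2f sL'); lia.
    by apply: (size_mul_leqD sf' sL); lia.
  have [->|E0] := eqVneq E 0; first by rewrite size_poly0.
  by rewrite size_Mmonic ?monicXn // size_polyXn addnS -[l.+1]add1n leq_add2r.
have /(congr1 (fun u : {poly K} => u`_l)) := e.
rewrite coefMXn ltnn subnn coefN => E0.
rewrite (size1_polyC sE) E0; congr _%:P; rewrite coefD.
have cL : L`_(2 * k + 1) = c by rewrite coef_take_poly ltn_add2l.
have sL1 : (size L^`() <= (2 * k).+1)%N by rewrite -addn1.
have sL2 : (size L <= (2 * k + 1).+1)%N by rewrite -addnS.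
have -> : (2%:R * f * L^`())`_l = 2%:R * ((2 * k + 1)%:R * c).
  rewrite [X in _`_X]addnC (coef_mul_top s2f sL1) coef_deriv -[in L`_ _]addn1 cL.
  by rewrite mulr_natl coefMn lead_cubic -[c *+ _]mulr_natl addn1.
have -> : (f^`() * L)`_l = 3%:R * c.
  rewrite [X in _`_X](_ : _ = 2 + (2 * k + 1))%N; last by rewrite addnCA.
  by rewrite (coef_mul_top sf' sL2) coef_deriv lead_cubic cL.
have -> : (2 * k + 1)%:R = - 2%:R :> K.
  by apply/eqP; rewrite -subr_eq0 opprK -natrD -addnA charl0.
by ring.
Qed.

Variables e1 e2 e3 : K.
Hypotheses (fE : f = ('X - e1%:P) * ('X - e2%:P) * ('X - e3%:P))
  (e12 : e1 != e2) (e13 : e1 != e3) (e23 : e2 != e3).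

Lemma frobE : F = ('X - (e1 ^+ l)%:P) * ('X - (e2 ^+ l)%:P) * ('X - (e3 ^+ l)%:P).
Proof. by rewrite fE !rmorphM !rmorphB /= map_polyX !map_polyC. Qed.

Lemma frob_inj : injective (fun x : K => x ^+ l).
Proof. exact: (fmorph_inj (pFrobenius_aut pcharKl)). Qed.

(** A nonzero solution gives (g * B^2)' = 0, so g * B^2, of degree at most l, is al * x^l + be. This
    has a single root by injectivity of Frobenius, whereas g vanishes at [x1] and [x2]. *)
Lemma cubic_ode_kernel (x1 x2 x3 : K) (g B : {poly K}) :
  g = ('X - x1%:P) * ('X - x2%:P) * ('X - x3%:P) -> x1 != x2 ->
  2%:R * g * B^`() + g^`() * B = 0 -> (size B <= k.+1)%N -> B = 0.
Proof.
move=> gE x12 ode sB; apply/eqP; apply: contraT => B0; case/eqP: x12.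
have gM : g \is monic by rewrite gE !monicMl ?monicXsubC.
have sg : size g = 4%N.
  by rewrite gE !size_Mmonic ?monicXsubC ?polyXsubC_eq0 ?mulf_neq0 ?polyXsubC_eq0 // !size_XsubC.
have sgB : size (g * B ^+ 2) = (2 * size B + 2)%N.
  rewrite (size_mul_field (monic_neq0 gM) (expf_neq0 2 B0)) sg size_sqr.
  have : (0 < size B)%N by rewrite size_poly_gt0.
  lia.
have gB' : (g * B ^+ 2)^`() = 0.
  rewrite derivM expr2 derivM; transitivity (B * (2%:R * g * B^`() + g^`() * B)); first by ring.
  by rewrite ode mulr0.
have sgB' : (size (g * B ^+ 2)%R <= l.+1)%N by rewrite sgB; lia.
have := deriv_eq0 pcharKl gB' sgB'; set al := _`_l; set be := _`_0 => gBE.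
have al0 : al != 0.
  apply: contra_eq_neq sgB => al0; rewrite gBE al0 scale0r add0r.
  by rewrite neq_ltn (leq_ltn_trans (size_polyC_leq1 _)) // addn2.
have rt x : root g x -> al * x ^+ l = - be.
  move/rootP=> gx; have := congr1 (fun u : {poly K} => u.[x]) gBE.
  rewrite hornerM gx mul0r hornerD hornerZ hornerXn hornerC => /esym/eqP.
  by rewrite addr_eq0 => /eqP.
apply: frob_inj; apply: (mulfI al0); rewrite !rt //.
  by rewrite gE !rootM !root_XsubC eqxx orbT.
by rewrite gE !rootM !root_XsubC eqxx.
Qed.

Section Normal.
Variables (a b : {poly {poly K}}) (c1 c0 : K).
Hypotheses (pab : pade k f a b) (a_top : (swapXY a)`_k.+2 = 1).
Hypothesis NE : pade_norm f pcharKl a b =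
  ('X^l%:P - 'X) * ('X%:P - (c1 *: 'X^l + c0%:P)^:P).
Local Notation xi := (c1 *: 'X^l + c0%:P).

Let sa : (size a <= k.+3)%N. Proof. by case: pab. Qed.
Let sb : (size b <= k.+1)%N. Proof. by case: pab. Qed.
Let sYa : (size (swapXY a) <= k.+3)%N. Proof. by rewrite -sizeYE; case: pab. Qed.
Let sYb : (size (swapXY b) <= k.+1)%N. Proof. by rewrite -sizeYE; case: pab. Qed.
Let sF : size F = 4%N. Proof. exact: size_frob. Qed.

Let sC : (size C <= k.+1)%N. Proof. exact: size_high. Qed.

Lemma normal_top : exists2 rho, rho ^+ 2 = c1 & a`_k.+2 = rho%:P.
Proof.
have e : a`_k.+2 ^+ 2 = c1%:P.
  have := congr1 (fun u : {poly {poly K}} => u`_(2 * k.+2)) NE.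
  rewrite /pade_norm coefB (coef_sqr_top sa) [(_ * b ^+ 2)`_ _]nth_default.
    rewrite subr0 => ->; rewrite (_ : 2 * k.+2 = l.+1)%N; last by lia.
    rewrite mulrBl coefB coefCM coefXM /= coefB coefC coef_map /= coefB coefC coef_map /=.
    rewrite !(coefD, coefZ, coefXn, coefC) eqxx (gtn_eqF (ltnSn l)) addn3 /=.
    by rewrite !mulr0 !addr0 mulr1 subr0 mulr0 !sub0r opprK.
  have sFf : (size (F^:P * f%:P : {poly {poly K}})%R <= 4)%N.
    by apply: (@size_mul_leqD _ _ _ 4 1); rewrite ?size_polyC_leq1 ?size_map_polyC ?sF.
  have sbb : (size (b ^+ 2) <= 2 * k + 1)%N.
    by rewrite expr2; apply: (size_mul_leqD sb sb); lia.
  by apply: (size_mul_leqD sFf sbb); lia.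
have sz : (size (a`_k.+2)%R <= 1)%N.
  have : size (a`_k.+2 ^+ 2) = size c1%:P by rewrite e.
  rewrite size_sqr; have := size_polyC_leq1 c1; lia.
exists (a`_k.+2)`_0; last exact: size1_polyC.
by apply: polyC_inj; rewrite polyC_exp -size1_polyC // e.
Qed.

Lemma normal_wronskian : pade_wr f pcharKl a b = pade_rho k f * ('X%:P - xi^:P).
Proof.
apply: pade_wronskian => //.
apply: sizeYD; rewrite ?sizeYN; first by rewrite sizeY_polyC size_polyX.
exact: leq_trans (sizeY_map_polyC _) _.
Qed.

(** Coefficient of X^(l+1) in the identity for the Wronskian. *)
Lemma normal_bottom rho : a`_k.+2 = rho%:P -> rho ^+ 2 = c1 -> rho != 0 ->
  b`_k = - rho *: C.
Proof.
move=> aE rhoE rho0; have := congr1 (fun u : {poly {poly K}} => u`_l.+1) normal_wronskian.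
have F3 : F`_3 = 1 by rewrite coef_map lead_cubic /= pFrobenius_aut1.
have F'2 : F^`()`_2 = 3%:R by rewrite coef_deriv F3.
have sF1 : (size F^:P <= 4)%N by rewrite size_map_polyC sF.
have sF' : (size F^`()^:P <= 3)%N.
  by rewrite size_map_polyC -ltnS -sF lt_size_deriv // -size_poly_eq0 sF.
have sa' : (size a^`() <= k.+2)%N.
  have [->|a0] := eqVneq a 0; first by rewrite deriv0 size_poly0.
  by rewrite -ltnS (leq_trans (lt_size_deriv a0)).
have sb' : (size b^`() <= k.-1.+1)%N.
  rewrite prednK //; have [->|b0] := eqVneq b 0; first by rewrite deriv0 size_poly0.
  by rewrite -ltnS (leq_trans (lt_size_deriv b0)).
have sab : (size (a * b)%R <= (k.+2 + k).+1)%N by apply: (size_mul_leqD sa sb); lia.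
have e1' : (a^`() * b)`_(2 * k + 1) = (rho%:P *+ k.+2) * b`_k.
  rewrite (_ : 2 * k + 1 = k.+1 + k)%N; last by lia.
  by rewrite (coef_mul_top sa' sb) coef_deriv aE.
have e2' : (a * b^`())`_(2 * k + 1) = rho%:P * (b`_k *+ k).
  rewrite (_ : 2 * k + 1 = k.+2 + k.-1)%N; last by lia.
  by rewrite (coef_mul_top sa sb') coef_deriv aE prednK.
have e3' : (a * b * F^`()^:P)`_l.+1 = rho%:P * b`_k * 3%:R.
  rewrite (_ : l.+1 = (k.+2 + k) + 2)%N; last by lia.
  by rewrite (coef_mul_top sab sF') (coef_mul_top sa sb) aE coef_map F'2 /= polyC_natr.
have sd : (size (a^`() * b - a * b^`())%R <= (2 * k + 1).+1)%N.
  apply: size_sub_leq; first by apply: (size_mul_leqD sa' sb); lia.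
  by apply: (size_mul_leqD sa sb'); lia.
have e4' : (F^:P * (a^`() * b - a * b^`()))`_l.+1 = 2%:R * (rho%:P * b`_k).
  rewrite (_ : l.+1 = 3 + (2 * k + 1))%N; last by lia.
  rewrite (coef_mul_top sF1 sd) coefB e1' e2' coef_map F3 mul1r.
  by rewrite -[k.+2]addn2 mulrnDr -mulr_natr -[b`_k *+ k]mulr_natr; ring.
rewrite /pade_wr coefB e3' mulr_natl coefMn e4'.
have sr : (size (pade_rho k f) <= 2)%N.
  rewrite /pade_rho addrC size_MXaddC; case: ifP => // _.
  by rewrite ltnS size_polyC_leq1.
have sM : (size ('X%:P - xi^:P : {poly {poly K}})%R <= l.+1)%N.
  apply: size_sub_leq; first by rewrite (leq_trans (size_polyC_leq1 _)).
  rewrite size_map_polyC (leq_trans (size_polyD _ _)) // geq_max.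
  rewrite (leq_trans (size_scale_leq _ _)) ?size_polyXn //=.
  by rewrite (leq_trans (size_polyC_leq1 _)).
have e6' : (pade_rho k f * ('X%:P - xi^:P))`_l.+1 = _ := coef_mul_top sr sM.
rewrite {}e6' => e5'.
have rhoP : rho%:P != 0 :> {poly K} by rewrite polyC_eq0.
apply: (mulfI rhoP); transitivity ((2%:R * (rho%:P * b`_k)) *+ 2 - rho%:P * b`_k * 3%:R).
  by rewrite -mulr_natr; ring.
have xl : xi`_l = rho ^+ 2.
  by rewrite coefD coefZ coefXn coefC eqxx mulr1 addn3 addr0.
have rho1 : (pade_rho k f)`_1 = C.
  by rewrite /pade_rho coefD coefC coefMX coefC /= add0r.
rewrite e5' coefB coefC coef_map rho1 xl gtn_eqF ?addn3 //= sub0r.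
by rewrite -mul_polyC expr2 polyCN polyCM; ring.
Qed.

(** Coefficient of x^(2k+2) in the same identity; the top x-coefficient of [a], being 1, has zero
    derivative. *)
Lemma normal_ode : 2%:R * F * ((swapXY b)`_k)^`() + F^`() * (swapXY b)`_k = - c%:P.
Proof.
have := congr1 (fun u : {poly {poly K}} => (swapXY u)`_(2 * k + 2)) normal_wronskian.
have -> : swapXY (pade_wr f pcharKl a b) = 2%:R * (F%:P *
     (swapXY a^`() * swapXY b - swapXY a * swapXY b^`())) - swapXY a * swapXY b * F^`()%:P.
  by rewrite /pade_wr !(swapXYB, swapXYM) !swapXY_map_polyC rmorph_nat.
rewrite (_ : 2 * k + 2 = k.+2 + k)%N; last by lia.
have sa' : (size (swapXY a^`()) <= k.+3)%N.
  by rewrite -sizeYE (leq_trans (sizeY_deriv _)) // sizeYE.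
have sb' : (size (swapXY b^`()) <= k.+1)%N.
  by rewrite -sizeYE (leq_trans (sizeY_deriv _)) // sizeYE.
rewrite coefB coefMC mulr_natl coefMn coefCM coefB.
rewrite (coef_mul_top sa' sYb) (coef_mul_top sYa sb') (coef_mul_top sYa sYb).
rewrite !swapXY_deriv a_top -polyC1 derivC mul0r !mul1r sub0r.
rewrite (_ : k.+2 + k = 2 * k + 1 + 1)%N; last by lia.
have -> : swapXY (pade_rho k f * ('X%:P - xi^:P)) =
   ((take_poly l (f ^+ k.+1))^:P + C^:P * 'X%:P) * ('X - xi%:P).
  rewrite swapXYM swapXYB swapXY_map_polyC swapXY_Y /pade_rho rmorphD /=.
  by rewrite swapXYM !swapXY_polyC swapXY_X.
have sr : (size ((take_poly l (f ^+ k.+1))^:P + C^:P * 'X%:P)%R <= (2 * k + 1).+1)%N.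
  rewrite (leq_trans (size_polyD _ _)) // geq_max size_map_polyC -addnS size_low //=.
  apply: (@size_mul_leqD _ _ _ k.+1 1); rewrite ?size_map_polyC ?size_polyC_leq1 //; lia.
rewrite (coef_mul_top sr) ?size_XsubC // coefB coefX coefC subr0 mulr1.
rewrite coefD coefMC !coef_map coef_take_poly ltn_add2l /= [C`_ _]nth_default; last first.
  by rewrite (leq_trans sC) //; lia.
rewrite polyC0 mul0r addr0 => <-; rewrite -mulr_natr; ring.
Qed.

(** The coefficient of x^k X^k in [b] is read in two ways: from the top coefficient in X, which is
    [- rho *: C], and from the top one in x, which solves the twisted differential equation. [C]
    being monic, this relates [rho] to [c]. *)
Lemma normal_rho rho : a`_k.+2 = rho%:P -> rho ^+ 2 = c1 -> rho != 0 ->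
  rho * c ^+ (2 * k + 2) = 1.
Proof.
move=> aE rhoE rho0; have bE := normal_bottom aE rhoE rho0.
have odeC := high_ode; have odeB := normal_ode.
have c_neq0 : c != 0.
  apply/negP=> /eqP c0'; have := high_lead; rewrite c0' in odeC.
  by rewrite (cubic_ode_kernel fE e12 odeC sC) // coef0 => /esym/eqP; rewrite oner_eq0.
(* The top x-coefficient of [b] solves the twisted equation with right-hand side -c, the twist of
   [C] solves it with c^l; this combination solves the homogeneous equation. *)
pose D := (c ^+ l) *: (swapXY b)`_k + c *: map_poly (pFrobenius_aut pcharKl) C.
have odeC' : 2%:R * F * (map_poly (pFrobenius_aut pcharKl) C)^`()
    + F^`() * map_poly (pFrobenius_aut pcharKl) C = (c ^+ l)%:P.
  have := congr1 (map_poly (pFrobenius_aut pcharKl)) odeC.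
  by rewrite rmorphD !rmorphM /= map_polyC rmorph_nat -!deriv_map.
have D0 : D = 0.
  apply: (cubic_ode_kernel frobE); first by rewrite (inj_eq frob_inj).
    transitivity ((c ^+ l) *: (2%:R * F * ((swapXY b)`_k)^`() + F^`() * (swapXY b)`_k)
      + c *: (2%:R * F * (map_poly (pFrobenius_aut pcharKl) C)^`()
         + F^`() * map_poly (pFrobenius_aut pcharKl) C)).
      by rewrite /D derivD !derivZ -!mul_polyC; ring.
    by rewrite odeB odeC' -!mul_polyC; ring.
  rewrite (leq_trans (size_polyD _ _)) // geq_max !(leq_trans (size_scale_leq _ _)) //.
    by rewrite size_map_poly.
  by rewrite (leq_trans (max_size_coefXY _ _)) // sizeYE swapXYK.
have := congr1 (fun u : {poly K} => u`_k) D0.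
rewrite coefD !coefZ coef_map coef_swapXY bE coefZ high_lead /= coef0 => e.
move/eqP: e; rewrite pFrobenius_aut1 !mulr1 mulrN addrC subr_eq0 => /eqP ce.
by apply: (mulfI c_neq0); rewrite mulr1 mulrCA -exprS -addnS {2}ce mulrC.
Qed.


Lemma size_xi_exp i : (size (xi ^+ i) <= (l * i).+1)%N.
Proof.
apply: leq_trans (size_poly_exp_leq _ _) _; rewrite ltnS leq_mul2r; apply/orP; right.
have : (size xi <= l.+1)%N.
  rewrite (leq_trans (size_polyD _ _)) // geq_max (leq_trans (size_polyC_leq1 _)) // andbT.
  by rewrite (leq_trans (size_scale_leq _ _)) ?size_polyXn.
by rewrite -subn1 leq_subLR add1n.
Qed.

Lemma size_horner_xi (u : {poly {poly K}}) n j : (size u <= n.+1)%N ->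
  (sizeY u <= j.+1)%N -> (size (u.[xi])%R <= (n * l + j).+1)%N.
Proof.
move=> su sYu; rewrite (horner_coef_wide _ su) (leq_trans (size_sum _ _ _)) //.
apply/bigmax_leqP => i _.
apply: (size_mul_leqD (leq_trans (max_size_coefXY u i) sYu) (size_xi_exp i)).
have lt_i := ltn_ord i; have : (l * i <= l * n)%N by rewrite leq_mul2l -ltnS lt_i orbT.
by rewrite (mulnC n); move: (l * i)%N (l * n)%N => x y; lia.
Qed.

Lemma coef_horner_xi (u : {poly {poly K}}) n j : (size u <= n.+1)%N ->
  (sizeY u <= l)%N -> (size (u`_n)%R <= j.+1)%N ->
  (u.[xi])`_(n * l + j) = u`_n`_j * c1 ^+ n.
Proof.
move=> su sYu sj.
have cxi i : (xi ^+ i)`_(l * i) = c1 ^+ i.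
  elim: i => [|i IHi]; first by rewrite muln0 coefC.
  rewrite exprS mulnS (coef_mul_top _ (size_xi_exp i)) ?IHi.
    by rewrite coefD coefZ coefXn coefC eqxx mulr1 addn3 addr0 exprS.
  by have := size_xi_exp 1; rewrite muln1 expr1.
rewrite (horner_coef_wide _ su) big_ord_recr coefD coef_sum big1 ?add0r /= => [|i _].
  have -> : (n * l + j = j + l * n)%N by rewrite addnC mulnC.
  by rewrite (coef_mul_top sj (size_xi_exp n)) cxi.
rewrite nth_default //; apply: (size_mul_leqD (leq_trans (max_size_coefXY u i) sYu) (size_xi_exp i)).
have := ltn_ord i => lt_i; have : (l * i.+1 <= l * n)%N by rewrite leq_mul2l lt_i orbT.
by rewrite mulnS mulnC; lia.
Qed.

Section Sign.
Variable rho : K.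
Hypotheses (rho0 : rho != 0) (rhoE : rho ^+ 2 = c1) (aE : a`_k.+2 = rho%:P).
Local Notation A1 := (swapXY a).[xi].
Local Notation B1 := (swapXY b).[xi].

Lemma coef_A1 : A1`_(k.+2 * l) = c1 ^+ k.+2.
Proof.
rewrite -[X in _`_X]addn0 coef_horner_xi ?a_top ?coefC ?mul1r ?size_polyC_leq1 //.
by rewrite sizeYE swapXYK (leq_trans sa) //; lia.
Qed.

Lemma coef_B1 : B1`_(k * l + k) = - rho * c1 ^+ k.
Proof.
rewrite coef_horner_xi //.
- by rewrite coef_swapXY (normal_bottom aE rhoE rho0) coefZ high_lead mulr1.
- by rewrite sizeYE swapXYK (leq_trans sb) //; lia.
- by rewrite (leq_trans (max_size_coefXY _ _)) // sizeYE swapXYK.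
Qed.

Lemma size_B1 : (size B1 <= (k * l + k).+1)%N.
Proof. by apply: size_horner_xi; rewrite ?sizeYE ?swapXYK. Qed.

Lemma normal_square : A1 ^+ 2 = F * (f \Po xi) * B1 ^+ 2.
Proof.
have NEs : swapXY a ^+ 2 - F%:P * f^:P * swapXY b ^+ 2 = ('X^l - 'X%:P) * ('X - xi%:P).
  have := congr1 swapXY NE; rewrite /pade_norm !expr2 !(swapXYB, swapXYM).
  by rewrite !swapXY_map_polyC !swapXY_polyC swapXY_X map_polyX map_polyXn.
have /eqP := congr1 (fun u : {poly {poly K}} => u.[xi]) NEs.
rewrite [in X in _ == X]hornerM hornerXsubC subrr mulr0 hornerD hornerN !hornerM hornerC.
by rewrite subr_eq0 -!expr2 => /eqP.
Qed.

(** In [normal_square] the simple roots r of [F] must occur with odd multiplicity in [f \Po xi]. So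
    x |-> c1 * x^(l^2) + c0 sends the roots of f to roots of f, injectively, hence permutes them. *)
Lemma comp_xi : f \Po xi = c1 ^+ 3 *: F ^+ l.
Proof.
have c1N : c1 != 0 by rewrite -rhoE expf_neq0.
have A10 : A1 != 0.
  by apply: contra_eq_neq coef_A1 => ->; rewrite coef0 eq_sym expf_neq0.
have B10 : B1 != 0.
  by apply: contra_eq_neq coef_B1 => ->; rewrite coef0 eq_sym mulf_neq0 ?oppr_eq0 ?expf_neq0.
have fx0 : f \Po xi != 0.
  by apply: contraNneq A10 => fx0; rewrite -sqrf_eq0 normal_square fx0 mulr0 mul0r.
have F0 : F != 0 by rewrite -size_poly_eq0 sF.
have rt r : mup r F = 1%N -> root f (c1 * r ^+ l + c0).
  move=> Fr; have : root (f \Po xi) r.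
    apply: contraT => /mupNroot mu0; have := congr1 (mup r) normal_square.
    rewrite mup_sqr // mupM ?mulf_neq0 ?expf_neq0 // mupM // mup_sqr // Fr mu0.
    by move/(congr1 odd); rewrite addn0 add1n !mul2n /= !odd_double.
  by rewrite !rootE horner_comp hornerD hornerZ hornerXn hornerC.
have FE : F = \prod_(y <- [:: e1 ^+ l; e2 ^+ l; e3 ^+ l]) ('X - y%:P).
  by rewrite frobE !big_cons big_nil mulr1 mulrA.
have ue : uniq [:: e1; e2; e3] by rewrite /= !inE negb_or e12 e13 e23.
pose g x : K := c1 * (x ^+ l) ^+ l + c0.
have rg x : x \in [:: e1; e2; e3] -> root f (g x).
  move=> xe; apply: rt; rewrite FE mu_prod_XsubC -[RHS]/(nat_of_bool true).
  rewrite (count_map (fun x => x ^+ l) (pred1 (x ^+ l)) [:: e1; e2; e3]).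
  rewrite (eq_count (a2 := pred1 x)) ?(count_uniq_mem _ ue) ?xe //.
  by move=> y /=; rewrite (inj_eq frob_inj).
have gI : injective g.
  by move=> x y /addIr/(mulfI c1N)/frob_inj/frob_inj.
have fg : f = ('X - (g e1)%:P) * ('X - (g e2)%:P) * ('X - (g e3)%:P).
  have sz : size f = (size (map g [:: e1; e2; e3])).+1 by rewrite size_f.
  rewrite {1}(all_roots_prod_XsubC sz) ?(monicP f_monic) ?scale1r.
  - by rewrite !big_cons big_nil mulr1 mulrA.
  - by rewrite /= !rg // !inE eqxx ?orbT.
  - by rewrite uniq_rootsE (map_inj_uniq gI).
have gE x : ('X - (g x)%:P) \Po xi = c1 *: ('X - (x ^+ l)%:P) ^+ l.
  rewrite comp_polyB comp_polyX comp_polyC (XnsubX pcharKl) scalerBr /g polyCD polyCM.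
  by rewrite -!mul_polyC; ring.
rewrite {1}fg !comp_polyM !gE frobE !exprMn -!mul_polyC.
by rewrite polyC_exp; move: (_ ^+ l) (_ ^+ l) (_ ^+ l) => u v w; ring.
Qed.

(** The squares of both sides agree, and the coefficients of degree (k+2) l select the sign. *)
Lemma normal_sign : A1 = - rho ^+ 3 *: (F ^+ k.+2 * B1).
Proof.
have c1N : c1 != 0 by rewrite -rhoE expf_neq0.
have two0 : 2%:R != 0 :> K.
  rewrite -(dvdn_pcharf pcharKl) gtnNdvd //; lia.
have : (A1 - rho ^+ 3 *: (F ^+ k.+2 * B1)) * (A1 + rho ^+ 3 *: (F ^+ k.+2 * B1)) == 0.
  have e6 : (rho ^+ 3) ^+ 2 = c1 ^+ 3 by rewrite -rhoE -!exprM.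
  have eF : (F ^+ k.+2) ^+ 2 = F * F ^+ l by rewrite -exprM -exprS; congr (_ ^+ _); lia.
  by rewrite -subr_sqr normal_square comp_xi exprZn e6 [(F ^+ _ * _) ^+ 2]exprMn eF subr_eq0 -scalerAr -scalerAl.
rewrite mulf_eq0 subr_eq0 addr_eq0 -scaleNr => /orP[/eqP e|/eqP //].
have : A1`_(k.+2 * l) == - A1`_(k.+2 * l).
  rewrite {1}e coefZ (_ : k.+2 * l = 3 * k.+2 + (k * l + k))%N; last by nia.
  rewrite (coef_mul_top _ size_B1).
    have FT : (F ^+ k.+2)`_(3 * k.+2) = 1.
      have FM : F ^+ k.+2 \is monic by rewrite monic_exp // map_monic.
      rewrite -(monicP FM) /lead_coef; congr nth; rewrite size_exp sF; lia.
    rewrite FT coef_B1 mul1r (_ : 3 * k.+2 + (k * l + k) = k.+2 * l)%N ?coef_A1; last by nia.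
    by apply/eqP; rewrite !exprS -rhoE; ring.
  by apply: leq_trans (size_poly_exp_leq _ _) _; rewrite sF ltnS.
by rewrite -addr_eq0 -mulr2n -mulr_natr mulf_eq0 (negPf two0) orbF coef_A1 expf_eq0 (negPf c1N) andbF.
Qed.
End Sign.
End Normal.

(** The pair is specialized at X = x^l. When b0 does not vanish at [xi], the remaining zero of the
    Miller function is (rho^2 x^(l^2) + c0, rho^3 y^(l^2)). If xi = x and b0(x) = 0, the equation on
    a0 reads 0 = 0; the last assertion recovers some information in that case. *)
Lemma supersingular_frobenius (s : seq K) x1 y1 xi1 a1 b1 x2 y2 xi2 a2 b2 :
  miller k f x1 y1 xi1 a1 b1 -> miller k f x2 y2 xi2 a2 b2 -> xi1 != xi2 ->
  exists rho c0, rho * c ^+ (2 * k + 2) = 1 /\ {in s, forall x y xi a0 b0,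
    miller k f x y xi a0 b0 ->
    [/\ xi = rho ^+ 2 * (x ^+ l) ^+ l + c0, a0.[xi] = - rho ^+ 3 * (y ^+ l) ^+ l * b0.[xi]
      & ~ [/\ root b0 x, xi = x, x ^+ l = x, y ^+ l = y & rho = 1]]}.
Proof.
have l1E : (2 * k.+2 = l.+1)%N by lia.
move=> mil1 mil2 ne_xi.
have [a [b [c1 [c0 [pab c1N prim a_top NE]]]]] :=
  pade_normal size_f pcharKl k_gt0 hasse0 (map (fun x => x ^+ l) s) mil1 mil2 ne_xi.
have [rho rhoE aE] := normal_top pab NE.
have rho0 : rho != 0 by apply: contraNneq c1N => rho0; rewrite -rhoE rho0 expr0n.
exists rho, c0; split; first by apply: (normal_rho pab a_top NE).
move=> x sx y xi a0 b0 mil; set X0 := x ^+ l.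
set Xi := c1 *: 'X^l + c0%:P in NE.
have sYM : (sizeY ('X%:P - Xi^:P : {poly {poly K}})%R <= 2)%N.
  apply: sizeYD; rewrite ?sizeYN; first by rewrite sizeY_polyC size_polyX.
  exact: leq_trans (sizeY_map_polyC _) _.
have prim0 := prim X0 (map_f (fun x => x ^+ l) sx).
have [[kap kap0 [a0E b0E]] [mu mu0 ME]] :=
  miller_pade size_f k_gt0 pab NE sYM prim0 mil.
case: (mil) => fx y0 [c' c'0 N0E] _.
have XiE : Xi.[X0] = xi.
  have MX : ('X%:P - Xi^:P).[X0%:P] = 'X - (Xi.[X0])%:P.
    by rewrite hornerD hornerN hornerC horner_map.
  move: ME; rewrite MX => e; have e1' := congr1 (fun u : {poly K} => u`_1) e.
  have := congr1 (fun u : {poly K} => u`_0) e; move: e1'.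
  rewrite !(coefB, coefZ, coefX, coefC) /= !subr0 !sub0r mulr1 mulrN => <-.
  by rewrite mul1r => /oppr_inj.
have FX0 : F.[X0] = (y ^+ 2) ^+ l by rewrite frob_horner fx.
have sgn := normal_sign pab a_top NE rho0 rhoE aE.
have sgn0 (u : {poly {poly K}}) : (swapXY u).[Xi].[X0] = u.[X0%:P].[xi].
  by rewrite horner_poly_swapXY XiE.
split.
- by rewrite -XiE hornerD hornerZ hornerXn hornerC -rhoE.
- have := congr1 (fun u : {poly K} => u.[X0]) sgn.
  rewrite hornerZ hornerM horner_exp !sgn0 FX0 => e.
  have yl0 : y ^+ l != 0 by rewrite expf_neq0.
  apply: (mulfI yl0); rewrite -hornerZ a0E hornerZ e b0E hornerZ.
  have -> : ((y ^+ 2) ^+ l) ^+ k.+2 = y ^+ l * (y ^+ l) ^+ l.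
    rewrite -!exprM -exprD; congr (_ ^+ _).
    by rewrite -[RHS]mulnS -l1E mulnCA mulnA.
  by ring.
case=> b0x xix xlx yly rho1.
have a0x : root a0 x.
  rewrite rootE -sqrf_eq0 -horner_exp; apply/eqP.
  have -> : a0 ^+ 2 = f * b0 ^+ 2 + c' *: (('X - x%:P) ^+ l * ('X - xi%:P)).
    by rewrite -N0E addrC subrK.
  rewrite hornerD hornerM horner_exp (rootP b0x) hornerZ hornerM xix hornerXsubC subrr.
  by rewrite expr0n !mulr0 addr0.
have Ax : root a.[X0%:P] x by rewrite -(rootZ _ _ kap0) -a0E rootZ ?expf_neq0.
have Bx : root b.[X0%:P] x by rewrite -(rootZ _ _ kap0) -b0E.
case/factor_theorem: (Ax) => A' AE; case/factor_theorem: (Bx) => B' BE.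
have xiX : ('X - xi%:P) = ('X - x%:P) by rewrite xix.
have Xl' : ('X^l : {poly K})^`() = 0.
  by rewrite derivXn -mulr_natr -polyC_natr charl0 mulr0.
have Xi'0 : Xi^`() = 0 by rewrite /Xi derivD derivZ Xl' derivC scaler0 addr0.
have MD : ('X%:P - Xi^:P)^`() = 0 :> {poly {poly K}}.
  by rewrite derivB derivC [(Xi^:P)^`()]deriv_map Xi'0 rmorph0 subr0.
have FX0y : F.[X0] = y ^+ 2 by rewrite FX0 exprAC yly.
(* The X-derivative of the norm identity at [X0], divided by 'X - x. *)
have key : 2%:R * A' * a^`().[X0%:P] - (F^`()).[X0]%:P * f * ('X - x%:P) * B' ^+ 2
    - 2%:R * (F.[X0])%:P * f * B' * b^`().[X0%:P] = -1.
  apply: (@mulIf _ ('X - x%:P)); first by rewrite polyXsubC_eq0.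
  have := congr1 (fun u : {poly {poly K}} => u^`().[X0%:P]) NE.
  rewrite /= deriv_norm deriv_Xl MD mulr0 addr0.
  rewrite hornerN [('X%:P - _).[_]]hornerD hornerN !hornerC horner_map /= XiE xiX mulN1r => <-.
  rewrite !(hornerD, hornerN, hornerM, hornerC) !horner_map /= AE BE.
  by ring.
have fy2 : f.[x] ^+ k.+2 = y ^+ 2.
  by rewrite fx -exprM l1E exprS yly.
have A'x : A'.[x] = - (y ^+ 2 * B'.[x]).
  have : ('X - x%:P) ^+ 2 %| (A' + f ^+ k.+2 * B') * ('X - x%:P).
    have -> : (A' + f ^+ k.+2 * B') * ('X - x%:P) = a.[X0%:P] + f ^+ k.+2 * b.[X0%:P].
      by rewrite AE BE; ring.
    by apply: dvdp_trans (pade_at pcharKl x pab); rewrite dvdp_exp2l // addn3.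
  rewrite expr2 dvdp_mul2r ?polyXsubC_eq0 // dvdp_XsubCl => /rootP.
  by rewrite hornerD hornerM horner_exp fy2 => /eqP; rewrite addr_eq0 => /eqP.
have a'x : a^`().[X0%:P].[x] = - (y ^+ 2 * b^`().[X0%:P].[x]).
  have dsw (u : {poly {poly K}}) : ((swapXY u).[Xi])^`() = (swapXY u^`()).[Xi].
    have su : (size (swapXY u^`()) <= size (swapXY u))%N by rewrite -!sizeYE sizeY_deriv.
    rewrite horner_coef (horner_coef_wide _ su) raddf_sum; apply: eq_bigr => i _.
    by rewrite /= derivM swapXY_deriv deriv_exp Xi'0 mul0r mul0rn mulr0 addr0.
  have := congr1 (fun u : {poly K} => u^`().[X0]) sgn.
  rewrite /= derivZ derivM !dsw hornerZ hornerD hornerM (hornerM (F ^+ _)) !sgn0 xix (rootP Bx) mulr0 add0r.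
  by rewrite horner_exp FX0y -fx fy2 rho1 expr1n mulN1r fx.
(* At x, both [A'] and the X-derivative of [a] are -y^2 times their counterparts for [b], so the two
   remaining terms of [key] cancel and 0 = -1. *)
have := congr1 (fun u : {poly K} => u.[x]) key.
rewrite !(hornerD, hornerN, hornerM, hornerC, hornerX) subrr A'x a'x fx FX0y.
rewrite !(mulr0, mul0r) subr0 => e; case/eqP: (oner_neq0 K).
apply: oppr_inj; rewrite oppr0 -[LHS]e; ring.
Qed.

End Supersingular.

(** * The Tate normal form with a point of order 7 *)

Section TateNormalForm.
Variable R : comNzRingType.
Implicit Types d x : R.

Definition tate_b2 d := (1 + d - d ^+ 2) ^+ 2 + 4%:R * (d ^+ 2 - d ^+ 3).
Definition tate_lin d x := (1 + d - d ^+ 2) * x + (d ^+ 2 - d ^+ 3).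
(** In spite of its name, the cubic 4 x^3 + b_2 x^2 + 2 b_4 x + b_6, which is the square of 2 Y +
    a_1 x + a_3 on the curve. *)
Definition tate_quartic d x := tate_lin d x ^+ 2 + 4%:R * (x ^+ 3 + (d ^+ 2 - d ^+ 3) * x ^+ 2).
Definition tate_c4 d := (d ^+ 2 - d + 1) * (d ^+ 6 - 11%:R * d ^+ 5 + 30%:R * d ^+ 4
  - 15%:R * d ^+ 3 - 10%:R * d ^+ 2 + 5%:R * d + 1).
(** The opposite of the usual invariant c_6, whence the sign of 54 c_6 in the short model. *)
Definition tate_c6 d := d ^+ 12 - 18%:R * d ^+ 11 + 117%:R * d ^+ 10 - 354%:R * d ^+ 9
  + 570%:R * d ^+ 8 - 486%:R * d ^+ 7 + 273%:R * d ^+ 6 - 222%:R * d ^+ 5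
  + 174%:R * d ^+ 4 - 46%:R * d ^+ 3 - 15%:R * d ^+ 2 + 6%:R * d + 1.
Definition tate_disc d := d ^+ 7 * (d - 1) ^+ 7 * (d ^+ 3 - 8%:R * d ^+ 2 + 5%:R * d + 1).

(** The usual passage to the short model, with abscissa 36 x + 3 b_2 and ordinate 108 (2 Y + a_1 x +
    a_3). *)
Lemma tate_short d x : (36%:R * x + 3%:R * tate_b2 d) ^+ 3
   - 27%:R * tate_c4 d * (36%:R * x + 3%:R * tate_b2 d) + 54%:R * tate_c6 d =
  108%:R ^+ 2 * tate_quartic d x.
Proof. rewrite /tate_b2 /tate_quartic /tate_lin /tate_c4 /tate_c6; ring. Qed.

Lemma tate_discE d : tate_c4 d ^+ 3 - tate_c6 d ^+ 2 = 1728%:R * tate_disc d.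
Proof. rewrite /tate_c4 /tate_c6 /tate_disc; ring. Qed.

(* Coordinates of [mP]; the ordinate is that of the model [Y^2 = tate_quartic d X]. *)
Definition tate_x m d : R := match m with
  | 2 | 5 => d ^+ 3 - d ^+ 2 | 3 | 4 => d ^+ 2 - d | _ => 0 end.

Definition tate_y m d : R := match m with
  | 1 => - (d ^+ 2 * (d - 1)) | 6 => d ^+ 2 * (d - 1)
  | 2 => d ^+ 3 * (d - 1) ^+ 2 | 5 => - (d ^+ 3 * (d - 1) ^+ 2)
  | 3 => - (d * (d - 1) ^+ 3) | 4 => d * (d - 1) ^+ 3 | _ => 0 end.

(* The pair [(u, v)] stands for the function [u + v * Y], found by Miller's algorithm, of divisor
   [i(jP) + (-ijP) - (i+1)(O)] with [P = (0, 0)] of order 7 on the Tate normal form. *)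
Definition tate_miller j i d x : R * R := match j, i with
    | 1, 1 => (x, 0)
    | 1, 2 => (0, 1)
    | 1, 3 => (x ^+ 2, (- 1))
    | 1, 4 => ((- d) * x ^+ 2, x + d)
    | 1, 5 => (x ^+ 3 + d ^+ 2 * x ^+ 2, (- 1 - d) * x + (- d ^+ 2))
    | 1, 6 => ((- 1 - d) * x ^+ 3 + (- d ^+ 2) * x ^+ 2, x ^+ 2 + (1 + 2%:R * d) * x + d ^+ 2)
    | 2, 1 => (x + (d ^+ 2 - d ^+ 3), 0)
    | 2, 2 => ((1 - d ^+ 2) * x + (d ^+ 2 + d ^+ 4 - 2%:R * d ^+ 3), 1)
    | 2, 3 => (- x ^+ 2 + (2%:R * d ^+ 3 - d ^+ 2 - d ^+ 4) * x, d ^+ 2)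
    | 2, 4 => ((1 + d - 2%:R * d ^+ 2) * x ^+ 2 + (2%:R * d ^+ 2 + 4%:R * d ^+ 5 - 2%:R * d ^+
      3 - 3%:R * d ^+ 4 - d ^+ 6) * x + (d ^+ 4 + 3%:R * d ^+ 6 - 3%:R * d ^+ 5 - d ^+ 7), x +
      (d ^+ 2 + d ^+ 4 - 2%:R * d ^+ 3))
    | 2, 5 => (- x ^+ 3 + (6%:R * d ^+ 3 - d - 2%:R * d ^+ 2 - 3%:R * d ^+ 4) * x ^+ 2 + (3%:R
      * d ^+ 4 + 4%:R * d ^+ 5 + 6%:R * d ^+ 7 - 2%:R * d ^+ 3 - 10%:R * d ^+ 6 - d ^+ 8) * x +
      (4%:R * d ^+ 6 + 4%:R * d ^+ 8 - d ^+ 5 - 6%:R * d ^+ 7 - d ^+ 9), (2%:R * d ^+ 2 - d) *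
      x + (4%:R * d ^+ 4 + d ^+ 6 - d ^+ 3 - 4%:R * d ^+ 5))
    | 2, 6 => ((1 + d - 3%:R * d ^+ 2) * x ^+ 3 + (3%:R * d ^+ 2 + 12%:R * d ^+ 5 - 3%:R * d ^+
      3 - 8%:R * d ^+ 4 - 4%:R * d ^+ 6) * x ^+ 2 + (3%:R * d ^+ 4 + 5%:R * d ^+ 6 + 10%:R * d
      ^+ 7 + 7%:R * d ^+ 9 - 9%:R * d ^+ 5 - 15%:R * d ^+ 8 - d ^+ 10) * x + (d ^+ 6 + 10%:R *
      d ^+ 8 + 5%:R * d ^+ 10 - 5%:R * d ^+ 7 - 10%:R * d ^+ 9 - d ^+ 11), x ^+ 2 + (2%:R * d
      ^+ 2 + 3%:R * d ^+ 4 - 4%:R * d ^+ 3) * x + (d ^+ 4 + 7%:R * d ^+ 6 + d ^+ 8 - 4%:R * d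
      ^+ 5 - 5%:R * d ^+ 7))
    | 3, 1 => (x + (d - d ^+ 2), 0)
    | 3, 2 => ((d - 1) * x, (- 1))
    | 3, 3 => (x ^+ 2 + (1 + d ^+ 2 - d - d ^+ 3) * x + (d ^+ 2 + d ^+ 4 - 2%:R * d ^+ 3), (1 +
      d ^+ 2 - 2%:R * d))
    | 3, 4 => ((2%:R - 2%:R * d) * x ^+ 2 + (1 + d ^+ 4 - d - d ^+ 3) * x + (d ^+ 2 + 3%:R * d
      ^+ 4 - 3%:R * d ^+ 3 - d ^+ 5), x + (1 + 2%:R * d ^+ 2 - 2%:R * d - d ^+ 3))
    | 3, 5 => (x ^+ 3 + (3%:R + 2%:R * d ^+ 2 - 4%:R * d - d ^+ 3) * x ^+ 2 + (1 + d ^+ 4 - d -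
      d ^+ 3) * x + (d ^+ 2 + 3%:R * d ^+ 4 - 3%:R * d ^+ 3 - d ^+ 5), (2%:R + d ^+ 2 - 3%:R *
      d) * x + (1 + d ^+ 2 - 2%:R * d))
    | 3, 6 => ((4%:R * d - 3%:R - d ^+ 2) * x ^+ 3 + (9%:R * d + 8%:R * d ^+ 3 + d ^+ 5 - 4%:R
      - 9%:R * d ^+ 2 - 5%:R * d ^+ 4) * x ^+ 2 + (2%:R * d + 4%:R * d ^+ 3 + 2%:R * d ^+ 5 - 1
      - 2%:R * d ^+ 2 - 5%:R * d ^+ 4) * x + (4%:R * d ^+ 3 + 4%:R * d ^+ 5 - d ^+ 2 - 6%:R * d
      ^+ 4 - d ^+ 6), - x ^+ 2 + (8%:R * d + 6%:R * d ^+ 3 - 3%:R - 10%:R * d ^+ 2 - d ^+ 4) *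
      x + (3%:R * d + 2%:R * d ^+ 4 - 1 - 3%:R * d ^+ 2 - d ^+ 5))
  | _, _ => (0, 0)
  end.

(** For eta = 2 Y + [tate_lin], twice u + v * Y is [miller_num + miller_den * eta]. *)
Definition miller_num j i d x := 2%:R * (tate_miller j i d x).1
  - (tate_miller j i d x).2 * tate_lin d x.
Definition miller_den j i d x := (tate_miller j i d x).2.

Lemma tate_yE m d : (0 < m < 7)%N -> tate_y m d ^+ 2 = tate_quartic d (tate_x m d).
Proof.
by move: m => [|[|[|[|[|[|[|m]]]]]]] //= _; rewrite /tate_quartic /tate_lin; ring.
Qed.

Lemma tate_miller_norm j i d x : (0 < j < 4)%N -> (0 < i < 7)%N ->
  miller_num j i d x ^+ 2 - tate_quartic d x * miller_den j i d x ^+ 2 =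
  4%:R * (-1) ^+ i.+1 * ((x - tate_x j d) ^+ i * (x - tate_x ((i * j) %% 7) d)).
Proof.
move: j i => [|[|[|[|j]]]] // [|[|[|[|[|[|[|i]]]]]]] // _ _;
  rewrite /miller_num /miller_den /tate_miller /tate_quartic /tate_lin /=; ring.
Qed.

(** The function vanishes at -ijP, whose ordinate is the opposite of that of ijP. *)
Lemma tate_miller_zero j i d : (0 < j < 4)%N -> (0 < i < 7)%N ->
  miller_num j i d (tate_x ((i * j) %% 7) d) =
  tate_y ((i * j) %% 7) d * miller_den j i d (tate_x ((i * j) %% 7) d).
Proof.
move: j i => [|[|[|[|j]]]] // [|[|[|[|[|[|[|i]]]]]]] // _ _;
  rewrite /miller_num /miller_den /tate_miller /tate_lin /=; ring.
Qed.

(** This is twice the value of the function at -jP. Being nonzero as soon as 2, d and d - 1 are, it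
    shows that the zero of the norm at the abscissa of jP lies entirely at jP. For i = 1 the
    function is a vertical line, which does vanish at -jP. *)
Lemma tate_miller_conj j i d : (0 < j < 4)%N -> (1 < i < 7)%N ->
  exists s m n, miller_num j i d (tate_x j d) - tate_y j d * miller_den j i d (tate_x j d) =
  2%:R * (-1) ^+ s * d ^+ m * (d - 1) ^+ n.
Proof.
move: j i => [|[|[|[|j]]]] // [|[|[|[|[|[|[|i]]]]]]] // _ _;
  rewrite /miller_num /miller_den /tate_miller /tate_lin /=.
- by exists 0%N, 2%N, 1%N; ring.
- by exists 1%N, 2%N, 1%N; ring.
- by exists 0%N, 3%N, 1%N; ring.
- by exists 1%N, 4%N, 1%N; ring.
- by exists 0%N, 4%N, 1%N; ring.
- by exists 1%N, 3%N, 2%N; ring.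
- by exists 1%N, 5%N, 2%N; ring.
- by exists 1%N, 6%N, 3%N; ring.
- by exists 1%N, 7%N, 4%N; ring.
- by exists 1%N, 9%N, 4%N; ring.
- by exists 1%N, 1%N, 3%N; ring.
- by exists 0%N, 1%N, 5%N; ring.
- by exists 1%N, 1%N, 6%N; ring.
- by exists 0%N, 1%N, 7%N; ring.
- by exists 1%N, 1%N, 9%N; ring.
Qed.

End TateNormalForm.

Section TateMorphism.
Variables (R S : comNzRingType) (phi : {rmorphism R -> S}).

Lemma rmorph_tate_b2 d : tate_b2 (phi d) = phi (tate_b2 d).
Proof. by rewrite /tate_b2; ring. Qed.

Lemma rmorph_tate_c4 d : tate_c4 (phi d) = phi (tate_c4 d).
Proof. by rewrite /tate_c4; ring. Qed.

Lemma rmorph_tate_c6 d : tate_c6 (phi d) = phi (tate_c6 d).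
Proof. by rewrite /tate_c6; ring. Qed.

Lemma rmorph_tate_disc d : tate_disc (phi d) = phi (tate_disc d).
Proof. by rewrite /tate_disc; ring. Qed.

Lemma rmorph_tate_x m d : tate_x m (phi d) = phi (tate_x m d).
Proof. by case: m => [|[|[|[|[|[|m]]]]]] //=; ring. Qed.

Lemma rmorph_tate_y m d : tate_y m (phi d) = phi (tate_y m d).
Proof. by case: m => [|[|[|[|[|[|[|m]]]]]]] //=; ring. Qed.

Lemma rmorph_tate_miller j i d x : tate_miller j i (phi d) (phi x) =
  (phi (tate_miller j i d x).1, phi (tate_miller j i d x).2).
Proof.
move: j i => [|[|[|[|j]]]] [|[|[|[|[|[|[|i]]]]]]] //=; congr (_, _); ring.
Qed.

Lemma rmorph_miller_num j i d x : miller_num j i (phi d) (phi x) = phi (miller_num j i d x).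
Proof. by rewrite /miller_num rmorph_tate_miller /tate_lin /=; ring. Qed.

Lemma rmorph_miller_den j i d x : miller_den j i (phi d) (phi x) = phi (miller_den j i d x).
Proof. by rewrite /miller_den rmorph_tate_miller. Qed.

End TateMorphism.

(** Evaluation at (x, -y) is multiplicative. *)
Lemma horner_conj (K : fieldType) (g a b u v : {poly K}) x y : g.[x] = y ^+ 2 ->
  (a * u + g * b * v).[x] - y * (a * v + b * u).[x] =
  (a.[x] - y * b.[x]) * (u.[x] - y * v.[x]).
Proof. by move=> gx; rewrite !(hornerD, hornerM) gx; ring. Qed.

Lemma pcharf_two_three (K : fieldType) k : (2 * k + 3)%N \in [pchar K] -> (0 < k)%N ->
  2%:R != 0 :> K /\ 3%:R != 0 :> K.
Proof. by move=> cK k0; rewrite -!(dvdn_pcharf cK) !gtnNdvd //; lia. Qed.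

(** * Miller functions on the short model *)

Section TateCurve.
Variables (K : fieldType) (k : nat) (d : K).
Local Notation l := (2 * k + 3)%N.
Hypotheses (pcharKl : l \in [pchar K]) (k_gt0 : (0 < k)%N) (d0 : d != 0) (d1 : d != 1).

Definition tate_cubic : {poly K} :=
  'X^3 - (27%:R * tate_c4 d) *: 'X + (54%:R * tate_c6 d)%:P.
Local Notation f := tate_cubic.

Definition short_x m := 36%:R * tate_x m d + 3%:R * tate_b2 d.
Definition short_y m := 108%:R * tate_y m d.

Let two0 : 2%:R != 0 :> K. Proof. by case: (pcharf_two_three pcharKl k_gt0). Qed.
Let three0 : 3%:R != 0 :> K. Proof. by case: (pcharf_two_three pcharKl k_gt0). Qed.

Lemma six_smooth m n : (2 ^ m * 3 ^ n)%:R != 0 :> K.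
Proof. by rewrite natrM !natrX mulf_neq0 ?expf_neq0 ?two0 ?three0. Qed.

Lemma size_tate_cubic : size f = 4%N.
Proof.
rewrite /tate_cubic -addrA size_polyDl ?size_polyXn //.
rewrite (leq_ltn_trans (size_polyD _ _)) // size_polyN gtn_max.
rewrite (leq_ltn_trans (size_scale_leq _ _)) ?size_polyX //.
by rewrite (leq_ltn_trans (size_polyC_leq1 _)).
Qed.

Lemma tate_cubic_monic : f \is monic.
Proof.
apply/monicP; rewrite /lead_coef size_tate_cubic /tate_cubic.
by rewrite !(coefD, coefN, coefZ, coefXn, coefX, coefC) /= mulr0 subr0 addr0.
Qed.

Local Notation xx := (36%:R^-1 *: ('X - (3%:R * tate_b2 d)%:P) : {poly K}).

Let n36 : 36%:R != 0 :> K. Proof. exact: (six_smooth 2 2). Qed.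
Let n108 : 108%:R != 0 :> K. Proof. exact: (six_smooth 2 3). Qed.

Lemma xxE : 36%:R * xx + 3%:R * tate_b2 d%:P = 'X.
Proof.
rewrite (rmorph_tate_b2 polyC) mulr_natl -scaler_nat scalerA divff // scale1r.
by rewrite polyCM polyC_natr subrK.
Qed.

Lemma tate_cubicE : f = 108%:R ^+ 2 * tate_quartic d%:P xx.
Proof.
rewrite -tate_short xxE /tate_cubic (rmorph_tate_c4 polyC) (rmorph_tate_c6 polyC).
by rewrite -mul_polyC; ring.
Qed.

Lemma xx_horner m : xx.[short_x m] = tate_x m d.
Proof. by rewrite hornerZ hornerXsubC /short_x addrK mulKf. Qed.

Lemma xx_sub m : xx - (tate_x m d)%:P = 36%:R^-1 *: ('X - (short_x m)%:P).
Proof.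
apply: (scalerI n36); rewrite scalerBr !scalerA divff // !scale1r -!mul_polyC.
by rewrite -polyCM /short_x polyCD; ring.
Qed.

Lemma tate_cubic_horner m : (0 < m < 7)%N -> f.[short_x m] = short_y m ^+ 2.
Proof.
move=> hm; rewrite exprMn tate_yE // -tate_short /tate_cubic -/(short_x m).
by rewrite !(hornerD, hornerN, hornerZ, hornerXn, hornerX, hornerC).
Qed.

(** The factor 108 compensates for the ordinate of the short model, which is 108 times that of the
    model of [tate_quartic]. *)
Definition num_fun j i : {poly K} := 108%:R *: miller_num j i d%:P xx.
Definition den_fun j i : {poly K} := miller_den j i d%:P xx.

Lemma num_fun_horner j i m :
  (num_fun j i).[short_x m] = 108%:R * miller_num j i d (tate_x m d).
Proof.
rewrite hornerZ; congr (_ * _); rewrite -[LHS]/(horner_eval (short_x m) _).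
by rewrite -rmorph_miller_num /= /horner_eval hornerC xx_horner.
Qed.

Lemma den_fun_horner j i m : (den_fun j i).[short_x m] = miller_den j i d (tate_x m d).
Proof.
rewrite -[LHS]/(horner_eval (short_x m) _).
by rewrite -rmorph_miller_den /= /horner_eval hornerC xx_horner.
Qed.

Lemma fun_norm j i : (0 < j < 4)%N -> (0 < i < 7)%N -> exists2 c, c != 0 &
  num_fun j i ^+ 2 - f * den_fun j i ^+ 2 =
  c *: (('X - (short_x j)%:P) ^+ i * ('X - (short_x ((i * j) %% 7))%:P)).
Proof.
move=> hj hi; pose c : K := 108%:R ^+ 2 * 4%:R * (-1) ^+ i.+1 * 36%:R^-1 ^+ i.+1.
have c0 : c != 0.
  rewrite !mulf_neq0 ?expf_neq0 ?oppr_eq0 ?oner_eq0 ?invr_eq0 //.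
  exact: (six_smooth 2 0).
exists c => //.
transitivity ((108%:R ^+ 2)%:P * (miller_num j i d%:P xx ^+ 2
    - tate_quartic d%:P xx * miller_den j i d%:P xx ^+ 2)).
  by rewrite tate_cubicE /num_fun /den_fun -mul_polyC polyC_exp polyC_natr; ring.
rewrite tate_miller_norm // !(rmorph_tate_x polyC) !xx_sub exprZn -!mul_polyC.
have -> : (-1) ^+ i.+1 = ((-1) ^+ i.+1)%:P :> {poly K} by rewrite polyC_exp polyCN polyC1.
rewrite /c [36%:R^-1 ^+ i.+1]exprS; move: (36%:R^-1) (36%:R^-1 ^+ i) ((-1) ^+ i.+1) => u v w.
by move: (_ ^+ i) => A; ring.
Qed.

Lemma fun_zero j i : (0 < j < 4)%N -> (0 < i < 7)%N ->
  (num_fun j i).[short_x ((i * j) %% 7)] =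
  short_y ((i * j) %% 7) * (den_fun j i).[short_x ((i * j) %% 7)].
Proof.
by move=> hj hi; rewrite num_fun_horner den_fun_horner tate_miller_zero // mulrA.
Qed.

Lemma fun_conj j i : (0 < j < 4)%N -> (1 < i < 7)%N ->
  (num_fun j i).[short_x j] - short_y j * (den_fun j i).[short_x j] != 0.
Proof.
move=> hj hi; rewrite num_fun_horner den_fun_horner -mulrA -mulrBr mulf_neq0 //.
have [s [m [n ->]]] := tate_miller_conj d hj hi.
by rewrite !mulf_neq0 ?expf_neq0 ?two0 ?oppr_eq0 ?oner_eq0 ?subr_eq0.
Qed.

Lemma short_y_neq0 m : (0 < m < 7)%N -> short_y m != 0.
Proof.
move=> hm; rewrite mulf_neq0 //.
by move: m hm => [|[|[|[|[|[|[|m]]]]]]] //= _;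
  rewrite ?oppr_eq0 !mulf_neq0 ?expf_neq0 ?subr_eq0.
Qed.

Lemma short_x_inj m n : (0 < m < 4)%N -> (0 < n < 4)%N -> short_x m = short_x n -> m = n.
Proof.
have d1' : d - 1 != 0 by rewrite subr_eq0.
have h12 : d ^+ 3 - d ^+ 2 != 0.
  by rewrite (_ : _ - _ = d ^+ 2 * (d - 1)) ?mulf_neq0 ?expf_neq0 //; ring.
have h13 : d ^+ 2 - d != 0 by rewrite (_ : _ - _ = d * (d - 1)) ?mulf_neq0 //; ring.
have h23 : (d ^+ 3 - d ^+ 2) - (d ^+ 2 - d) != 0.
  by rewrite (_ : _ - _ = d * (d - 1) ^+ 2) ?mulf_neq0 ?expf_neq0 //; ring.
move=> hm hn /addIr/(mulfI n36); move: m n hm hn => [|[|[|[|m]]]] // [|[|[|[|n]]]] //= _ _ /eqP.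
- by rewrite eq_sym (negPf h12).
- by rewrite eq_sym (negPf h13).
- by rewrite (negPf h12).
- by rewrite -subr_eq0 (negPf h23).
- by rewrite (negPf h13).
- by rewrite eq_sym -subr_eq0 (negPf h23).
Qed.

(** The product of [y ^+ l *: a + f ^+ k.+2 * b] and its conjugate is y^(2l) (a^2 - f b^2) up to a
    multiple of f^l - y^(2l), which ('X - x)^l divides by Frobenius. The conjugate does not vanish
    at x. *)
Lemma miller_dvd (x y : K) (a b : {poly K}) e : (e <= l)%N -> y != 0 ->
  f.[x] = y ^+ 2 -> ('X - x%:P) ^+ e %| a ^+ 2 - f * b ^+ 2 -> a.[x] - y * b.[x] != 0 ->
  ('X - x%:P) ^+ e %| y ^+ l *: a + f ^+ k.+2 * b.
Proof.
move=> el y0 fx dv conj0.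
have l1E : (k.+2 * 2 = l.+1)%N by lia.
have dvl : ('X - x%:P) ^+ e %| f ^+ l - (y ^+ (l * 2))%:P.
  have pcharP : l \in [pchar {poly K}] by rewrite pchar_poly.
  apply: (dvdp_trans (dvdp_exp2l _ el)).
  have -> : f ^+ l - (y ^+ (l * 2))%:P = (f - f.[x]%:P) ^+ l.
    rewrite -(pFrobenius_autE pcharP (f - _)) rmorphB /= !pFrobenius_autE.
    by rewrite fx -polyC_exp -exprM (mulnC 2 l).
  by rewrite dvdp_exp2r // dvdp_XsubCl rootE !hornerE subrr.
have cop : coprimep (('X - x%:P) ^+ e) (y ^+ l *: a - f ^+ k.+2 * b).
  rewrite coprimep_expl // coprimep_sym coprimep_XsubC rootE hornerD hornerN hornerZ hornerM horner_exp.
  by rewrite fx -exprM (mulnC 2 k.+2) l1E exprSr -mulrA -mulrBr mulf_neq0 ?expf_neq0.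
rewrite -(Gauss_dvdpl _ cop).
have -> : (y ^+ l *: a + f ^+ k.+2 * b) * (y ^+ l *: a - f ^+ k.+2 * b) =
   (y ^+ (l * 2))%:P * (a ^+ 2 - f * b ^+ 2) - (f ^+ l - (y ^+ (l * 2))%:P) * (f * b ^+ 2).
  rewrite [LHS]mulrC -subr_sqr exprZn exprMn -!exprM l1E [f ^+ l.+1]exprS -mul_polyC.
  by move: (f ^+ l) (y ^+ (l * 2))%:P => u v; ring.
by apply: dvdp_sub; [apply: dvdp_mull | apply: dvdp_mulr].
Qed.

(** Since -6 = 1 modulo 7, the Miller function for i = 6 has divisor 7(jP) - 7(O); its m-th power is
    taken. *)
Lemma miller_pow j m : (0 < j < 4)%N -> exists a b c, [/\ c != 0,
  a ^+ 2 - f * b ^+ 2 = c *: ('X - (short_x j)%:P) ^+ (7 * m)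
  & a.[short_x j] - short_y j * b.[short_x j] != 0].
Proof.
move=> hj; have hj7 : (0 < j < 7)%N by lia.
elim: m => [|m [a [b [c [c0 e conj0]]]]].
  exists 1, 0, 1; rewrite oner_neq0 !hornerC mulr0 subr0 oner_neq0 muln0 expr0.
  by rewrite expr0n mulr0 subr0 expr1n scale1r.
have h6 : (0 < 6 < 7)%N by []; have [c' c'0 e'] := fun_norm hj h6.
have conj6 := fun_conj hj (isT : (1 < 6 < 7)%N).
have j6 : short_x ((6 * j) %% 7) = short_x j.
  by move: j hj {e conj0 e' conj6 hj7} => [|[|[|[|j]]]].
exists (a * num_fun j 6 + f * b * den_fun j 6), (a * den_fun j 6 + b * num_fun j 6), (c * c').
split; first by rewrite mulf_neq0.
  transitivity ((a ^+ 2 - f * b ^+ 2) * (num_fun j 6 ^+ 2 - f * den_fun j 6 ^+ 2)); first by ring.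
  rewrite e e' j6 -exprSr -scalerAl -scalerAr scalerA -exprD mulnS addnC //.
by rewrite (horner_conj _ _ _ _ (tate_cubic_horner hj7)) mulf_neq0.
Qed.

(** The product of a function of divisor 7m(jP) - 7m(O) by the Miller function for i; its last zero
    is -ijP, which is also -l(jP). *)
Lemma tate_millerP j i m : (0 < j < 4)%N -> (0 < i < 7)%N -> (7 * m + i)%N = l ->
  exists a b, [/\ miller k f (short_x j) (short_y j) (short_x ((i * j) %% 7)) a b,
    a.[short_x ((i * j) %% 7)] = short_y ((i * j) %% 7) * b.[short_x ((i * j) %% 7)]
    & i = 1%N -> root b (short_x j)].
Proof.
move=> hj hi lE; have hj7 : (0 < j < 7)%N by lia.
have hij : (0 < (i * j) %% 7 < 7)%N.
  by move: j i hj hi {hj7 lE} => [|[|[|[|j]]]] // [|[|[|[|[|[|[|i]]]]]]].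
have [a [b [c [c0 e conj0]]]] := miller_pow m hj.
have [c' c'0 e'] := fun_norm hj hi; have z := fun_zero hj hi.
set num := num_fun j i in e' z; set den := den_fun j i in e' z.
exists (a * num + f * b * den), (a * den + b * num).
have ne : (a * num + f * b * den) ^+ 2 - f * (a * den + b * num) ^+ 2 =
  (c * c') *: (('X - (short_x j)%:P) ^+ l * ('X - (short_x ((i * j) %% 7))%:P)).
  transitivity ((a ^+ 2 - f * b ^+ 2) * (num ^+ 2 - f * den ^+ 2)); first by ring.
  by rewrite e e' -scalerAl -scalerAr scalerA mulrA -exprD lE.
have den1 : i = 1%N -> den = 0.
  by move=> i1; rewrite /den /den_fun /miller_den i1; move: j hj {hj7 hij e conj0 e' z num den ne}
     => [|[|[|[|j]]]].
have num1 : i = 1%N -> num.[short_x j] = 0.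
  move=> i1; have := z; rewrite (den1 i1) horner0 mulr0 i1 mul1n modn_small //; lia.
split=> //.
- split; rewrite ?tate_cubic_horner ?short_y_neq0 //.
    by exists (c * c'); rewrite ?mulf_neq0.
  (* For i = 1 the product vanishes at -jP too, so [miller_dvd] applies only to its first factor,
     with exponent l - 1; the vertical line supplies the last factor. *)
  have [i1|i_neq1] := eqVneq i 1%N.
    have dv : ('X - (short_x j)%:P) ^+ l.-1 %|
        short_y j ^+ l *: a + f ^+ k.+2 * b.
      apply: miller_dvd; rewrite ?leq_pred ?tate_cubic_horner ?short_y_neq0 //.
      by rewrite e dvdpZr // dvdp_exp2l // -ltnS prednK -lE i1 // addn1.
    have dvn : 'X - (short_x j)%:P %| num by rewrite dvdp_XsubCl rootE num1.
    have -> : ('X - (short_x j)%:P) ^+ l = ('X - (short_x j)%:P) ^+ l.-1 * ('X - (short_x j)%:P).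
      by rewrite -exprSr prednK // addn3.
    by rewrite den1 // !mulr0 addr0 add0r scalerAl mulrA -mulrDl dvdp_mul.
  apply: miller_dvd; rewrite ?tate_cubic_horner ?short_y_neq0 //.
    by rewrite ne dvdpZr ?mulf_neq0 // dvdp_mulr.
  by rewrite (horner_conj _ _ _ _ (tate_cubic_horner hj7)) mulf_neq0 // fun_conj //; lia.
- apply/eqP; rewrite -subr_eq0 (horner_conj _ _ _ _ (tate_cubic_horner hij)) z subrr.
  by rewrite mulr0.
- by move=> i1; rewrite rootE (den1 i1) mulr0 add0r hornerM (num1 i1) mulr0.
Qed.

End TateCurve.

(** * Frobenius and the multiples of the point of order 7 *)

Section Order7.
Variables (K : closedFieldType) (k : nat) (d : K).
Local Notation l := (2 * k + 3)%N.
Local Notation f := (tate_cubic d).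
Local Notation c := ((f ^+ k.+1)`_(2 * k + 1)).
Hypotheses (pcharKl : l \in [pchar K]) (k_gt0 : (0 < k)%N).
Hypotheses (disc0 : tate_disc d != 0) (hasse0 : (f ^+ k.+1)`_(2 * k + 2) = 0).

Lemma disc_d0 : d != 0.
Proof. by apply: contraNneq disc0 => ->; rewrite /tate_disc expr0n !mul0r. Qed.

Lemma disc_d1 : d != 1.
Proof. by apply: contraNneq disc0 => ->; rewrite /tate_disc subrr expr0n mulr0 mul0r. Qed.

Lemma short_disc : 4%:R * (27%:R * tate_c4 d) ^+ 3 - 27%:R * (54%:R * tate_c6 d) ^+ 2 != 0.
Proof.
have -> : 4%:R * (27%:R * tate_c4 d) ^+ 3 - 27%:R * (54%:R * tate_c6 d) ^+ 2 =
    (2%:R ^+ 8 * 3%:R ^+ 12) * tate_disc d.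
  transitivity (2%:R ^+ 2 * 3%:R ^+ 9 * (tate_c4 d ^+ 3 - tate_c6 d ^+ 2)); first by ring.
  by rewrite tate_discE; ring.
apply: mulf_neq0 disc0; apply: mulf_neq0; apply: expf_neq0.
  by case: (pcharf_two_three pcharKl k_gt0).
by case: (pcharf_two_three pcharKl k_gt0).
Qed.

Lemma tate_cubic_split : exists e1 e2 e3,
  [/\ f = ('X - e1%:P) * ('X - e2%:P) * ('X - e3%:P), e1 != e2, e1 != e3 & e2 != e3].
Proof.
have [r] := closed_field_poly_normal f; rewrite (monicP (tate_cubic_monic d)) scale1r => fr.
have : size r = 3%N.
  by apply: succn_inj; rewrite -(size_prod_XsubC r id) -fr size_tate_cubic.
case: r fr => [|e1 [|e2 [|e3 [|e4 r]]]] //; rewrite !big_cons big_nil mulr1 mulrA => fr _.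
exists e1, e2, e3; have cf i := congr1 (fun p : {poly K} => p`_i) fr.
have fE : ('X - e1%:P) * ('X - e2%:P) * ('X - e3%:P) = 'X^3 - (e1 + e2 + e3) *: 'X^2
   + (e1 * e2 + e1 * e3 + e2 * e3) *: 'X - (e1 * e2 * e3)%:P.
  by rewrite -!mul_polyC; ring.
have cfE i := etrans (cf i) (congr1 (fun p : {poly K} => p`_i) fE).
move: (cfE 0%N) (cfE 1%N) (cfE 2%N).
rewrite !(coefD, coefN, coefZ, coefXn, coefX, coefC) /=.
rewrite !(mulr0, mulr1, subr0, sub0r, addr0, add0r, oppr0).
move=> cf0 cf1 /eqP cf2.
move: short_disc; rewrite cf0.
have -> : 27%:R * tate_c4 d = - (e1 * e2 + e1 * e3 + e2 * e3) by rewrite -cf1 opprK.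
have e3E : e3 = - (e1 + e2).
  by apply/eqP; rewrite -addr_eq0 addrC -oppr_eq0 eq_sym.
have -> : 4%:R * (- (e1 * e2 + e1 * e3 + e2 * e3)) ^+ 3 - 27%:R * (- (e1 * e2 * e3)) ^+ 2 =
   ((e1 - e2) * (e1 - e3) * (e2 - e3)) ^+ 2 by rewrite e3E; ring.
rewrite expf_eq0 !mulf_eq0 !subr_eq0 /= !negb_or -andbA => /and3P[e12 e13 e23].
by split; rewrite ?fr.
Qed.

Local Notation i := (l %% 7)%N.
Local Notation X := (short_x d).
Local Notation Y := (short_y d).
Hypothesis l_mod7 : i != 0%N.

Let i_lt7 : (0 < i < 7)%N. Proof. by rewrite lt0n l_mod7 ltn_mod. Qed.
Let d0 := disc_d0.
Let d1 := disc_d1.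

(** The last zero of the Miller function is -ijP, which explains the minus sign on the ordinates. *)
Lemma order7_frobenius : exists rho c0, rho * c ^+ (2 * k + 2) = 1 /\
  forall j, (0 < j < 4)%N ->
  [/\ X ((i * j) %% 7) = rho ^+ 2 * (X j ^+ l) ^+ l + c0,
     (i == 2) || (i == 4) -> Y ((i * j) %% 7) = - rho ^+ 3 * (Y j ^+ l) ^+ l
   & i = 1%N -> ~ [/\ X j ^+ l = X j, Y j ^+ l = Y j & rho = 1]].
Proof.
have lE : (7 * (l %/ 7) + i)%N = l by rewrite mulnC -divn_eq.
have mil j : (0 < j < 4)%N -> _ := fun hj => tate_millerP pcharKl k_gt0 d0 d1 hj i_lt7 lE.
have ne m n : (0 < m < 4)%N -> (0 < n < 4)%N -> m != n -> X m != X n.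
  by move=> hm hn; apply: contra_neq; apply: short_x_inj pcharKl k_gt0 d0 d1 _ _ hm hn.
have [a1 [b1 [mil1 _ _]]] := mil 1%N isT; have [a2 [b2 [mil2 _ _]]] := mil 2%N isT.
have X12 : X ((i * 1) %% 7) != X ((i * 2) %% 7).
  move: i_lt7; case: (i) => [|[|[|[|[|[|[|?]]]]]]] //= _.
  - exact: (ne 1%N 2%N).
  - exact: (ne 2%N 3%N).
  - exact: (ne 3%N 1%N).
  - exact: (ne 3%N 1%N).
  - exact: (ne 2%N 3%N).
  - exact: (ne 1%N 2%N).
have [e1 [e2 [e3 [fE e12 e13 e23]]]] := tate_cubic_split.
have [rho [c0 [rhoE main]]] := supersingular_frobenius (size_tate_cubic d) pcharKl k_gt0
  hasse0 (tate_cubic_monic d) fE e12 e13 e23 [:: X 1; X 2; X 3] mil1 mil2 X12.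
exists rho, c0; split=> // j hj; have [a [b [milj zj bj]]] := mil j hj.
have Xj : X j \in [:: X 1; X 2; X 3].
  by move: j hj {a b milj zj bj} => [|[|[|[|j]]]] // _; rewrite !inE eqxx ?orbT.
have [xiE sgn spec] := main _ Xj _ _ _ _ milj; split=> //; last first.
  move=> i1 [Xl Yl rho1]; apply: spec; split=> //; first exact: bj.
  by rewrite i1 mul1n modn_small //; move: hj; lia.
move=> i24; have zX : X ((i * j) %% 7) != X j.
  move: hj; case/orP: i24 => /eqP ->; move: (j) => [|[|[|[|?]]]] // _.
  - exact: (ne 2%N 1%N).
  - exact: (ne 3%N 2%N).
  - exact: (ne 1%N 3%N).
  - exact: (ne 3%N 1%N).
  - exact: (ne 1%N 2%N).
  - exact: (ne 2%N 3%N).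
(* The abscissas of ijP and jP differ, so that of ijP is a simple root of the norm and [a], [b]
   cannot both vanish there. *)
have bN : b.[X ((i * j) %% 7)] != 0.
  apply/eqP=> b0; have a0 := zj; rewrite b0 mulr0 in a0.
  case: milj => _ _ [c' c'0 NE] _; set z := X _ in b0 a0 NE.
  have : ('X - z%:P) ^+ 2 %| a ^+ 2 - f * b ^+ 2.
    have [az bz] : 'X - z%:P %| a /\ 'X - z%:P %| b.
      by rewrite !dvdp_XsubCl !rootE a0 b0.
    by apply: dvdp_sub; [exact: dvdp_exp2r | apply: dvdp_mull; exact: dvdp_exp2r].
  rewrite NE dvdpZr // expr2 dvdp_mul2r ?polyXsubC_eq0 // dvdp_XsubCl.
  rewrite rootE horner_exp expf_eq0 hornerXsubC subr_eq0 => /andP[_]; exact/negP.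
by apply: (mulIf bN); rewrite -zj sgn.
Qed.

Lemma short_x_frob (d' : K) m : short_x d' m ^+ l = short_x (d' ^+ l) m.
Proof.
rewrite -!(pFrobenius_autE pcharKl) /short_x rmorph_tate_x rmorph_tate_b2.
by rewrite rmorphD !rmorphM !rmorph_nat.
Qed.

Lemma short_y_frob (d' : K) m : short_y d' m ^+ l = short_y (d' ^+ l) m.
Proof.
by rewrite -!(pFrobenius_autE pcharKl) /short_y rmorph_tate_y rmorphM rmorph_nat.
Qed.

Lemma cubic_coef_frob (d' : K) m n : ((tate_cubic d' ^+ m)`_n) ^+ l =
  (tate_cubic (d' ^+ l) ^+ m)`_n.
Proof.
rewrite -!(pFrobenius_autE pcharKl) -coef_map rmorphXn /=.
suff -> : map_poly (pFrobenius_aut pcharKl) (tate_cubic d') =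
  tate_cubic (pFrobenius_aut pcharKl d') by [].
rewrite /tate_cubic rmorphD rmorphB /= map_polyXn map_polyZ map_polyX map_polyC /=.
by rewrite rmorph_tate_c4 rmorph_tate_c6 -!mul_polyC; ring.
Qed.

Lemma order7_ratio : [/\ (i == 1) || (i == 6) -> (d ^+ l) ^+ l = d,
  (i == 2) || (i == 5) -> d * (d ^+ l) ^+ l = d - 1
  & (i == 3) || (i == 4) -> (1 - d) * (d ^+ l) ^+ l = 1].
Proof.
have [rho [c0 [rhoE main]]] := order7_frobenius.
have [x1 _ _] := main 1%N isT; have [x2 _ _] := main 2%N isT.
have [x3 _ _] := main 3%N isT; move: x1 x2 x3; rewrite !short_x_frob.
set D := (d ^+ l) ^+ l => x1 x2 x3.
have n36 : 36%:R != 0 :> K by apply: (six_smooth pcharKl k_gt0 2 2).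
have dd : d * (d - 1) != 0 by rewrite mulf_neq0 // subr_eq0.
(* The relation x_2 - x_1 = d (x_3 - x_1), raised to the power l^2; differences remove [c0], and
   rho^2 factors out. *)
have e : X ((i * 2) %% 7) - X ((i * 1) %% 7) = D * (X ((i * 3) %% 7) - X ((i * 1) %% 7)).
  by rewrite x1 x2 x3 /short_x /=; ring.
have {x1 x2 x3 main} e : tate_x ((i * 2) %% 7) d - tate_x ((i * 1) %% 7) d =
    D * (tate_x ((i * 3) %% 7) d - tate_x ((i * 1) %% 7) d).
  apply: (mulfI n36); transitivity (X ((i * 2) %% 7) - X ((i * 1) %% 7)).
    by rewrite /short_x; ring.
  by rewrite e /short_x; ring.
split=> /orP[]/eqP i_eq.
- have {}e : tate_x 2 d - tate_x 1 d - D * (tate_x 3 d - tate_x 1 d) = 0.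
    by apply/eqP; rewrite subr_eq0; apply/eqP; move: e; rewrite i_eq.
  apply: (mulfI dd); apply: subr0_eq; apply: oppr_inj; rewrite oppr0; rewrite -[RHS]e /tate_x; ring.
- have {}e : tate_x 5 d - tate_x 6 d - D * (tate_x 4 d - tate_x 6 d) = 0.
    by apply/eqP; rewrite subr_eq0; apply/eqP; move: e; rewrite i_eq.
  apply: (mulfI dd); apply: subr0_eq; apply: oppr_inj; rewrite oppr0; rewrite -[RHS]e /tate_x; ring.
- have {}e : tate_x 4 d - tate_x 2 d - D * (tate_x 6 d - tate_x 2 d) = 0.
    by apply/eqP; rewrite subr_eq0; apply/eqP; move: e; rewrite i_eq.
  apply: (mulfI dd); apply: subr0_eq; rewrite -[RHS]e /tate_x; ring.
- have {}e : tate_x 3 d - tate_x 5 d - D * (tate_x 1 d - tate_x 5 d) = 0.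
    by apply/eqP; rewrite subr_eq0; apply/eqP; move: e; rewrite i_eq.
  apply: (mulfI dd); apply: subr0_eq; rewrite -[RHS]e /tate_x; ring.
- have {}e : tate_x 6 d - tate_x 3 d - D * (tate_x 2 d - tate_x 3 d) = 0.
    by apply/eqP; rewrite subr_eq0; apply/eqP; move: e; rewrite i_eq.
  apply: (mulfI dd); apply: subr0_eq; rewrite -[RHS]e /tate_x; ring.
- have {}e : tate_x 1 d - tate_x 4 d - D * (tate_x 5 d - tate_x 4 d) = 0.
    by apply/eqP; rewrite subr_eq0; apply/eqP; move: e; rewrite i_eq.
  apply: (mulfI dd); apply: subr0_eq; rewrite -[RHS]e /tate_x; ring.
Qed.

Lemma rho_frob (rho : K) : rho * c ^+ (2 * k + 2) = 1 -> rho * c ^+ l = c /\ c != 0.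
Proof.
move=> rhoE; split; last first.
  by apply: contra_eq_neq rhoE => ->; rewrite addn2 expr0n mulr0 eq_sym oner_eq0.
transitivity (rho * c ^+ (2 * k + 2) * c); last by rewrite rhoE mul1r.
by rewrite -mulrA -exprSr -addnS.
Qed.

(** If d lies in F_l, so does c, hence rho = 1 and multiplication by i translates the three
    abscissas by [c0]. For i = 2, 3, 4, 5 it permutes them in a 3-cycle: [c0] is nonzero, yet
    summing gives 3 * c0 = 0. The case i = 1 is the last assertion of [order7_frobenius]. *)
Lemma order7_degree1 : i != 6%N -> d ^+ l != d.
Proof.
move=> i6; apply/eqP => dl; have [rho [c0 [rhoE main]]] := order7_frobenius.
have cl : c ^+ l = c by rewrite cubic_coef_frob dl.
have [rhoc c_neq0] := rho_frob rhoE.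
have rho1 : rho = 1 by apply: (mulIf c_neq0); rewrite mul1r -{1}cl.
have Xl j : X j ^+ l = X j by rewrite short_x_frob dl.
have Yl j : Y j ^+ l = Y j by rewrite short_y_frob dl.
have x j (hj : (0 < j < 4)%N) : X ((i * j) %% 7) = X j + c0.
  by have [-> _ _] := main j hj; rewrite !Xl rho1 expr1n mul1r.
have [i1|i_neq1] := eqVneq i 1%N; first by have [_ _ /(_ i1)[]] := main 1%N isT.
have ne m n : (0 < m < 4)%N -> (0 < n < 4)%N -> m != n -> X m != X n.
  by move=> hm hn; apply: contra_neq; apply: short_x_inj pcharKl k_gt0 d0 d1 _ _ hm hn.
have c0_neq0 : c0 != 0.
  apply: (contraTneq _ (ne 1%N 2%N isT isT isT)) => c00.
  have xx j (hj : (0 < j < 4)%N) : X ((i * j) %% 7) = X j by rewrite x // c00 addr0.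
  have := xx 1%N isT; have := xx 2%N isT; move: i_lt7 i_neq1 i6.
  case: (i) => [|[|[|[|[|[|[|?]]]]]]] // _ _ _ => [_ e|e _|_ e|e _].
  - by case/eqP: (ne 2%N 1%N isT isT isT).
  - by case/eqP: (ne 1%N 2%N isT isT isT).
  - by case/eqP: (ne 3%N 1%N isT isT isT).
  - by case/eqP: (ne 3%N 2%N isT isT isT).
have sum0 : 3%:R * c0 = 0.
  have e : X ((i * 1) %% 7) + X ((i * 2) %% 7) + X ((i * 3) %% 7) = X 1 + X 2 + X 3.
    move: i_lt7 i_neq1 i6; case: (i) => [|[|[|[|[|[|[|?]]]]]]] // _ _ _.
    - by transitivity (X 2 + X 3 + X 1); last ring.
    - by transitivity (X 3 + X 1 + X 2); last ring.
    - by transitivity (X 3 + X 1 + X 2); last ring.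
    - by transitivity (X 2 + X 3 + X 1); last ring.
  apply: (@addrI _ (X 1 + X 2 + X 3)); rewrite addr0 -[RHS]e !x //; ring.
move/eqP: sum0; rewrite mulf_eq0 (negPf c0_neq0) orbF.
by case: (pcharf_two_three pcharKl k_gt0) => _ /negPf ->.
Qed.

(** For i = 1, d^(l^2) = d and d^(l^3) = d would give d^l = d. For i = 2, 4 one has i^3 = 1 modulo
    7: three applications of the ordinate formula give y_1 = -n^3 * y_1, where n = rho * phi(rho) *
    phi(phi(rho)). From rho * c^l = c and c^(l^3) = c follows n = 1, so y_1 = 0, a contradiction. *)
Lemma order7_degree3 : (i == 1) || ((i == 2) || (i == 4)) -> ((d ^+ l) ^+ l) ^+ l != d.
Proof.
case/orP=> [/eqP i1|i24]; apply/eqP=> dl3.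
  have [/(_ _)dl2 _ _] := order7_ratio; rewrite i1 eqxx in dl2.
  have := order7_degree1; rewrite i1 => /(_ isT)/eqP; apply.
  by rewrite -{1}(dl2 isT).
have [rho [c0 [rhoE main]]] := order7_frobenius.
pose phi x : K := (x ^+ l) ^+ l.
have [rhoc c_neq0] := rho_frob rhoE.
have cE : ((c ^+ l) ^+ l) ^+ l = c by rewrite !cubic_coef_frob dl3.
have phiM x y : phi (x * y) = phi x * phi y by rewrite /phi !exprMn.
have rhoN : rho * phi rho * phi (phi rho) = 1.
  have e2 : phi rho * c = (c ^+ l) ^+ l.
    by have := congr1 phi rhoc; rewrite phiM [phi (c ^+ l)]cE.
  have e3 : phi (phi rho) * (c ^+ l) ^+ l = c ^+ l.
    by have := congr1 phi e2; rewrite phiM [phi ((c ^+ l) ^+ l)]/phi cE.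
  have cl_neq0 : c ^+ l != 0 by rewrite expf_neq0.
  have cll_neq0 : (c ^+ l) ^+ l != 0 by rewrite expf_neq0.
  apply: (mulIf (mulf_neq0 (mulf_neq0 c_neq0 cl_neq0) cll_neq0)).
  transitivity ((rho * c ^+ l) * (phi rho * c) * (phi (phi rho) * (c ^+ l) ^+ l)).
    by move: (c ^+ l) ((c ^+ l) ^+ l) => u v; ring.
  by rewrite rhoc e2 e3; move: (c ^+ l) ((c ^+ l) ^+ l) => u v; ring.
have phiN x : phi (- x) = - phi x.
  by rewrite /phi -!(pFrobenius_autE pcharKl) !rmorphN.
have phiX x n : phi (x ^+ n) = phi x ^+ n by rewrite /phi ![_ ^+ n ^+ l]exprAC.
have phi3Y j : phi (phi (phi (Y j))) = Y j.
  by rewrite /phi !short_y_frob !dl3.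
have y j (hj : (0 < j < 4)%N) : Y ((i * j) %% 7) = - rho ^+ 3 * phi (Y j).
  by have [_ -> //] := main j hj.
have y1 := y 1%N isT; have y2 := y 2%N isT; have y3 := y 3%N isT.
have Y4 : Y 4 = - Y 3 by rewrite /short_y /=; ring.
have Y5 : Y 5 = - Y 2 by rewrite /short_y /=; ring.
have Y6 : Y 6 = - Y 1 by rewrite /short_y /=; ring.
clearbody phi.
have : Y 1 = - Y 1.
  case/orP: i24 => /eqP i_eq.
    have {}y1 : Y 2 = - rho ^+ 3 * phi (Y 1) by rewrite -y1 i_eq.
    have {}y2 : Y 3 = rho ^+ 3 * phi (Y 2).
      by apply: oppr_inj; rewrite -Y4 -mulNr -y2 i_eq.
    have {}y3 : Y 1 = rho ^+ 3 * phi (Y 3).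
      by apply: oppr_inj; rewrite -Y6 -mulNr -y3 i_eq.
    move: y1 y2 y3 (phi3Y 1%N); move: (Y 1) (Y 2) (Y 3) => u v w y1 y2 y3 phi3u.
    rewrite {1}y3 y2 y1 !(phiM, phiN, phiX) phi3u.
    transitivity (- ((rho * phi rho * phi (phi rho)) ^+ 3 * u)); first by ring.
    by rewrite rhoN expr1n mul1r.
  have {}y1 : Y 3 = rho ^+ 3 * phi (Y 1).
    by apply: oppr_inj; rewrite -Y4 -mulNr -y1 i_eq.
  have {}y3 : Y 2 = rho ^+ 3 * phi (Y 3).
    by apply: oppr_inj; rewrite -Y5 -mulNr -y3 i_eq.
  have {}y2 : Y 1 = - rho ^+ 3 * phi (Y 2) by rewrite -y2 i_eq.
  move: y1 y2 y3 (phi3Y 1%N); move: (Y 1) (Y 2) (Y 3) => u v w y1 y2 y3 phi3u.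
  rewrite {1}y2 y3 y1 !(phiM, phiN, phiX) phi3u.
  transitivity (- ((rho * phi rho * phi (phi rho)) ^+ 3 * u)); first by ring.
  by rewrite rhoN expr1n mul1r.
move/eqP; rewrite -addr_eq0 -mulr2n -mulr_natr mulf_eq0.
have [/negPf-> _] := pcharf_two_three pcharKl k_gt0.
by rewrite (negPf (short_y_neq0 pcharKl k_gt0 d0 d1 (isT : (0 < 1 < 7)%N))).
Qed.

End Order7.

(** * The Hasse invariant and the Legendre polynomial *)

Lemma coef_1DX (R : comNzRingType) n i : ((1 + 'X : {poly R}) ^+ n)`_i = 'C(n, i)%:R.
Proof.
rewrite addrC exprDn coef_sum; under eq_bigr do rewrite expr1n mulr1 coefMn coefXn.
have [lt_in|le_ni] := ltnP i n.+1.
  rewrite (bigD1 (Ordinal (rev_ord_proof (Ordinal lt_in)))) //= big1 => [|j /eqP ne_j].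
    by rewrite addr0 subSS subKn // eqxx bin_sub.
  rewrite mulrb ifN ?mul0rn //; apply/eqP=> e; apply: ne_j; apply: val_inj => /=.
  by have := ltn_ord j; rewrite e; lia.
rewrite big1 => [|j _]; first by rewrite bin_small.
rewrite mulrb ifN ?mul0rn //; apply/eqP=> e; lia.
Qed.

Lemma coef_1DXn2 (R : comNzRingType) n i :
  ((1 + 'X^2 : {poly R}) ^+ n)`_i = if odd i then 0 else 'C(n, i./2)%:R.
Proof.
have -> : (1 + 'X^2 : {poly R}) ^+ n = (1 + 'X) ^+ n \Po 'X^2.
  by rewrite rmorphXn rmorphD rmorph1 /= comp_polyX.
by rewrite coef_comp_poly_Xn // dvdn2 coef_1DX divn2; case: (odd i).
Qed.

Lemma sum_even_odd (g : nat -> nat) n :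
  (\sum_(t < 2 * n) g t = \sum_(k < n) (g (2 * k) + g (2 * k).+1))%N.
Proof.
elim: n => [|n IHn]; first by rewrite !big_ord0.
by rewrite mulnS addnC !addnS addn0 !big_ord_recr /= IHn addnA.
Qed.

(* Coefficient of [X^p] in [(1 + X)^(2m) = ((1 + X^2) + 2X)^m]. *)
Lemma bin_double_even (m e s : nat) : (s <= 1)%N ->
  'C(2 * m, 2 * e + s) =
  (\sum_(k < e.+1) 'C(m, 2 * k + s) * 2 ^ (2 * k + s) * 'C(m - (2 * k + s), e - k))%N.
Proof.
move=> s1; pose p := (2 * e + s)%N.
pose g t := ('C(m, t) * 2 ^ t * (if (t <= p)%N && ~~ odd (p - t) then 'C(m - t, (p - t)./2) else 0))%N.
have gE : 'C(2 * m, p) = (\sum_(t < m.+1) g t)%N.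
  apply/eqP; rewrite -(Num.Theory.eqr_nat int) natr_sum -coef_1DX exprM; apply/eqP.
  have -> : (1 + 'X) ^+ 2 = (1 + 'X^2) + 2%:R * 'X :> {poly int} by ring.
  rewrite exprDn coef_sum; apply: eq_bigr => t _.
  rewrite exprMn mulrCA -natrX mulr_natl -mulrnA coefMn coefMXn /g.
  have [le_tp|lt_pt] := leqP t p; last by rewrite mul0rn muln0.
  rewrite coef_1DXn2 mulnC; case: (odd _); first by rewrite mul0rn /= muln0.
  by rewrite /= -mulrnA mulnC.
have {}gE : 'C(2 * m, p) = (\sum_(t < 2 * e.+1) g t)%N.
  rewrite gE (big_ord_widen (m.+1 + 2 * e.+1) g) ?leq_addr //.
  rewrite [RHS](big_ord_widen (m.+1 + 2 * e.+1) g) ?leq_addl //.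
  rewrite big_mkcond [RHS]big_mkcond; apply: eq_bigr => t _.
  have [lt_tm|lt_mt] := ltnP t m.+1; have [lt_te|le_et] := ltnP t (2 * e.+1) => //.
    rewrite /g (_ : (t <= p)%N = false) ?muln0 //; apply/negbTE; rewrite -ltnNge /p; lia.
  by rewrite /g bin_small.
rewrite gE sum_even_odd; apply: eq_bigr => k _.
have lek : (k <= e)%N by rewrite -ltnS.
case: s s1 @p @g {gE} => [|[|//]] _ p g; rewrite /g /p ?addn0 ?addn1.
  have -> : (2 * k <= 2 * e)%N by rewrite leq_mul2l.
  rewrite -mulnBr oddM /= [(2 * (e - k))%N]mul2n doubleK.
  have [lt_ke|_] := ltnP (2 * k) (2 * e); last by rewrite muln0 addn0.
  by rewrite oddB // !oddM /= oddM /= muln0 addn0.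
rewrite ltnS leq_mul2l lek subSS -mulnBr oddM /= [(2 * (e - k))%N]mul2n doubleK.
rewrite subSn ?leq_mul2l ?lek ?orbT // -mulnBr oddS oddM /= andbF muln0 add0n //.
Qed.

(* Coefficient of [u ^+ (N - e) * v ^+ e] in the homogenized sum defining [J_l], where [u] and [v]
   are proportional to [c4 ^+ 3] and [c6 ^+ 2]. *)
Definition legendre_coef N s e := ('C(2 * N + s, N - e) * 'C(2 * (N + e + s), 2 * N + s))%N.

(** After multiplication by (N+e+s)! (N-e)!, each term becomes (2N+s)! times a term of
    [bin_double_even] for m = N + e + s. *)
Lemma legendre_sum N s e : (s <= 1)%N -> (e <= N)%N ->
  (2 ^ s * \sum_(k < e.+1) 'C(2 * N + s, 2 * k + s) * 'C(2 * N - 2 * k, N - k) * 4 ^ k *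
     'C(N - k, e - k) = legendre_coef N s e)%N.
Proof.
move=> s1 eN; have D0 : (0 < (N + e + s)`! * (N - e)`!)%N by rewrite muln_gt0 !fact_gt0.
apply/eqP; rewrite -(eqn_pmul2r D0); apply/eqP.
have -> : (legendre_coef N s e * ((N + e + s)`! * (N - e)`!) =
    (2 * N + s)`! * 'C(2 * (N + e + s), 2 * e + s))%N.
  have f1 := bin_fact (_ : N - e <= 2 * N + s)%N.
  have {f1} f1 := f1 ltac:(lia).
  rewrite -f1 /legendre_coef (_ : 2 * N + s - (N - e) = N + e + s)%N; last by lia.
  rewrite -(bin_sub (_ : 2 * N + s <= _)%N); last by lia.
  rewrite (_ : 2 * (N + e + s) - (2 * N + s) = 2 * e + s)%N; last by lia.
  by ring.
rewrite bin_double_even // big_distrr big_distrr /= big_distrl /=.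
apply: eq_bigr => [[k /=]]; rewrite ltnS => ke _.
have f1 := bin_fact (leq_add (leq_mul (leqnn 2) (leq_trans ke eN)) (leqnn s)).
have f2 := bin_fact (_ : N - k <= 2 * N - 2 * k)%N; have {}f2 := f2 ltac:(lia).
have f3 := bin_fact (leq_sub2r k eN).
have f4 := bin_fact (_ : 2 * k + s <= N + e + s)%N; have {}f4 := f4 ltac:(lia).
have f5 := bin_fact (_ : e - k <= N + e + s - (2 * k + s))%N; have {}f5 := f5 ltac:(lia).
rewrite (_ : 2 * N - 2 * k - (N - k) = N - k)%N in f2; last by lia.
rewrite (_ : 2 * N + s - (2 * k + s) = 2 * N - 2 * k)%N in f1; last by lia.
rewrite (_ : N - k - (e - k) = N - e)%N in f3; last by lia.
rewrite (_ : N + e + s - (2 * k + s) - (e - k) = N - k)%N in f5; last by lia.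
have p2 : (2 ^ (2 * k + s) = 4 ^ k * 2 ^ s)%N by rewrite expnD expnM.
rewrite p2 -f1 -f4 -f5 -f2.
transitivity (2 ^ s * 4 ^ k * 'C(2 * N + s, 2 * k + s) * 'C(2 * N - 2 * k, N - k) *
  'C(N + e + s, 2 * k + s) * 'C(N + e + s - (2 * k + s), e - k) * (2 * k + s)`! *
  (N - k)`! * ('C(N - k, e - k) * ((e - k)`! * (N - e)`!)))%N; first by ring.
by rewrite f3; ring.
Qed.

Lemma binomial_shift (R : comNzRingType) (u v : R) N k : (k <= N)%N ->
  v ^+ k * (u + v) ^+ (N - k) =
  \sum_(e < N.+1 | (k <= e)%N) 'C(N - k, e - k)%:R * (u ^+ (N - e) * v ^+ e).
Proof.
move=> kN; rewrite -(big_geq_mkord _ _ xpredT (fun e => 'C(N - k, e - k)%:R * (u ^+ (N - e) * v ^+ e))) (big_addn 0 N.+1 k).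
rewrite subSn // big_mkord exprDn mulr_sumr; apply: eq_bigr => t _.
rewrite addnK -mulr_natl [LHS]mulrCA; congr (_ * _).
by rewrite mulrCA -exprD addnC subnDA subnAC.
Qed.

(** The sum defining J_l is a form in v and u + v. Expanded in u and v, it has closed-form
    coefficients, which can be compared with those of the Hasse invariant. *)
Lemma legendre_expand (R : comNzRingType) (u v : R) N s : (s <= 1)%N ->
  2%:R ^+ s * \sum_(k < N.+1) ('C(2 * N + s, 2 * k + s) * 'C(2 * N - 2 * k, N - k))%:R *
     ((4%:R * v) ^+ k * (u + v) ^+ (N - k)) =
  \sum_(e < N.+1) (legendre_coef N s e)%:R * (u ^+ (N - e) * v ^+ e).
Proof.
move=> s1; rewrite mulr_sumr.
pose a k e : R := 2%:R ^+ s * ('C(2 * N + s, 2 * k + s) * 'C(2 * N - 2 * k, N - k))%:R *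
  4%:R ^+ k * 'C(N - k, e - k)%:R * (u ^+ (N - e) * v ^+ e).
transitivity (\sum_(k < N.+1) \sum_(e < N.+1 | (k <= e)%N) a k e).
  apply: eq_bigr => k _; have kN : (k <= N)%N by rewrite -ltnS.
  transitivity (2%:R ^+ s * ('C(2 * N + s, 2 * k + s) * 'C(2 * N - 2 * k, N - k))%:R *
    4%:R ^+ k * (v ^+ k * (u + v) ^+ (N - k))); first by rewrite [(4%:R * v) ^+ k]exprMn !mulrA.
  by rewrite binomial_shift // mulr_sumr; apply: eq_bigr => e _; rewrite mulrA.
transitivity (\sum_(e < N.+1) \sum_(k < N.+1 | (k <= e)%N) a k e).
  by rewrite (exchange_big_dep xpredT).
apply: eq_bigr => e _; have eN : (e <= N)%N by rewrite -ltnS.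
rewrite -legendre_sum // natrM natrX natr_sum mulr_sumr mulr_suml.
transitivity (\sum_(k < e.+1) a k e); first by rewrite (big_ord_widen N.+1 (fun k => a k e)).
apply: eq_bigr => k _; rewrite /a.
move: ('C(_, _) * 'C(_, _))%N ('C(N - k, e - k)) => b1 b2.
by rewrite [in RHS]natrM [in RHS](natrM _ b1) natrX !mulrA.
Qed.

Lemma coef_affine_exp (R : comNzRingType) (A B : R) t j :
  ((A *: 'X + B%:P) ^+ t)`_j = 'C(t, j)%:R * (A ^+ j * B ^+ (t - j)).
Proof.
rewrite addrC exprDn coef_sum.
have coefE (i : nat) : (B%:P ^+ (t - i) * (A *: 'X) ^+ i *+ 'C(t, i))`_j =
    (B ^+ (t - i) * A ^+ i *+ 'C(t, i)) *+ (j == i).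
  by rewrite coefMn -polyC_exp exprZn coefCM coefZ coefXn mulr_natr mulrnAr mulrnAC.
under eq_bigr do rewrite coefE.
have [lt_jt|le_tj] := ltnP j t.+1; last first.
  rewrite bin_small // mul0r big1 // => i _; rewrite (_ : (j == i) = false) //.
  by apply/negbTE; rewrite neq_ltn orbC (leq_trans (ltn_ord i)).
rewrite (bigD1 (Ordinal lt_jt)) //= eqxx big1 ?addr0 => [|i /eqP ne_i].
  by rewrite mulr1n -mulr_natl mulrC [A ^+ j * _]mulrC mulrC.
by rewrite (_ : (j == i) = false) //; apply/eqP=> e; apply/ne_i/val_inj.
Qed.

(** A trinomial coefficient: it chooses 3N+r+2s+e factors X^3, r+3(N-e) factors A X and s+2e factors
    B. *)
Definition hasse_coef N r s e :=
  ('C(6 * N + 2 * r + 3 * s, 3 * N + r + 2 * s + e) *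
   'C(3 * N + r + s - e, r + 3 * (N - e)))%N.

Lemma coef_cubic_exp (R : comNzRingType) (A B : R) N r s : (r <= 1)%N -> (s <= 1)%N ->
  (('X^3 + A *: 'X + B%:P) ^+ (6 * N + 2 * r + 3 * s))`_(2 * (6 * N + 2 * r + 3 * s)) =
  \sum_(e < N.+1) (hasse_coef N r s e)%:R * (A ^+ (r + 3 * (N - e)) * B ^+ (s + 2 * e)).
Proof.
move=> r1 s1; set n := (6 * N + 2 * r + 3 * s)%N; set i0 := (3 * N + r + 2 * s)%N.
pose G i : R := if (2 * n < 3 * i)%N then 0 else
  'C(n, i)%:R * ('C(n - i, 2 * n - 3 * i)%:R * (A ^+ (2 * n - 3 * i) * B ^+ (n - i - (2 * n - 3 * i)))).
have -> : (('X^3 + A *: 'X + B%:P) ^+ n)`_(2 * n) = \sum_(0 <= i < n.+1) G i.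
  rewrite -addrA addrC exprDn coef_sum big_mkord; apply: eq_bigr => i _.
  rewrite coefMn -exprM coefMXn /G; case: ifP => _; first by rewrite mul0rn.
  by rewrite coef_affine_exp -[LHS]mulr_natl.
(* Only i0 <= i <= i0 + N contributes: below, fewer than 2n - 3i factors remain for A X; above,
   X^(3i) already exceeds degree 2n. *)
rewrite (big_cat_nat (n := i0)) //=; last by rewrite /i0 /n; lia.
rewrite (big_cat_nat (n := i0 + N.+1) (m := i0)) //=; [|lia|by rewrite /i0 /n; lia].
rewrite big1_seq ?add0r; last first.
  move=> i; rewrite mem_index_iota => /= lt_i; rewrite /G; case: ifP => // _.
  by rewrite (@bin_small (n - i)) ?mul0r ?mulr0 //; move: lt_i; rewrite /i0 /n; lia.
rewrite [X in _ + X]big1_seq ?addr0; last first.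
  move=> i; rewrite mem_index_iota => /= lt_i; rewrite /G ifT //.
  by move: lt_i; rewrite /i0 /n; lia.
rewrite (big_addn 0 _ i0) addKn big_mkord; apply: eq_bigr => e _.
have eN : (e <= N)%N by rewrite -ltnS.
rewrite /G ifF; last by apply/negbTE; rewrite -leqNgt /i0 /n; lia.
rewrite mulrA -natrM; congr (_%:R * (_ ^+ _ * _ ^+ _)); rewrite /hasse_coef ?/i0 ?/n; try lia.
congr ('C(_, _) * 'C(_, _))%N; lia.
Qed.

Lemma hasse_coef_fact N r s e : (e <= N)%N ->
  (hasse_coef N r s e * ((3 * N + r + 2 * s + e)`! * (r + 3 * (N - e))`! * (s + 2 * e)`!) =
   (6 * N + 2 * r + 3 * s)`!)%N.
Proof.
move=> eN; rewrite /hasse_coef.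
have f1 := bin_fact (_ : 3 * N + r + 2 * s + e <= 6 * N + 2 * r + 3 * s)%N.
have {}f1 := f1 ltac:(lia).
have f2 := bin_fact (_ : r + 3 * (N - e) <= 3 * N + r + s - e)%N; have {}f2 := f2 ltac:(lia).
rewrite (_ : _ - _ = 3 * N + r + s - e)%N in f1; last by lia.
rewrite (_ : 3 * N + r + s - e - (r + 3 * (N - e)) = s + 2 * e)%N in f2; last by lia.
by rewrite -f1 -f2; ring.
Qed.

Lemma legendre_coef_fact N s e : (e <= N)%N ->
  (legendre_coef N s e * ((N - e)`! * (N + e + s)`! * (2 * e + s)`!) = (2 * (N + e + s))`!)%N.
Proof.
move=> eN; rewrite /legendre_coef.
have f1 := bin_fact (_ : 2 * N + s <= 2 * (N + e + s))%N; have {}f1 := f1 ltac:(lia).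
have f2 := bin_fact (_ : N - e <= 2 * N + s)%N; have {}f2 := f2 ltac:(lia).
rewrite (_ : 2 * (N + e + s) - _ = 2 * e + s)%N in f1; last by lia.
rewrite (_ : 2 * N + s - _ = N + e + s)%N in f2; last by lia.
by rewrite -f1 -f2; ring.
Qed.

Lemma hasse_coef_rec r s e w : let N := (e + w).+1 in
  (hasse_coef N r s e.+1 * ((3 * N + r + 2 * s + e).+1 * ((s + 2 * e).+1 * (s + 2 * e).+2)) =
   hasse_coef N r s e * ((r + 3 * w).+3 * (r + 3 * w).+2 * (r + 3 * w).+1))%N.
Proof.
move=> N; have eN : (e < N)%N by rewrite ltnS leq_addr.
have := hasse_coef_fact r s eN; rewrite -(hasse_coef_fact r s (ltnW eN)).
rewrite (_ : N - e.+1 = w)%N; last by lia.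
rewrite (_ : r + 3 * (N - e) = (r + 3 * w).+3)%N; last by lia.
rewrite (_ : s + 2 * e.+1 = (s + 2 * e).+2)%N; last by lia.
rewrite (_ : 3 * N + r + 2 * s + e.+1 = (3 * N + r + 2 * s + e).+1)%N; last by lia.
move: (3 * N + r + 2 * s + e)%N => i; rewrite !factS.
set a := (i`!)%N; set b := ((r + 3 * w)`!)%N; set g := ((s + 2 * e)`!)%N => e1.
have D0 : (0 < a * b * g)%N by rewrite !muln_gt0 !fact_gt0.
apply/eqP; rewrite -(eqn_pmul2r D0); apply/eqP.
move: e1; move: (hasse_coef _ _ _ _) (hasse_coef _ _ _ _) => h1 h2 e1.
transitivity (h2 * (i.+1 * a * b *
   ((s + 2 * e).+2 * ((s + 2 * e).+1 * g))))%N; first by ring.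
by rewrite e1; ring.
Qed.

Lemma legendre_coef_rec s e w : let N := (e + w).+1 in
  (legendre_coef N s e.+1 * ((s + 2 * e).+1 * (s + 2 * e).+2) =
   legendre_coef N s e * (2 * (2 * (N + e + s)).+1 * w.+1))%N.
Proof.
move=> N; have eN : (e < N)%N by rewrite ltnS leq_addr.
have e2 := legendre_coef_fact s (ltnW eN).
have := legendre_coef_fact s eN.
rewrite (_ : 2 * (N + e.+1 + s) = (2 * (N + e + s)).+2)%N; last by lia.
rewrite [((2 * _).+2)`!]factS [((2 * _).+1)`!]factS -e2.
rewrite (_ : N - e.+1 = w)%N; last by lia.
rewrite (_ : N - e = w.+1)%N; last by lia.
rewrite (_ : N + e.+1 + s = (N + e + s).+1)%N; last by lia.
rewrite (_ : 2 * e.+1 + s = (s + 2 * e).+2)%N; last by lia.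
rewrite (_ : 2 * e + s = s + 2 * e)%N; last by lia.
move: (N + e + s)%N => M; rewrite !factS.
set a := (M`!)%N; set b := (w`!)%N; set g := ((s + 2 * e)`!)%N => e1.
have D0 : (0 < M.+1 * a * b * g)%N by rewrite !muln_gt0 !fact_gt0.
apply/eqP; rewrite -(eqn_pmul2r D0); apply/eqP.
move: e1; move: (legendre_coef _ _ _) (legendre_coef _ _ _) => h1 h2 e1.
transitivity (h2 * (b * (M.+1 * a) * ((s + 2 * e).+2 * ((s + 2 * e).+1 * g))))%N; first by ring.
by rewrite e1; ring.
Qed.

Lemma pcharf_fact_neq0 (K : fieldType) l n : l \in [pchar K] -> (n < l)%N -> n`!%:R != 0 :> K.
Proof.
move=> chl; elim: n => [|n IHn] lt_nl; first exact: oner_neq0.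
by rewrite factS natrM mulf_neq0 ?(IHn (ltnW lt_nl)) // -(dvdn_pcharf chl) gtnNdvd.
Qed.

(** Both sequences are hypergeometric in e, and in characteristic l = 12N+1+4r+6s their ratios of
    consecutive terms differ by the constant factor 27/4. *)
Lemma hasse_legendre (K : fieldType) N r s : (r <= 1)%N -> (s <= 1)%N ->
  (12 * N + 1 + 4 * r + 6 * s)%N \in [pchar K] -> exists lam : K, forall e, (e <= N)%N ->
    (hasse_coef N r s e)%:R = lam * (legendre_coef N s e)%:R * (4%:R ^+ (N - e) * 27%:R ^+ e).
Proof.
move=> r1 s1 chl; have lpr := pcharf_prime chl; have l0 := pcharf0 chl.
have natf_neq0 n : (0 < n)%N -> (n < 12 * N + 1 + 4 * r + 6 * s)%N -> n%:R != 0 :> K.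
  by move=> n0 ltn; rewrite -(dvdn_pcharf chl) gtnNdvd.
have T0 : (legendre_coef N s 0)%:R != 0 :> K.
  have := pcharf_fact_neq0 (n := (2 * (N + 0 + s))%N) chl ltac:(have := prime_gt1 lpr; lia).
  by rewrite -legendre_coef_fact // natrM mulf_eq0 negb_or => /andP[].
have n4 : 4%:R != 0 :> K.
  rewrite -(dvdn_pcharf chl) (Euclid_dvdX 2 2 lpr) andbT.
  by apply/negP=> /dvdn_leq; have := prime_gt1 lpr; lia.
exists ((hasse_coef N r s 0)%:R / ((legendre_coef N s 0)%:R * 4%:R ^+ N)).
elim=> [|e IHe] leN; first by rewrite subn0 expr0 mulr1 -mulrA mulfVK // mulf_neq0 ?expf_neq0.
have {}IHe := IHe (ltnW leN); set lam := _ / _ in IHe *; clearbody lam.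
have [w wE] : exists w, N = (e + w).+1 by exists (N - e.+1)%N; lia.
have Ne : (N - e = w.+1)%N by lia.
have Ne1 : (N - e.+1 = w)%N by lia.
have E1 : (3 * (3 * N + r + 2 * s + e).+1 + (1 + r + 3 * w) = 12 * N + 1 + 4 * r + 6 * s)%N by lia.
have E2 : (3 * (2 * (N + e + s)).+1 + (4 + 4 * r + 6 * w) = 12 * N + 1 + 4 * r + 6 * s)%N by lia.
have rM := hasse_coef_rec r s e w; have rT := legendre_coef_rec s e w.
rewrite /= -wE in rM rT.
have q0 : ((3 * N + r + 2 * s + e).+1 * ((s + 2 * e).+1 * (s + 2 * e).+2))%:R != 0 :> K.
  by rewrite !natrM !mulf_neq0 // natf_neq0 //; lia.
apply: (mulIf q0); rewrite -natrM rM natrM IHe.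
move: (legendre_coef N s e.+1) (legendre_coef N s e) rT => t2 t1 /(congr1 (fun n => n%:R : K)) rT.
rewrite (natrM K t2) (natrM K t1) in rT.
rewrite Ne Ne1.
rewrite (natrM _ (3 * N + r + 2 * s + e).+1) !exprS.
transitivity (lam * (4%:R ^+ w * 27%:R ^+ e) * (27%:R * (3 * N + r + 2 * s + e).+1%:R) *
  (t1%:R * (2 * (2 * (N + e + s)).+1 * w.+1)%:R)); last by rewrite -rT; ring.
transitivity (lam * (4%:R ^+ w * 27%:R ^+ e) * t1%:R *
  (4%:R * ((r + 3 * w).+3 * (r + 3 * w).+2 * (r + 3 * w).+1)%:R)); first by ring.
rewrite -[LHS]mulrA -[RHS]mulrA; congr (_ * _).
rewrite (natrM K (2 * (2 * (N + e + s)).+1)) (natrM K 2).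
move: E1 E2; move: (3 * N + r + 2 * s + e).+1 (2 * (N + e + s)).+1 => i m E1 E2.
have {}E1 : 3%:R * i%:R = - (1 + r + 3 * w)%:R :> K.
  by apply/eqP; rewrite -(natrM K) -addr_eq0 -natrD E1 l0.
have {}E2 : 3%:R * m%:R = - (4 + 4 * r + 6 * w)%:R :> K.
  by apply/eqP; rewrite -(natrM K) -addr_eq0 -natrD E2 l0.
transitivity ((t1%:R : K) * (6%:R * w.+1%:R) * ((3%:R * i%:R) * (3%:R * m%:R))); last by ring.
(* For r = 0 or 1, the three consecutive integers are 3(w+1), 1+r+3w and 2+2r+3w in some order. *)
rewrite E1 E2 {E1 E2}; case: r r1 {chl lpr l0 natf_neq0 T0 IHe rM q0} => [|[|//]] _ /=; ring.
Qed.

Lemma hasse_formula (K : fieldType) N r s (c4 c6 disc : K) : (r <= 1)%N -> (s <= 1)%N ->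
  (12 * N + 1 + 4 * r + 6 * s)%N \in [pchar K] -> c4 ^+ 3 - c6 ^+ 2 = 1728%:R * disc ->
  exists lam : K,
  (('X^3 - (27%:R * c4) *: 'X + (54%:R * c6)%:P) ^+ (6 * N + 2 * r + 3 * s))`_(2 * (6 * N + 2 * r + 3 * s)) =
  lam * (c4 ^+ r * c6 ^+ s * \sum_(k < N.+1)
    ('C(2 * N + s, 2 * k + s) * 'C(2 * N - 2 * k, N - k))%:R * (- 432%:R) ^+ (N - k) *
    ((c6 ^+ 2) ^+ k * disc ^+ (N - k))).
Proof.
move=> r1 s1 chl discE; have [lam lamE] := hasse_legendre r1 s1 chl.
rewrite -scaleNr coef_cubic_exp //.
(* The constant m satisfies 4 * 27 B^2 = m * c6^2; then 4 A^3 + 27 B^2 = m * (-432 disc), which is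
   the origin of -432 = -1728/4 in J_l. *)
set A := - (27%:R * c4); set B := 54%:R * c6; set m : K := 16%:R * 27%:R ^+ 3.
exists (lam * ((- 27%:R) ^+ r * 54%:R ^+ s * 2%:R ^+ s * m ^+ N)).
have uv : 4%:R * A ^+ 3 + 27%:R * B ^+ 2 = m * (- 432%:R * disc).
  transitivity (- (4%:R * 27%:R ^+ 3) * (c4 ^+ 3 - c6 ^+ 2)); first by rewrite /A /B; ring.
  by rewrite discE /m; ring.
have v4 : 4%:R * (27%:R * B ^+ 2) = m * c6 ^+ 2 by rewrite /B /m; ring.
transitivity (lam * (A ^+ r * B ^+ s) * (\sum_(e < N.+1) (legendre_coef N s e)%:R *
   ((4%:R * A ^+ 3) ^+ (N - e) * (27%:R * B ^+ 2) ^+ e))).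
  rewrite mulr_sumr; apply: eq_bigr => e _; rewrite lamE; last by rewrite -ltnS.
  rewrite (exprD A r) (exprD B s) (exprM A 3) (exprM B 2).
  rewrite (exprMn (N - e) 4%:R) (exprMn e 27%:R).
  move: (A ^+ 3 ^+ (N - e)) (B ^+ 2 ^+ e) => x y; move: (N - e)%N => w; ring.
have Ar : A ^+ r = (- 27%:R) ^+ r * c4 ^+ r by rewrite -exprMn /A mulNr.
have Bs : B ^+ s = 54%:R ^+ s * c6 ^+ s by rewrite -exprMn.
rewrite -legendre_expand // uv v4 Ar Bs; clearbody m.
set S1 := \sum_(k < N.+1) _; set S2 := \sum_(k < N.+1) _.
suff -> : S1 = m ^+ N * S2.
  by move: (_ ^+ r) (54%:R ^+ s) (2%:R ^+ s) => x y z; ring.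
rewrite mulr_sumr; apply: eq_bigr => k _.
have mN : m ^+ N = m ^+ k * m ^+ (N - k) by rewrite -exprD subnKC // -ltnS.
rewrite mN !(exprMn k, exprMn (N - k)); move: (N - k)%N => w.
ring.
Qed.

(** * Legendre symbols and the residue of l modulo 12 *)

Lemma finField_expf_neq1 (F : finFieldType) m : (0 < m < #|F|.-1)%N ->
  exists2 x : F, x != 0 & x ^+ m != 1.
Proof.
case/andP=> m0 ltm; pose A := [pred x : F | x != 0].
have cardA : size (enum A) = #|F|.-1.
  by rewrite -cardE -(cardC1 (0 : F)); apply: eq_card => x; rewrite !inE.
have [all1|/allPn[x]] := boolP (all m.-unity_root (enum A)).
  by have := max_unity_roots m0 all1 (enum_uniq _); rewrite cardA leqNgt ltm.
by rewrite mem_enum unity_rootE => x0 xm; exists x.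
Qed.

Section LegendreSymbols.
Variable l : nat.
Hypotheses (lpr : prime l) (l2 : l != 2%N) (l3 : l != 3%N).

Let gt3 : (3 < l)%N.
Proof. by case: l lpr l2 l3 => [|[|[|[|]]]]. Qed.

Let natf_neq0 n : (0 < n)%N -> (n < l)%N -> n%:R != 0 :> 'F_l.
Proof. by move=> n0 ltn; rewrite -(dvdn_pcharf (pchar_Fp lpr)) gtnNdvd. Qed.

Let frob (x : 'F_l) : x ^+ l = x.
Proof. by rewrite -[X in x ^+ X](card_Fp lpr) expf_card. Qed.

(** Square roots of -3 are the 2w + 1 with w a primitive cube root of unity, and such w exist in F_l
    exactly when 3 divides l - 1. *)
Lemma sqrN3_mod3 : [exists x : 'F_l, x ^+ 2 == (-3)%:~R] = (l %% 3 == 1)%N.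
Proof.
have n2 : 2%:R != 0 :> 'F_l by apply: natf_neq0 => //; lia.
have n3 : 3%:R != 0 :> 'F_l by apply: natf_neq0 => //; lia.
apply/idP/idP=> [/existsP[x /eqP sqx] | /eqP l1].
  have l30 : (l %% 3 != 0)%N.
    by rewrite -[(_ %% _)%N == _]/(3 %| l)%N dvdn_prime2 // eq_sym.
  apply: contraT => l31; have l32 : (l = 3 * (l %/ 3) + 2)%N.
    by have := divn_eq l 3; have := ltn_mod l 3; lia.
  pose w := (x - 1) / 2%:R.
  have w3 : w ^+ 2 = - 1 - w.
    apply: (mulIf (mulf_neq0 n2 n2)); rewrite /w.
    have -> : ((x - 1) / 2%:R) ^+ 2 * (2%:R * 2%:R) = x ^+ 2 - 2%:R * x + 1 :> 'F_l by field.
    by rewrite sqx; field.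
  have ww : w ^+ 3 = 1 by rewrite exprSr w3 mulrBl -expr2 w3; ring.
  have : w ^+ (3 * (l %/ 3) + 2) = w by rewrite -l32 frob.
  rewrite exprD exprM ww expr1n mul1r w3 => e.
  case/eqP: n3; have -> : 3%:R = 4%:R * (w ^+ 2 - (- 1 - w)) + (- 1 - w - w) * (1 + 2%:R * w) :> 'F_l by ring.
  by rewrite w3 subrr e subrr mulr0 mul0r addr0.
have [|x x0 x1] := finField_expf_neq1 (F := 'F_l) (m := (l %/ 3)%N).
  by rewrite card_Fp //; lia.
pose w := x ^+ (l %/ 3); apply/existsP; exists (2%:R * w + 1).
have w3 : w ^+ 3 = 1.
  apply: (mulIf x0); rewrite mul1r -exprM -exprSr -[RHS]frob; congr (_ ^+ _).
  by have := divn_eq l 3; lia.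
have : (w - 1) * (w ^+ 2 + w + 1) = 0 by rewrite -[RHS](subrr 1) -[X in _ = X - _]w3; ring.
move/eqP; rewrite mulf_eq0 subr_eq0 (negbTE x1) /= => /eqP e.
have -> : (2%:R * w + 1) ^+ 2 = 4%:R * (w ^+ 2 + w + 1) - 3%:R by ring.
by rewrite e mulr0 sub0r.
Qed.

Lemma sqrN4_mod4 : [exists x : 'F_l, x ^+ 2 == (-4)%:~R] = (l %% 4 == 1)%N.
Proof.
have n2 : 2%:R != 0 :> 'F_l by apply: natf_neq0 => //; lia.
apply/idP/idP=> [/existsP[x /eqP sqx] | /eqP l1].
  have l40 : ~~ (2 %| l)%N by rewrite dvdn_prime2 // eq_sym.
  apply: contraT => l31; have l43 : (l = 4 * (l %/ 4) + 3)%N.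
    by have := divn_eq l 4; have := ltn_mod l 4; lia.
  pose w := x / 2%:R.
  have w2 : w ^+ 2 = - 1.
    apply: (mulIf (mulf_neq0 n2 n2)); rewrite /w.
    have -> : (x / 2%:R) ^+ 2 * (2%:R * 2%:R) = x ^+ 2 :> 'F_l by field.
    by rewrite sqx; ring.
  have w4 : w ^+ 4 = 1 by rewrite (exprM w 2 2) w2; ring.
  have : w ^+ (4 * (l %/ 4) + 3) = w by rewrite -l43 frob.
  rewrite exprD exprM w4 expr1n mul1r exprSr w2 mulN1r => /eqP.
  rewrite eq_sym -addr_eq0 -mulr2n -mulr_natl mulf_eq0 (negbTE n2) /= => /eqP w0.
  by move/eqP: w2; rewrite w0 expr0n /= eq_sym oppr_eq0 oner_eq0.
have [|x x0 x1] := finField_expf_neq1 (F := 'F_l) (m := (l %/ 2)%N).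
  by rewrite card_Fp //; lia.
pose w := x ^+ (l %/ 4); apply/existsP; exists (2%:R * w).
have w2 : w ^+ 2 = x ^+ (l %/ 2) by rewrite -exprM; congr (_ ^+ _); lia.
have w4 : w ^+ 4 = 1.
  apply: (mulIf x0); rewrite mul1r -exprM -exprSr -[RHS]frob; congr (_ ^+ _).
  by have := divn_eq l 4; lia.
have : (w ^+ 2 - 1) * (w ^+ 2 + 1) = 0 by rewrite -[RHS](subrr 1) -[X in _ = X - _]w4; ring.
move/eqP; rewrite mulf_eq0 subr_eq0 w2 (negbTE x1) /= addr_eq0 -w2 => /eqP e.
by rewrite exprMn e; apply/eqP; ring.
Qed.

(** r and s detect l modulo 3 and modulo 4, and 1 + 4r + 6s is the residue of l modulo 12. *)
Lemma hasse_exponents : [/\ (r_l l <= 1)%N, (s_l l <= 1)%N &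
  l = (12 * n_l l + 1 + 4 * r_l l + 6 * s_l l)%N].
Proof.
have n2 : ~~ (2 %| l)%N by rewrite dvdn_prime2 // eq_sym.
have n3 : ~~ (3 %| l)%N by rewrite dvdn_prime2 // eq_sym.
have nd3 : ((-3 %% l%:Z)%Z == 0) = false.
  by apply/negbTE/negP => /eqP/dvdz_mod0P; rewrite dvdzE /= dvdn_prime2 // (negbTE l3).
have nd4 : ((-4 %% l%:Z)%Z == 0) = false.
  by apply/negbTE/negP => /eqP/dvdz_mod0P; rewrite dvdzE /= (Euclid_dvdX 2 2 lpr) dvdn_prime2 // (negbTE l2).
rewrite /r_l /s_l /n_l /legendre nd3 nd4 sqrN3_mod3 sqrN4_mod4.
case: eqP => l_3; case: eqP => l_4 /=; rewrite ?subrr /=; split=> //; lia.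
Qed.

End LegendreSymbols.

(** * Degrees of the irreducible factors *)

Lemma irreducible_root_dvdp (F K : fieldType) (io : {rmorphism F -> K}) (p g : {poly F}) (d : K) :
  irreducible_poly p -> root (map_poly io p) d -> root (map_poly io g) d -> p %| g.
Proof.
case=> _ irr rp /rootP rg; have [cop|] := boolP (coprimep p g).
  by have := coprimep_root (etrans (coprimep_map io p g) cop) rp; rewrite rg eqxx.
rewrite /coprimep => /irr -/(_ (dvdp_gcdl p g)) /andP[_ /dvdp_trans]; apply; exact: dvdp_gcdr.
Qed.

Section RootDegree.
Variables (l : nat) (K : fieldType) (io : {rmorphism 'F_l -> K}) (p : {poly 'F_l}) (d : K).
Hypotheses (lpr : prime l) (pirr : irreducible_poly p) (rpd : root (map_poly io p) d).
Local Notation n := (size p).-1.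

Let pcharKl : l \in [pchar K].
Proof. by rewrite inE lpr -(rmorph_nat io) (pcharf0 (pchar_Fp lpr)) rmorph0 eqxx. Qed.

Let horner_expn (g : {poly 'F_l}) e : (map_poly io g).[d] ^+ (l ^ e) = (map_poly io g).[d ^+ (l ^ e)].
Proof.
elim: e => [|e IHe]; first by rewrite !expr1.
rewrite expnS mulnC exprM IHe [in RHS]exprM; move: (d ^+ _) => x.
rewrite -!(pFrobenius_autE pcharKl) -horner_map /= -map_poly_comp; congr (_.[_]).
apply: eq_map_poly => a /=; rewrite pFrobenius_autE -rmorphXn; congr (io _).
by rewrite -[X in a ^+ X](card_Fp lpr) expf_card.
Qed.

(** In the field F_l[X]/(p), which has l^n elements, the class of X is fixed by the power l^n; so p
    divides X^(l^n) - X. *)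
Lemma root_expn_degree : d ^+ (l ^ n) = d.
Proof.
have p0 : p != 0 by apply: irredp_neq0.
pose h := (lead_coef p)^-1 *: p.
have hp : h %= p by rewrite eqp_scale // invr_eq0 lead_coef_eq0.
have hI : monic_irreducible_poly h.
  split; last by rewrite monicE lead_coefZ mulVf // lead_coef_eq0.
  case: pirr => sp irr; split; first by rewrite (eqp_size hp).
  by move=> q sq qh; rewrite (eqp_rtrans hp) irr // -(eqp_dvdr _ hp).
pose x : {poly %/ h with hI} := in_qpoly h 'X.
have xE : in_qpoly h ('X ^+ (l ^ n)) = in_qpoly h 'X.
  have : x ^+ #|{poly %/ h with hI}| = x := expf_card x.
  rewrite card_qfpoly card_Fp // (eqp_size hp) => xq.
  transitivity (x ^+ (l ^ n)); first exact: rmorphXn.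
  exact: xq.
have /dvdpP[u uE] : h %| 'X^(l ^ n) - 'X.
  have : in_qpoly h ('X^(l ^ n) - 'X) = 0 by rewrite linearB /= xE subrr.
  have hM : h \is monic by case: (hI).
  by move/(congr1 val); rewrite /= -Pdiv.IdomainMonic.modpE mk_monicE // => /eqP.
have rh : root (map_poly io h) d by rewrite map_polyZ rootZ // fmorph_eq0 invr_eq0 lead_coef_eq0.
have : ((map_poly io) ('X^(l ^ n) - 'X)).[d] = 0 by rewrite uE rmorphM hornerM (rootP rh) mulr0.
rewrite rmorphB /= map_polyXn map_polyX hornerD hornerN hornerXn hornerX => /eqP.
by rewrite subr_eq0 => /eqP.
Qed.

(** With e the remainder of m modulo n, the power l^e fixes d and hence all l^n elements of F_l[d].
    For 0 < e < n these are too many roots for X^(l^e) - X. *)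
Lemma root_expn_dvdn m : d ^+ (l ^ m) = d -> (n %| m)%N.
Proof.
move=> dm; have n0 : (0 < n)%N by case: pirr => sp _; rewrite -subn1 subn_gt0.
have dX e j : d ^+ (l ^ e) = d -> d ^+ (l ^ (e * j)) = d.
  by move=> de; elim: j => [|j IHj]; rewrite ?muln0 // mulnS expnD exprM de.
have {dm} : d ^+ (l ^ (m %% n)) = d.
  by rewrite -[RHS]dm {2}(divn_eq m n) expnD exprM mulnC dX // root_expn_degree.
rewrite /dvdn; move: (m %% n)%N (ltn_pmod m n0) => e lt_en de.
apply/eqP; case: (posnP e) => // e0.
pose ev (v : 'rV['F_l]_n) : K := (map_poly io (rVpoly v)).[d].
have ev_inj : injective ev.
  move=> v w /eqP; rewrite -subr_eq0 /ev -hornerN -hornerD -rmorphB -raddfB /= => r0.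
  have /dvdp_leq le_p := irreducible_root_dvdp pirr rpd r0.
  apply/eqP; rewrite -subr_eq0; apply: contraT => vw0.
  have /le_p : rVpoly (v - w) != 0 by apply: contra vw0 => /eqP r; rewrite -(rVpolyK (v - w)) r raddf0.
  by rewrite leqNgt => /negP[]; apply: leq_ltn_trans (size_poly _ _) _; rewrite -[X in (_ < X)%N]prednK ?ltnS //; move: n0; case: (size p).
pose g := 'X^(l ^ e) - 'X : {poly K}.
have le1 : (1 < l ^ e)%N by rewrite -(exp1n e) ltn_exp2r // prime_gt1.
have sg : size g = (l ^ e).+1 by rewrite size_polyDl ?size_polyXn // size_polyN size_polyX.
have g0 : g != 0 by rewrite -size_poly_eq0 sg.
have rootg v : root g (ev v).
  by rewrite rootE !(hornerD, hornerN, hornerXn, hornerX) /ev horner_expn de subrr.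
have := max_poly_roots (rs := [seq ev v | v : 'rV['F_l]_n]) g0.
rewrite (map_inj_uniq ev_inj) enum_uniq size_map -cardE card_mx card_Fp // mul1n sg ltnS.
have -> : all (root g) [seq ev v | v : 'rV['F_l]_n] by apply/allP=> _ /mapP[v _ ->].
by move/(_ isT isT); rewrite leq_exp2l ?prime_gt1 // leqNgt lt_en.
Qed.

End RootDegree.

(** * The Hasse invariant evaluated at a root *)

Lemma tate_c4E l : tate_c4 'X = q1 l * q2 l.
Proof. by rewrite /tate_c4 /q1 /q2 -!mul_polyC; ring. Qed.

Lemma tate_c6E l : tate_c6 'X = f2 l.
Proof. by rewrite /tate_c6 /f2 -!mul_polyC; ring. Qed.

Lemma tate_den7E l : tate_disc 'X = den7 l.
Proof. by rewrite /tate_disc /den7 /c7 -!mul_polyC; ring. Qed.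

(** This is the relation j - 1728 = c_6^2 / disc. *)
Lemma num7_sub l : num7 l - 1728%:R *: den7 l = tate_c6 'X ^+ 2.
Proof.
rewrite /num7 -tate_c4E -tate_den7E -mul_polyC polyC_natr -(tate_discE 'X); ring.
Qed.

Lemma Hhat7_horner l (K : fieldType) (io : {rmorphism 'F_l -> K}) (d : K) :
  (map_poly io (Hhat7 l)).[d] = tate_c4 d ^+ r_l l * tate_c6 d ^+ s_l l *
    \sum_(k < (n_l l).+1)
    ('C(2 * n_l l + s_l l, 2 * k + s_l l) * 'C(2 * n_l l - 2 * k, n_l l - k))%:R *
    (- 432%:R) ^+ (n_l l - k) * ((tate_c6 d ^+ 2) ^+ k * tate_disc d ^+ (n_l l - k)).
Proof.
have cd : commr_rmorph io d by move=> a; apply: mulrC.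
pose phi : {rmorphism {poly 'F_l} -> K} := horner_morph cd.
have phiX : phi 'X = d by apply: horner_morphX.
have phiC a : phi a%:P = io a by apply: horner_morphC.
rewrite -[LHS]/(phi (Hhat7 l)) /Hhat7 -exprMn -tate_c4E -tate_c6E.
clearbody phi.
rewrite (rmorphM phi (_ * _)) (rmorphM phi (_ ^+ _)) (rmorphXn phi (r_l l)) (rmorphXn phi (s_l l)).
rewrite -!(rmorph_tate_c4 phi) -!(rmorph_tate_c6 phi) phiX; congr (_ * _).
rewrite /JdenJ7 big_mkord (rmorph_sum phi); apply: eq_bigr => k _.
rewrite num7_sub -tate_den7E -mul_polyC (rmorphM phi _%:P) (rmorphM phi (_ ^+ k)).
rewrite (rmorphXn phi k) (rmorphXn phi (n_l l - k)) (rmorphXn phi 2).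
rewrite -!(rmorph_tate_c6 phi) -!(rmorph_tate_disc phi) phiX phiC /Jcoef.
by rewrite (rmorphM io _%:R) rmorph_nat (rmorphXn io (n_l l - k)) rmorphN rmorph_nat.
Qed.

(* The resultant of [c4] and the cubic factor of the discriminant is a power of 7. *)
Lemma tate_c4_neq0 (K : fieldType) (d : K) : 7%:R != 0 :> K -> tate_disc d = 0 -> tate_c4 d != 0.
Proof.
move=> n7 /eqP; rewrite /tate_disc (mulf_eq0 (_ * _)) (mulf_eq0 (_ ^+ 7)) !expf_eq0 /= subr_eq0 -orbA.
case/or3P=> /eqP e; [rewrite e | rewrite e | apply: contraNneq n7 => c4].
- by rewrite (_ : tate_c4 (0 : K) = 1) ?oner_neq0 // /tate_c4; ring.
- by rewrite (_ : tate_c4 (1 : K) = 1) ?oner_neq0 // /tate_c4; ring.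
have : 7%:R * 7%:R = 0 :> K.
  transitivity ((1710%:R + 3005%:R * d - 444%:R * d ^+ 2) * tate_c4 d +
    (- 1661%:R - 1540%:R * d + 6776%:R * d ^+ 2 - 693%:R * d ^+ 3 - 6853%:R * d ^+ 4
     + 12530%:R * d ^+ 5 - 4781%:R * d ^+ 6 + 444%:R * d ^+ 7) *
    (d ^+ 3 - 8%:R * d ^+ 2 + 5%:R * d + 1)); first by rewrite /tate_c4; ring.
  by rewrite c4 e !mulr0 addr0.
by move/eqP; rewrite mulf_eq0 orbb.
Qed.

Lemma Hhat7_root l k (K : fieldType) (io : {rmorphism 'F_l -> K}) (d : K) :
  prime l -> l != 3%N -> l != 7%N -> l = (2 * k + 3)%N -> root (map_poly io (Hhat7 l)) d ->
  tate_disc d != 0 /\ (tate_cubic d ^+ k.+1)`_(2 * k + 2) = 0.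
Proof.
move=> lpr l3 l7 lE; rewrite /root Hhat7_horner => /eqP Hd.
have chl : l \in [pchar K].
  by rewrite inE lpr -(rmorph_nat io) (pcharf0 (pchar_Fp lpr)) rmorph0 eqxx.
have l2 : l != 2%N by lia.
have [r1 s1 lE'] := hasse_exponents lpr l2 l3.
move: (r_l l) (s_l l) (n_l l) r1 s1 lE' Hd => r s N r1 s1 lE' Hd; split.
  apply/eqP=> disc0.
  have n7 : 7%:R != 0 :> K by rewrite -(dvdn_pcharf chl) dvdn_prime2.
  have c4 := tate_c4_neq0 n7 disc0.
  have c6 : tate_c6 d != 0.
    apply: contraNneq c4 => c6; have := tate_discE d.
    by rewrite disc0 c6 expr0n subr0 mulr0 => /eqP; rewrite expf_eq0.
  (* If the discriminant vanished, only the term k = N would survive, a product of powers of c_4 and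
     c_6, both nonzero. *)
  move/eqP: Hd; rewrite big_ord_recr /= big1 ?add0r => [|i _]; last first.
    by rewrite disc0 [0 ^+ _]expr0n subn_eq0 leqNgt ltn_ord !mulr0.
  rewrite !subnn !binn muln1 !expr0 !mulr1 mul1r.
  by rewrite !mulf_eq0 !expf_eq0 (negbTE c4) (negbTE c6) !andbF.
have chl' : (12 * N + 1 + 4 * r + 6 * s)%N \in [pchar K] by rewrite -lE'.
have n1 : (6 * N + 2 * r + 3 * s = k.+1)%N by lia.
have n2 : (2 * k.+1 = 2 * k + 2)%N by lia.
have [lam] := hasse_formula r1 s1 chl' (tate_discE d).
by rewrite Hd mulr0 -[_ + _%:P]/(tate_cubic d) n1 n2.
Qed.

(* The homography [x |-> (x - 1) / x] has order 3. *)
Lemma homography_order3 (K : fieldType) (a b c e : K) :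
  a * b = a - 1 -> b * c = b - 1 -> c * e = c - 1 -> e = a.
Proof.
move=> ab bc ce.
have abc : a * (b * c) = - 1 by rewrite bc mulrBr ab; ring.
have bce : b * c * e = - 1 by rewrite -mulrA ce mulrBr bc; ring.
have bc0 : b * c != 0.
  by apply/eqP=> bc0; move/eqP: bce; rewrite bc0 mul0r eq_sym oppr_eq0 oner_eq0.
by apply: (mulfI bc0); rewrite bce mulrC abc.
Qed.

(** The l^2-power map commutes with homographies over the prime field; acting on d as one of order
    3, its cube fixes d. *)
Lemma frob6_of_homography (K : fieldType) l (d : K) : l \in [pchar K] ->
  d * (d ^+ l) ^+ l = d - 1 \/ (1 - d) * (d ^+ l) ^+ l = 1 -> d ^+ (l ^ 6) = d.
Proof.
move=> chl; pose phi (x : K) := (x ^+ l) ^+ l; rewrite -[(d ^+ l) ^+ l]/(phi d).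
have phiM x y : phi (x * y) = phi x * phi y by rewrite /phi !exprMn.
have phiB x y : phi (x - y) = phi x - phi y by rewrite /phi -!(pFrobenius_autE chl) !rmorphB.
have phi1 : phi 1 = 1 by rewrite /phi !expr1n.
have -> : d ^+ (l ^ 6) = phi (phi (phi d)) by rewrite /phi -!exprM; congr (_ ^+ _); ring.
have [b bE] : exists b, phi d = b by exists (phi d).
have [c cE] : exists c, phi b = c by exists (phi b).
rewrite bE cE => -[] h1.
  have h2 : b * c = b - 1 by have := congr1 phi h1; rewrite phiM phiB phi1 bE cE.
  have h3 : c * phi c = c - 1 by have := congr1 phi h2; rewrite phiM phiB phi1 cE.
  exact: homography_order3 h1 h2 h3.
have h2 : (1 - b) * c = 1 by have := congr1 phi h1; rewrite phiM phiB phi1 bE cE.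
have h3 : (1 - c) * phi c = 1 by have := congr1 phi h2; rewrite phiM phiB phi1 cE.
(* x |-> 1/(1-x) is inverse to x |-> (x-1)/x, so the orbit is read backwards. *)
symmetry; apply: (@homography_order3 _ (phi c) c b d).
- by rewrite -[in RHS]h3; ring.
- by rewrite -[in RHS]h2; ring.
- by rewrite -[in RHS]h1; ring.
Qed.

Theorem theorem5p2 (l : nat) :
  prime l -> l != 2%N -> l != 3%N -> l != 7%N ->
  forall p : {poly 'F_l}, irreducible_poly p -> p %| Hhat7 l ->
    [/\ (l %% 7 = 1)%N -> size p = 3%N,
        (l %% 7 = 6)%N -> size p = 2%N \/ size p = 3%N,
        (l %% 7 = 2)%N \/ (l %% 7 = 4)%N ->
           p %= q1 l \/ size p = 7%N
      & (l %% 7 = 3)%N \/ (l %% 7 = 5)%N ->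
           [\/ p %= q1 l, size p = 4%N | size p = 7%N]].
Proof.
move=> lpr l2 l3 l7 p pirr pH.
have [K [io _]] := countable_algebraic_closure 'F_l.
have [d rpd] : exists d : K, root (map_poly io p) d.
  by apply: closed_rootP; rewrite size_map_poly; case: pirr => sp _; rewrite neq_ltn sp orbT.
have l_gt3 : (3 < l)%N by case: l lpr l2 l3 {l7 p pirr pH K io d rpd} => [|[|[|[|]]]].
pose k := (l - 3)./2.
have lE : l = (2 * k + 3)%N.
  have : ~~ (2 %| l)%N by rewrite dvdn_prime2 // eq_sym.
  by rewrite /k; lia.
have k_gt0 : (0 < k)%N by lia.
have rHd : root (map_poly io (Hhat7 l)) d.
  by have /dvdpP[u ->] := pH; rewrite rmorphM rootM rpd orbT.
have [disc0 hasse0] := Hhat7_root lpr l3 l7 lE rHd.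
have chl : l \in [pchar K].
  by rewrite inE lpr -(rmorph_nat io) (pcharf0 (pchar_Fp lpr)) rmorph0 eqxx.
have chk : (2 * k + 3)%N \in [pchar K] by rewrite -lE.
have l_mod7 : (l %% 7 != 0)%N by rewrite -[(_ %% _)%N == _]/(7 %| l)%N dvdn_prime2 // eq_sym.
have l_mod7' := l_mod7; rewrite {1}lE in l_mod7'.
have := order7_ratio chk k_gt0 disc0 hasse0 l_mod7'.
have := order7_degree1 chk k_gt0 disc0 hasse0 l_mod7'.
have := order7_degree3 chk k_gt0 disc0 hasse0 l_mod7'.
rewrite -lE => deg3 deg1 [ratio1 ratio2 ratio3] {l_mod7' hasse0 chk}.
have frob_n := root_expn_degree lpr pirr rpd.
have dvd_n m : d ^+ (l ^ m) = d -> ((size p).-1 %| m)%N := @root_expn_dvdn _ _ _ _ _ lpr pirr rpd m.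
have sp1 : (1 < size p)%N by case: pirr.
have sq1 : size (q1 l) = 3%N.
  rewrite /q1 -addrA size_polyDl ?size_polyXn // (leq_ltn_trans (size_polyD _ _)) //.
  by rewrite size_polyN size_polyX size_poly1.
(* In degree 2, d^(l^2) = d is a fixed point of the homography; either homography has d^2 - d + 1 =
   0 as its equation of fixed points. *)
have deg2 : size p = 3%N -> d * (d ^+ l) ^+ l = d - 1 \/ (1 - d) * (d ^+ l) ^+ l = 1 -> p %= q1 l.
  move=> sp; move: frob_n; rewrite sp /= (expnD l 1 1) exprM => -> h.
  rewrite -dvdp_size_eqp ?sp ?sq1 //.
  apply: (irreducible_root_dvdp pirr rpd).
  rewrite rootE /q1 rmorphD rmorphB /= map_polyXn map_polyX rmorph1.
  rewrite !(hornerD, hornerN, hornerXn, hornerX) hornerC; apply/eqP.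
  case: h => h; first by rewrite (_ : _ + 1 = d * d - (d - 1)); [rewrite h subrr|ring].
  by rewrite (_ : _ + 1 = 1 - (1 - d) * d); [rewrite h subrr|ring].
have n1 : (l %% 7 != 6)%N -> size p != 2%N.
  move=> l6; apply: contraNneq (deg1 l6) => sp; move: frob_n; rewrite sp expn1 => ->.
  exact: eqxx.
have n3 : ((l %% 7 == 1) || ((l %% 7 == 2) || (l %% 7 == 4)))%N -> size p != 4%N.
  move=> /deg3; apply: contraNneq => sp; move: frob_n; rewrite sp /= (expnD l 1 2) (expnD l 1 1) !exprM => ->.
  exact: eqxx.
(* The degree divides 6, and degree 2 forces [q1]. *)
have n6 : d * (d ^+ l) ^+ l = d - 1 \/ (1 - d) * (d ^+ l) ^+ l = 1 ->
  [\/ size p = 2%N, p %= q1 l, size p = 4%N | size p = 7%N].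
  move=> h; have := dvd_n 6%N (frob6_of_homography chl h); have := deg2 ^~ h.
  case: (size p) sp1 => [|[|[|[|[|[|[|[|m]]]]]]]] //= _ dg _.
  - by constructor 1.
  - by constructor 2; apply: dg.
  - by constructor 3.
  - by constructor 4.
have n2 : (d ^+ l) ^+ l = d -> size p = 2%N \/ size p = 3%N.
  rewrite -exprM => /(dvd_n 2%N).
  by case: (size p) sp1 => [|[|[|[|m]]]] //= _ _; [left|right].
split=> l7E.
- move: ratio1 n1; rewrite l7E => /(_ isT)/n2[->|//].
  by move/(_ isT).
- by apply: n2; apply: ratio1; rewrite l7E.
- have h : d * (d ^+ l) ^+ l = d - 1 \/ (1 - d) * (d ^+ l) ^+ l = 1.
    by case: l7E => l7E; [left; apply: ratio2|right; apply: ratio3]; rewrite l7E.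
  have [sp|pq|sp|sp] := n6 h; [|by left| |by right].
    by move: n1; rewrite sp; case: l7E => -> /(_ isT).
  by move: n3; rewrite sp; case: l7E => -> /(_ isT).
have h : d * (d ^+ l) ^+ l = d - 1 \/ (1 - d) * (d ^+ l) ^+ l = 1.
  by case: l7E => l7E; [right; apply: ratio3|left; apply: ratio2]; rewrite l7E.
have [sp|pq|sp|sp] := n6 h; [|by constructor 1|by constructor 2|by constructor 3].
by move: n1; rewrite sp; case: l7E => -> /(_ isT).
Qed.
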